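(* Let $V$ be a finite-dimensional vector space, $R\subset V\otimes V$ a subspace, and let $S=T(V)/(R)$ be a quantum polynomial algebra of dimension $n\ge2$. Then $S$ is a Clifford quantum polynomial algebra if and only if there exists $w\in\mathrm{Sym}^n(V)$ such that $S=\mathcal D(w,n-2)$.
   Context: $k$ is an algebraically closed field of characteristic $0$; all algebras and vector spaces are over $k$. For graded right modules $M,N$ over a connected graded algebra $S$, $\underline{\mathrm{Ext}}^i_S(M,N)=\bigoplus_{j\in\mathbb Z}\mathrm{Ext}^i_{\mathrm{grmod}\,S}(M,N(j))$; $H_S(t)=\sum_i(\dim_k S_i)t^i$. A noetherian connected graded algebra $S$ is an $n$-dimensional quantum polynomial algebra if $\mathrm{gldim}\,S=n$, $\underline{\mathrm{Ext}}^i_S(k,S)\cong k(n)$ for $i=n$ and $0$ for $i\neq n$, and $H_S(t)=(1-t)^{-n}$. For a sequence $F=(F_1,\dots,F_n)$ of linearly independent symmetric matrices in $M_n(k)$, the graded Clifford algebra is $$C(F)=k\langle x_1,\dots,x_n,y_1,\dots,y_n\rangle/\Big(x_ix_j+x_jx_i-\sum_{m=1}^n(F_m)_{ij}y_m,\; x_iy_j-y_jx_i,\; y_iy_j-y_jy_i\Big)_{1\le i,j\le n},$$ with $\deg x_i=1$, $\deg y_j=2$. An $n$-dimensional Clifford quantum polynomial algebra is an $n$-dimensional quantum polynomial algebra isomorphic, as a graded algebra, to some $C(F)$. $\mathrm{Sym}^n(V)=\{w\in V^{\otimes n}\mid\theta(w)=w\ \forall\theta\in\mathfrak S_n\}$,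 with $\mathfrak S_n$ permuting tensor factors. For a subspace $W\subset V^{\otimes m}$, $\partial W=\{(\psi\otimes\mathrm{id}^{\otimes m-1})(w)\mid\psi\in V^*,w\in W\}$ (as a subspace of $V^{\otimes m-1}$, i.e. its span), $\partial^0W=W$, $\partial^{i+1}W=\partial(\partial^iW)$. For $w\in V^{\otimes n}$, the $i$-th order derivation quotient algebra is $\mathcal D(w,i)=T(V)/(\partial^i(kw))$. *)

(* Defs.v *)
From HB Require Import structures.
From mathcomp Require Import all_boot all_order all_algebra perm.
From mathcomp Require Import classical_sets.
From mathcomp Require Import finmap monalg.

Set Implicit Arguments.
Unset Strict Implicit.
Unset Printing Implicit Defensive.

Import GRing.Theory.
Local Open Scope classical_set_scope.
Local Open Scope ring_scope.

Section LinearAlgebra.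
Variables (k : fieldType) (M : lmodType k).

Definition subspace (W : set M) : Prop :=
  W 0 /\ forall (c : k) (x y : M), W x -> W y -> W (c *: x + y).

Definition linear_span (X : set M) : set M :=
  [set x | exists (r : nat) (c : 'I_r -> k) (y : 'I_r -> M),
     (forall i, X (y i)) /\ x = \sum_(i < r) c i *: y i].

Definition has_dim (W : set M) (r : nat) : Prop :=
  exists e : 'I_r -> M,
    W = [set x | exists c : 'I_r -> k, x = \sum_(i < r) c i *: e i] /\
    forall c : 'I_r -> k, \sum_(i < r) c i *: e i = 0 -> forall i, c i = 0.

End LinearAlgebra.

Definition direct_sum_decomposition (D : eqType) (M : zmodType)
    (gr : D -> set M) : Prop :=
  [/\ forall i, gr i 0,
      forall i x y, gr i x -> gr i y -> gr i (x - y),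
      forall x, exists (s : seq D) (f : D -> M),
        (forall i, gr i (f i)) /\ x = \sum_(i <- s) f i
    & forall (s : seq D) (f : D -> M), uniq s -> (forall i, gr i (f i)) ->
        \sum_(i <- s) f i = 0 -> forall i, i \in s -> f i = 0].

(* Right S-modules are the objects of lmodType S^c. *)

Section Rings.
Variable A : nzRingType.

Definition left_ideal (I : set A) : Prop :=
  I 0 /\ forall a x y : A, I x -> I y -> I (a * x + y).

Definition left_noetherian : Prop :=
  forall I : set A, left_ideal I ->
    exists (r : nat) (g : 'I_r -> A),
      (forall i, I (g i)) /\
      forall x, I x -> exists a : 'I_r -> A, x = \sum_(i < r) a i * g i.

Definition projective_module (P : lmodType A) : Prop :=
  forall (M N : lmodType A) (g : {linear M -> N}) (f : {linear P -> N}),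
    (forall y, exists x, g x = y) ->
    exists h : {linear P -> M}, forall x, g (h x) = f x.

(* Exactness of ... -> P 2 -> P 1 -> P 0 -> M -> 0. *)
Definition is_resolution (M : lmodType A) (P : nat -> lmodType A)
    (d : forall i, {linear P i.+1 -> P i}) (e : {linear P 0%N -> M}) : Prop :=
  [/\ forall y, exists x, e x = y,
      forall x, e x = 0 <-> exists y, d 0%N y = x
    & forall i x, d i x = 0 <-> exists y, d i.+1 y = x].

Definition pdim_le (M : lmodType A) (m : nat) : Prop :=
  exists (P : nat -> lmodType A) (d : forall i, {linear P i.+1 -> P i})
         (e : {linear P 0%N -> M}),
    [/\ forall i, projective_module (P i),
        is_resolution d e
      & forall i, (m < i)%N -> forall x : P i, x = 0].

Definition gldim_eq (n : nat) : Prop :=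
  (forall M : lmodType A, pdim_le M n) /\
  forall m, (forall M : lmodType A, pdim_le M m) -> (n <= m)%N.

End Rings.

Section GradedAlgebra.
Variables (k : fieldType) (S : algType k).

Definition noetherian : Prop := left_noetherian S /\ left_noetherian S^c.

Definition connected_graded (gr : nat -> set S) : Prop :=
  [/\ direct_sum_decomposition gr,
      forall i, subspace (gr i),
      forall i j a b, gr i a -> gr j b -> gr (i + j)%N (a * b)
    & gr 0%N = [set a | exists c : k, a = c%:A]].

Definition hilbert_function (gr : nat -> set S) (h : nat -> nat) : Prop :=
  forall i, has_dim (gr i) (h i).

(* Coefficient-wise form of H(t) (1 - t)^n = 1 in Z[[t]]. *)
Definition hilbert_series_eq_inv_pow (gr : nat -> set S) (n : nat) : Prop :=
  exists h : nat -> nat, hilbert_function gr h /\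
    forall m : nat,
      \sum_(j < m.+1) ((1 - 'X) ^+ n : {poly int})`_j * (h (m - j)%N)%:Z
        = (m == 0%N)%:Z.

Variable gr : nat -> set S.

(* right_act m a is the right action m . a. *)
Definition right_act (M : lmodType S^c) (m : M) (a : S) : M := (a : S^c) *: m.
Definition kscale (M : lmodType S^c) (c : k) (m : M) : M := right_act m c%:A.

Definition graded_module (M : lmodType S^c) (grM : int -> set M) : Prop :=
  direct_sum_decomposition grM /\
  forall i (j : nat) m a, grM i m -> gr j a -> grM (i + j%:Z) (right_act m a).

Definition shift (M : lmodType S^c) (j : int) (grM : int -> set M) :
  int -> set M := fun i => grM (j + i).

Definition graded_hom (M N : lmodType S^c) (grM : int -> set M)
    (grN : int -> set N) (f : {linear M -> N}) : Prop :=
  forall i m, grM i m -> grN i (f m).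

Definition graded_projective (P : lmodType S^c) (grP : int -> set P) : Prop :=
  graded_module grP /\
  forall (M N : lmodType S^c) (grM : int -> set M) (grN : int -> set N)
         (g : {linear M -> N}) (f : {linear P -> N}),
    graded_module grM -> graded_module grN ->
    graded_hom grM grN g -> graded_hom grP grN f ->
    (forall y, exists x, g x = y) ->
    exists h : {linear P -> M},
      graded_hom grP grM h /\ forall x, g (h x) = f x.

Definition graded_projective_resolution (M : lmodType S^c)
    (grM : int -> set M) (P : nat -> lmodType S^c)
    (grP : forall i, int -> set (P i))
    (d : forall i, {linear P i.+1 -> P i}) (e : {linear P 0%N -> M}) : Prop :=
  [/\ is_resolution d e,
      forall i, graded_projective (@grP i),
      graded_hom (@grP 0%N) grM e
    & forall i, graded_hom (@grP i.+1) (@grP i) (d i)].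

Section Ext.
Variables (P : nat -> lmodType S^c) (grP : forall i, int -> set (P i)).
Variable d : forall i, {linear P i.+1 -> P i}.
Variables (N : lmodType S^c) (grN : int -> set N).

Definition cocycle (i : nat) (f : {linear P i -> N}) : Prop :=
  graded_hom (@grP i) grN f /\ forall x, f (d i x) = 0.

Definition coboundary (i : nat) : {linear P i -> N} -> Prop :=
  match i return {linear P i -> N} -> Prop with
  | 0%N => fun f => forall x, f x = 0
  | j.+1 => fun f => exists g : {linear P j -> N},
      graded_hom (@grP j) grN g /\ forall x, f x = g (d j x)
  end.

Definition Ext_vanishes (i : nat) : Prop :=
  forall f, @cocycle i f -> coboundary f.

(* phi induces a k-linear isomorphism from cocycles modulo coboundaries onto *)
(* the subspace E of W. *)
Definition Ext_isomorphic (i : nat) (W : lmodType S^c) (E : set W) : Prop :=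
  exists phi : {linear P i -> N} -> W,
    [/\ forall f, cocycle f -> E (phi f),
        forall (c : k) f g h, cocycle f -> cocycle g -> cocycle h ->
          (forall x, h x = kscale c (f x) + g x) ->
          phi h = kscale c (phi f) + phi g,
        forall y, E y -> exists2 f, cocycle f & phi f = y
      & forall f, cocycle f -> (phi f = 0 <-> coboundary f)].

End Ext.

Definition regular_grading : int -> set (S^c)^o :=
  fun i => if i is Posz m then [set a : (S^c)^o | gr m (a : S)] else [set 0].

(* K is the graded module k = S / S_{>= 1}: one-dimensional, concentrated in *)
(* degree 0; this determines it up to isomorphism when S is connected graded. *)
Definition trivial_module (K : lmodType S^c) (grK : int -> set K) : Prop :=
  [/\ graded_module grK,
      grK 0 = setT
    & exists2 u : K, u != 0 & forall x, exists c : k, x = kscale c u].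

(* Ext^i(k, S) = (+)_j Ext^i_{GrMod S}(k, S(j)) is k(n) if i = n, 0 otherwise.*)
Definition gorenstein_condition (n : nat) : Prop :=
  exists (K : lmodType S^c) (grK : int -> set K)
         (P : nat -> lmodType S^c) (grP : forall i, int -> set (P i))
         (d : forall i, {linear P i.+1 -> P i}) (e : {linear P 0%N -> K}),
    [/\ trivial_module grK,
        graded_projective_resolution grK grP d e,
        forall j : int,
          Ext_isomorphic grP d (shift j regular_grading) n
            (shift n%:Z grK j)
      & forall i : nat, i != n -> forall j : int,
          Ext_vanishes grP d (shift j regular_grading) i].

Definition quantum_polynomial_algebra (n : nat) : Prop :=
  [/\ connected_graded gr,
      noetherian,
      gldim_eq S^c n,
      gorenstein_condition n
    & hilbert_series_eq_inv_pow gr n].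

End GradedAlgebra.

Definition graded_algebra_iso (k : fieldType) (S C : algType k)
    (grS : nat -> set S) (grC : nat -> set C) : Prop :=
  exists f : {lrmorphism S -> C},
    bijective f /\ forall i a, grS i a <-> grC i (f a).

Definition two_sided_ideal (A : nzRingType) (X : set A) : set A :=
  [set x | exists (r : nat) (a b y : 'I_r -> A),
     (forall i, X (y i)) /\ x = \sum_(i < r) a i * y i * b i].

(* pi exhibits S as the quotient of A by the two-sided ideal (X). *)
Definition presents (k : fieldType) (A : lalgType k) (S : algType k)
    (pi : {lrmorphism A -> S}) (X : set A) : Prop :=
  (forall a, exists x, pi x = a) /\
  forall x, pi x = 0 <-> two_sided_ideal X x.

Section FreeAlgebra.
Variables (k : fieldType) (I : choiceType).

Definition free_algebra : lalgType k := {malg k[{fmonom I}]}.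

Definition gen (i : I) : free_algebra := << fmu i >>.

(* Degree-m part of the free algebra when the generator i has degree wt i. *)
Definition free_grading (wt : I -> nat) (m : nat) : set free_algebra :=
  [set x : {malg k[{fmonom I}]} |
     forall u : {fmonom I}, u \in msupp x -> (\sum_(i <- u) wt i)%N = m].

Definition quotient_grading (S : algType k)
    (pi : {lrmorphism free_algebra -> S}) (wt : I -> nat) : nat -> set S :=
  fun m => [set pi x | x in free_grading wt m].

End FreeAlgebra.

Section TensorAlgebra.
Variables (k : fieldType) (V : vectType k).

(* T(V) is the free algebra on the letters i standing for the basis vectors *)
(* (vbasis {:V})`_i, so that words of length m are a basis of V^{(x) m}. *)
Definition tensor_algebra : lalgType k := free_algebra k 'I_(\dim {:V}).

Definition tensor_power (m : nat) : set tensor_algebra :=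
  free_grading (fun=> 1%N) m.

Definition permute_factors (m : nat) (s : 'S_m)
    (w : {malg k[{fmonom 'I_(\dim {:V})}]}) : tensor_algebra :=
  \sum_(u : m.-tuple 'I_(\dim {:V}))
     w@_(FMonom u) *: << FMonom [tuple tnth u (s j) | j < m] >>.

Definition symmetric_tensors (m : nat) : set tensor_algebra :=
  [set w | tensor_power m w /\ forall s : 'S_m, permute_factors s w = w].

(* psi (x) id^{(x) m-1} on V^{(x) m}, for all m >= 1 at once. *)
Definition contract (psi : {linear V -> k^o})
    (w : {malg k[{fmonom 'I_(\dim {:V})}]}) : tensor_algebra :=
  \sum_(u <- msupp w)
     if fmonom_val u is i :: t
     then (w@_u * psi (tnth (vbasis {:V}) i)) *: << FMonom t >> else 0.

Definition partial (W : set tensor_algebra) : set tensor_algebra :=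
  linear_span [set x | exists (psi : {linear V -> k^o}) (w : tensor_algebra),
                 W w /\ x = contract psi w].

Definition line (w : tensor_algebra) : set tensor_algebra :=
  [set x | exists c : k, x = c *: w].

Definition derivation_relations (w : tensor_algebra) (i : nat) :
  set tensor_algebra := iter i partial (line w).

Definition tensor_quotient_grading (S : algType k)
    (pi : {lrmorphism tensor_algebra -> S}) : nat -> set S :=
  quotient_grading pi (fun=> 1%N).

End TensorAlgebra.

Section Clifford.
Variables (k : fieldType) (n : nat).

(* inl i stands for x_i and inr m for y_m. *)
Definition cliff_free : lalgType k := free_algebra k ('I_n + 'I_n)%type.
Definition cliff_x (i : 'I_n) : cliff_free := gen k (inl i : 'I_n + 'I_n)%type.
Definition cliff_y (m : 'I_n) : cliff_free := gen k (inr m : 'I_n + 'I_n)%type.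
Definition cliff_deg (z : 'I_n + 'I_n) : nat :=
  if z is inl _ then 1%N else 2%N.

Definition clifford_relations (F : n.-tuple 'M[k]_n) : set cliff_free :=
  [set x | exists i j : 'I_n,
    [\/ x = cliff_x i * cliff_x j + cliff_x j * cliff_x i
              - \sum_(m < n) (tnth F m) i j *: cliff_y m,
        x = cliff_x i * cliff_y j - cliff_y j * cliff_x i
      | x = cliff_y i * cliff_y j - cliff_y j * cliff_y i]].

Definition clifford_quantum_polynomial_algebra (S : algType k)
    (grS : nat -> set S) : Prop :=
  quantum_polynomial_algebra grS n /\
  exists F : n.-tuple 'M[k]_n,
    [/\ free F,
        forall m, (tnth F m)^T = tnth F m
      & exists (C : algType k) (rho : {lrmorphism cliff_free -> C}),
          presents rho (clifford_relations F) /\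
          graded_algebra_iso grS (quotient_grading rho cliff_deg)].

End Clifford.

(* Main.v *)
(* Both conditions are equivalent to R being contained in Sym^2 V.            *)
(*                                                                            *)
(* If S is isomorphic to C(F), then R is symmetric because the antisymmetric  *)
(* part of the coefficients of x_i x_j vanishes on the ideal of relations of  *)
(* C(F). If R is spanned by derivatives of a symmetric tensor, it consists of *)
(* symmetric tensors.                                                         *)
(*                                                                            *)
(* Suppose that R is symmetric. The trivial module has a minimal graded free  *)
(* resolution, given by matrices M_i over S. Comparing it with the projective *)
(* resolutions of the hypotheses shows that it has length n, and that the     *)
(* dual complex is exact but in degree n, where its cohomology is k(n). As    *)
(* minimality holds on both sides, every entry of every M_i has degree one.   *)
(* Lifting the entries to V, the product w of the M_i is a tensor of degree n *)
(* whose derivatives of order i span the entries of M_i ... M_(n-1); those of *)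
(* order n - 2 span R. Consecutive products M_i M_(i+1) have entries in R, so *)
(* w is invariant under adjacent transpositions.                              *)
(*                                                                            *)
(* Conversely let Y be the image of Sym^2 V in S. The Hilbert series gives    *)
(* dim Y = n and dim S_3 = n^2 + C(n, 3). The latter is the dimension of the  *)
(* sum of Y (x) V and of the third exterior power of V, onto which V^(x)3     *)
(* maps with a kernel containing VR + RV and the commutators of V and Sym^2 V.*)
(* Hence these commutators vanish in S: the elements of Y are central, and S  *)
(* is a graded Clifford algebra on a basis of V and a basis of Y.             *)
Require Import Defs.
From HB Require Import structures.
From mathcomp Require Import all_boot all_order all_algebra perm.
From mathcomp Require Import boolp classical_sets.
From mathcomp Require Import finmap monalg.
From mathcomp Require Import zify ring.

Set Implicit Arguments.
Unset Strict Implicit.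
Unset Printing Implicit Defensive.

Import Order.TTheory GRing.Theory Num.Theory.
Local Open Scope classical_set_scope.
Local Open Scope ring_scope.

(** * Homogeneous components *)

(** The hub is the condition that every element of [R] is a symmetric tensor:
    [clifford_relations_symmetric] and [relations_symmetric] derive it from the two sides of the
    equivalence, [symmetric_potential] and [clifford_of_symmetric] lead back from it.

    The potential comes from duality. By [gorenstein_columns] the dual of the minimal resolution is
    exact except at its end, where one class survives. Minimality of both complexes squeezes the
    generator degrees ([degreeE]), so all matrices are linear ([linear_resolution_exists]).
    Independence of their rows identifies derivatives of the potential with partial products
    ([partial_chain]); exactness of the dual at its last two places yields all of [R]
    ([chain2_span]).

    The Clifford structure comes from counting. In degree 2 the image of Sym^2 has dimension [n]
    ([symmetric_image_basis]). In degree 3 there are n^2 + C(n,3) independent functionals that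
    vanish on the relations; this is the dimension of S_3, so they cut out the relations exactly. As
    they also kill the commutators of letters with quadratic symmetric tensors, those commutators
    are 0 in [S] ([tau_central]). [clifford_presents] then compares the two presentations. *)

Section Components.
Variables (D : eqType) (M : zmodType) (gr : D -> set M).
Hypothesis gr_ds : direct_sum_decomposition gr.

Lemma grade0 i : gr i 0. Proof. by case: gr_ds. Qed.

Lemma gradeB i x y : gr i x -> gr i y -> gr i (x - y).
Proof. by case: gr_ds => _ + _ _; apply. Qed.

Lemma gradeN i x : gr i x -> gr i (- x).
Proof. by move=> gx; rewrite -[- x]add0r; apply: gradeB gx; apply: grade0. Qed.

Lemma gradeD i x y : gr i x -> gr i y -> gr i (x + y).
Proof. by move=> gx gy; rewrite -[y]opprK; apply/gradeB/gradeN. Qed.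

Lemma grade_sum i (I : Type) (s : seq I) (P : pred I) (F : I -> M) :
  (forall j, P j -> gr i (F j)) -> gr i (\sum_(j <- s | P j) F j).
Proof.
by move=> gF; elim/big_ind: _ => //; [apply: grade0 | apply: gradeD].
Qed.

Definition component_family (x : M) (f : D -> M) : Prop :=
  exists s : seq D, [/\ uniq s, forall i, gr i (f i),
    forall i, i \notin s -> f i = 0 & x = \sum_(i <- s) f i].

Lemma component_family_exists x : exists f, component_family x f.
Proof.
case: gr_ds => _ _ /(_ x) [s [f [gf ->]]] _.
(* [s] may list an index several times, so the component at [i] is [f i] taken with its multiplicity
   in [s]. *)
exists (fun i => if i \in s then f i *+ count_mem i s else 0), (undup s).
split => [|i|i|].
- exact: undup_uniq.
- case: ifP => _; last exact: grade0.
  elim: (count_mem i s) => [|m IH]; first by rewrite mulr0n; apply: grade0.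
  by rewrite mulrS; apply: gradeD.
- by rewrite mem_undup => /negbTE ->.
- rewrite -big_undup_iterop_count; apply: eq_big_seq => i.
  rewrite mem_undup => ->; rewrite Monoid.iteropE.
  by elim: (count_mem _ _) => [|m IH] //; rewrite iterS IH mulrS.
Qed.

Lemma big_supp (f : D -> M) (s t : seq D) :
  uniq s -> uniq t -> (forall i, i \notin s -> f i = 0) ->
  {subset s <= t} -> \sum_(i <- t) f i = \sum_(i <- s) f i.
Proof.
move=> us ut fs st; rewrite (bigID (mem s)) /= [X in _ + X]big1 ?addr0 //.
rewrite -big_filter; apply/perm_big/uniq_perm; rewrite ?filter_uniq //.
by move=> i; rewrite mem_filter; case: (boolP (i \in s)) => //= /st.
Qed.

Lemma component_family_inj x f g :
  component_family x f -> component_family x g -> f = g.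
Proof.
move=> [s [us gf fs xs]] [t [ut gg gt xt]]; apply/funext => i.
pose u := undup (s ++ t); case: (boolP (i \in u)) => iu; last first.
  move: iu; rewrite mem_undup mem_cat negb_or => /andP[/fs-> /gt->] //.
apply/eqP; rewrite -subr_eq0; apply/eqP.
case: gr_ds => _ _ _ /(_ u (fun i => f i - g i)); apply => //.
- exact: undup_uniq.
- by move=> j; apply: gradeB.
rewrite sumrB (@big_supp f s) ?undup_uniq // ?(@big_supp g t) ?undup_uniq //.
- by rewrite -xs -xt subrr.
- by move=> j jt; rewrite mem_undup mem_cat jt orbT.
- by move=> j jt; rewrite mem_undup mem_cat jt.
Qed.

Definition hcomp (i : D) (x : M) : M :=
  sval (cid (component_family_exists x)) i.

Lemma hcompP x : component_family x (hcomp^~ x).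
Proof. by rewrite /hcomp; case: cid. Qed.

Lemma hcomp_unique x f : component_family x f -> forall i, hcomp i x = f i.
Proof. by move=> fx i; rewrite -(component_family_inj (hcompP x) fx). Qed.

Lemma hcomp_in i x : gr i (hcomp i x).
Proof. by have [s []] := hcompP x. Qed.

Lemma hcompB i x y : hcomp i (x - y) = hcomp i x - hcomp i y.
Proof.
apply: (hcomp_unique (f := fun i => hcomp i x - hcomp i y)).
have [s [us gs s0 xs]] := hcompP x; have [t [ut gt t0 xt]] := hcompP y.
exists (undup (s ++ t)); split; rewrite ?undup_uniq //.
- by move=> j; apply: gradeB.
- by move=> j; rewrite mem_undup mem_cat negb_or => /andP[/s0-> /t0->]; rewrite subrr.
rewrite sumrB (@big_supp (hcomp^~ x) s) ?undup_uniq //.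
- rewrite (@big_supp (hcomp^~ y) t) ?undup_uniq //; first by rewrite -xs -xt.
  by move=> j jt; rewrite mem_undup mem_cat jt orbT.
- by move=> j jt; rewrite mem_undup mem_cat jt.
Qed.

HB.instance Definition _ i := GRing.isZmodMorphism.Build M M (hcomp i) (hcompB i).

Lemma hcomp_hom i j x : gr j x -> hcomp i x = if i == j then x else 0.
Proof.
move=> gx; apply: (hcomp_unique (f := fun i => if i == j then x else 0)).
exists [:: j]; split=> // [k|k|].
- by case: eqP => [->|_] //; apply: grade0.
- by rewrite inE => /negbTE->.
- by rewrite big_seq1 eqxx.
Qed.

Lemma hcomp_id i x : gr i x -> hcomp i x = x.
Proof. by move/(@hcomp_hom i i); rewrite eqxx. Qed.

Lemma hcomp_finite x : exists s : seq D,
  [/\ uniq s, forall i, i \notin s -> hcomp i x = 0 & x = \sum_(i <- s) hcomp i x].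
Proof. by have [s [us _ s0 xs]] := hcompP x; exists s. Qed.

Lemma hcomp_sum_supp x s : uniq s -> (forall i, i \notin s -> hcomp i x = 0) ->
  x = \sum_(i <- s) hcomp i x.
Proof.
move=> us s0; have [t [ut t0 {1}->]] := hcomp_finite x.
transitivity (\sum_(i <- undup (s ++ t)) hcomp i x).
  apply/esym/big_supp; rewrite ?undup_uniq // => j jt.
  by rewrite mem_undup mem_cat jt orbT.
apply/big_supp; rewrite ?undup_uniq // => j jt.
by rewrite mem_undup mem_cat jt.
Qed.

Lemma hom_eq0 i j x : gr i x -> gr j x -> i != j -> x = 0.
Proof.
move=> gi gj ij; rewrite -(hcomp_id gi) (hcomp_hom _ gj).
by rewrite (negbTE ij).
Qed.

End Components.

(** Applying [c i] to a vanishing sum isolates its [i]-th term, which gives uniqueness. The gradings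
    on [B] and on row vectors are obtained in this way. *)
Lemma ds_of_components (D : eqType) (M : zmodType) (gr : D -> set M)
    (c : D -> {additive M -> M}) :
  (forall i x y, gr i x -> gr i y -> gr i (x - y)) ->
  (forall i x, gr i (c i x)) ->
  (forall i j x, gr j x -> c i x = if i == j then x else 0) ->
  (forall x, exists s : seq D, x = \sum_(i <- s) c i x) ->
  direct_sum_decomposition gr.
Proof.
move=> gB gc ch cf; split=> // [i|x|s f us gf s0 i si].
- by rewrite -(raddf0 (c i)).
- by have [s xs] := cf x; exists s, (fun i => c i x).
- have := congr1 (c i) s0; rewrite raddf0 raddf_sum /= (bigD1_seq i) //=.
  rewrite (ch i i) ?eqxx // big1 ?addr0 // => j ji.
  by rewrite (ch _ j) // eq_sym (negbTE ji).
Qed.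

Lemma big_seq_pick (D : eqType) (M : zmodType) (s : seq D) (j : D) (F : D -> M) :
  uniq s -> \sum_(i <- s) (if j == i then F i else 0) =
    if j \in s then F j else 0.
Proof.
move=> us; case: ifP => js.
  rewrite (bigD1_seq _ js us) /= eqxx big1 ?addr0 // => i ij.
  by rewrite eq_sym (negbTE ij).
by rewrite big_seq big1 // => i is_; case: eqP => // ji; rewrite ji is_ in js.
Qed.

(** * Integer gradings, graded free modules and the augmentation *)

Section IntGrading.
Variables (B : nzRingType) (gr : nat -> set B).

(** Extension by zero to negative degrees, so that generators of free modules may sit in any integer
    degree and differences of degrees need no truncation. *)
Definition int_grading (z : int) : set B :=
  if z is Posz m then gr m else [set 0].

Hypothesis gr_ds : direct_sum_decomposition gr.
Hypothesis gr_mul : forall i j a b, gr i a -> gr j b -> gr (i + j)%N (a * b).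

Definition int_comp (z : int) (x : B) : B :=
  if z is Posz m then hcomp gr_ds m x else 0.

Lemma int_compB z x y : int_comp z (x - y) = int_comp z x - int_comp z y.
Proof. by case: z => m /=; rewrite ?raddfB ?subr0. Qed.

HB.instance Definition _ z :=
  GRing.isZmodMorphism.Build B B (int_comp z) (int_compB z).

Lemma int_grading_ds : direct_sum_decomposition int_grading.
Proof.
apply: (ds_of_components (c := int_comp)) => [[]m x y|[]m x|i j x|x] /=.
- exact: gradeB.
- by move=> -> ->; rewrite subrr.
- exact: hcomp_in.
- by [].
- case: j => j; last by move=> ->; rewrite raddf0 if_same.
  by case: i => i gx //=; rewrite (hcomp_hom gr_ds _ gx).
- have [s [us _ {1}->]] := hcomp_finite gr_ds x.
  by exists (map Posz s); rewrite big_map.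
Qed.

Lemma int_gradingM i j a b :
  int_grading i a -> int_grading j b -> int_grading (i + j) (a * b).
Proof.
case: i => i /=; last first.
  by move=> -> _; rewrite mul0r; apply: (grade0 int_grading_ds).
case: j => j ga; last by move=> ->; rewrite mulr0; apply: (grade0 int_grading_ds).
exact: gr_mul.
Qed.

Notation zc := (hcomp int_grading_ds).

Lemma hcomp_mulr z d x g : int_grading d g -> zc z (x * g) = zc (z - d) x * g.
Proof.
move=> gg; have [s [us s0 {1}->]] := hcomp_finite int_grading_ds x.
rewrite mulr_suml raddf_sum /=.
have E i : zc z (zc i x * g) = if z - d == i then zc i x * g else 0.
  rewrite (hcomp_hom int_grading_ds z (int_gradingM (hcomp_in _ i x) gg)).
  by rewrite subr_eq.
under eq_bigr do rewrite E.
rewrite big_seq_pick //; case: ifP => // /negbT/s0->; rewrite mul0r //.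
Qed.

Lemma hcomp_mull z d x g : int_grading d g -> zc z (g * x) = g * zc (z - d) x.
Proof.
move=> gg; have [s [us s0 {1}->]] := hcomp_finite int_grading_ds x.
rewrite mulr_sumr raddf_sum /=.
have E i : zc z (g * zc i x) = if z - d == i then g * zc i x else 0.
  rewrite (hcomp_hom int_grading_ds z (int_gradingM gg (hcomp_in _ i x))).
  by rewrite subr_eq addrC.
under eq_bigr do rewrite E.
rewrite big_seq_pick //; case: ifP => // /negbT/s0->; rewrite mulr0 //.
Qed.

(** All degrees are nonnegative, so only the degree-0 parts of the factors reach degree 0: the
    projection is the augmentation, a ring morphism. *)
Lemma hcomp0M x y : zc 0 (x * y) = zc 0 x * zc 0 y.
Proof.
have [s [us s0 {1}->]] := hcomp_finite int_grading_ds x.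
rewrite mulr_suml raddf_sum /=.
have E i : zc 0 (zc i x * y) = if 0 == i then zc 0 x * zc 0 y else 0.
  rewrite (hcomp_mull _ _ (hcomp_in _ i x)) sub0r.
  case: eqP => [<-|/eqP i0]; first by rewrite oppr0.
  (* If [i] is positive, the matching component of [y] has negative degree and vanishes; if [i] is
     negative, [zc i x] itself vanishes. *)
  case: i i0 => [[|m]|m] // _; last first.
    by have -> : zc (Negz m) x = 0 := hcomp_in int_grading_ds (Negz m) x; rewrite mul0r.
  have -> : - Posz m.+1 = Negz m by rewrite NegzE.
  by have -> : zc (Negz m) y = 0 := hcomp_in int_grading_ds (Negz m) y; rewrite mulr0.
under eq_bigr do rewrite E.
rewrite (big_seq_pick 0 (fun=> _)) //; case: ifP => // /negbT/s0->.
by rewrite mul0r.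
Qed.

(** The graded free module whose basis vector [b] has degree [a b]; the coordinate at [b] makes up
    the difference. *)
Definition row_grading r (a : 'I_r -> int) (z : int) : set 'rV[B]_r :=
  [set x | forall b, int_grading (z - a b) (x 0 b)].

Definition row_comp r (a : 'I_r -> int) (z : int) (x : 'rV[B]_r) : 'rV[B]_r :=
  \row_b zc (z - a b) (x 0 b).

Lemma row_compB r (a : 'I_r -> int) z x y :
  row_comp a z (x - y) = row_comp a z x - row_comp a z y.
Proof. by apply/rowP => b; rewrite !mxE raddfB. Qed.

HB.instance Definition _ r (a : 'I_r -> int) z :=
  GRing.isZmodMorphism.Build _ _ (row_comp a z) (row_compB a z).

Lemma row_comp_in r (a : 'I_r -> int) z x : row_grading a z (row_comp a z x).
Proof. by move=> b; rewrite mxE; apply: hcomp_in. Qed.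

Lemma row_comp_hom r (a : 'I_r -> int) z z' x : row_grading a z' x ->
  row_comp a z x = if z == z' then x else 0.
Proof.
move=> gx; apply/rowP => b; rewrite mxE (hcomp_hom _ _ (gx b)).
by rewrite (inj_eq (addIr _)); case: ifP; rewrite ?mxE.
Qed.

Lemma row_comp_finite r (a : 'I_r -> int) x : exists s : seq int,
  [/\ uniq s, forall z, z \notin s -> row_comp a z x = 0
    & x = \sum_(z <- s) row_comp a z x].
Proof.
have /choice [s sP] (b : 'I_r) := hcomp_finite int_grading_ds (x 0 b).
pose t := undup (flatten [seq [seq a b + z | z <- s b] | b <- enum 'I_r]).
have t0 b z : z \notin t -> zc (z - a b) (x 0 b) = 0.
  move=> zt; have [_ s0 _] := sP b; apply: s0; apply: contra zt => zs.
  rewrite mem_undup; apply/flattenP; exists [seq a b + z | z <- s b].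
    by apply/mapP; exists b => //; rewrite mem_enum.
  by apply/mapP; exists (z - a b) => //; rewrite addrC subrK.
exists t; split; first exact: undup_uniq.
- by move=> z zt; apply/rowP => b; rewrite !mxE t0.
- apply/rowP => b; rewrite summxE; under eq_bigr do rewrite mxE.
  rewrite -(big_map (fun z => z - a b) xpredT (fun z => zc z (x 0 b))).
  apply: (hcomp_sum_supp (gr_ds := int_grading_ds)).
    by rewrite map_inj_uniq ?undup_uniq //; apply: addIr.
  move=> z zt; rewrite -[z](addrK (a b)); apply: t0.
  by apply: contra zt => zt; apply/mapP; exists (z + a b) => //; rewrite addrK.
Qed.

Lemma row_grading_ds r (a : 'I_r -> int) :
  direct_sum_decomposition (row_grading a).
Proof.
apply: (ds_of_components (c := row_comp a)) => [z x y gx gy b|z x|z z' x|x].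
- by rewrite !mxE; apply: (gradeB int_grading_ds).
- exact: row_comp_in.
- exact: row_comp_hom.
- by have [s [_ _ xs]] := row_comp_finite a x; exists s.
Qed.

(** The degree-preserving maps between graded free modules: row [b] is the image of a basis vector
    of degree [a b]. *)
Definition hom_mx r s (a : 'I_r -> int) (a' : 'I_s -> int) (G : 'M[B]_(r, s)) :=
  forall b c, int_grading (a b - a' c) (G b c).

Lemma row_comp_mulmx r s (a : 'I_r -> int) (a' : 'I_s -> int) G z x :
  hom_mx a a' G -> row_comp a' z (x *m G) = row_comp a z x *m G.
Proof.
move=> hG; apply/rowP => c; rewrite !mxE raddf_sum /=; apply: eq_bigr => b _.
by rewrite (hcomp_mulr _ _ (hG b c)) mxE opprB addrA subrK.
Qed.

Lemma row_grading_mulmx r s (a : 'I_r -> int) (a' : 'I_s -> int) G z x :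
  hom_mx a a' G -> row_grading a z x -> row_grading a' z (x *m G).
Proof.
move=> hG gx; have := row_comp_in a' z (x *m G).
by rewrite (row_comp_mulmx _ _ hG) (row_comp_hom _ gx) eqxx.
Qed.

(** Entries in the augmentation ideal. This is the minimality condition on matrices, and by
    [hcomp0M] it survives multiplication on either side. *)
Definition aug0 m n (A : 'M[B]_(m, n)) := forall i j, zc 0 (A i j) = 0.

Lemma aug0_mulr m n p (A : 'M[B]_(m, n)) (C : 'M[B]_(n, p)) :
  aug0 A -> aug0 (A *m C).
Proof.
move=> A0 i j; rewrite mxE raddf_sum /= big1 // => l _.
by rewrite hcomp0M A0 mul0r.
Qed.

Lemma aug0_mull m n p (A : 'M[B]_(m, n)) (C : 'M[B]_(n, p)) :
  aug0 C -> aug0 (A *m C).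
Proof.
move=> A0 i j; rewrite mxE raddf_sum /= big1 // => l _.
by rewrite hcomp0M A0 mulr0.
Qed.

Lemma aug0D m n (A C : 'M[B]_(m, n)) : aug0 A -> aug0 C -> aug0 (A + C).
Proof. by move=> A0 C0 i j; rewrite mxE raddfD /= A0 C0 addr0. Qed.

End IntGrading.

(** * Minimal graded free resolutions *)

Section Noetherian.
Variable B : nzRingType.

Definition row_submodule r (N : set 'rV[B]_r) : Prop :=
  N 0 /\ forall b x y, N x -> N y -> N (b *: x + y).

Lemma row_submodule_mul r s (N : set 'rV[B]_r) (G : 'M[B]_(s, r)) y :
  row_submodule N -> (forall b, N (row b G)) -> N (y *m G).
Proof.
move=> [N0 NC] NG; rewrite mulmx_sum_row.
by elim/big_ind: _ => // [x z Nx Nz|b _]; [rewrite -[x]scale1r|rewrite -[_ *: _]addr0]; apply: NC.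
Qed.

(** Induction on the rank: the first coordinates form a left ideal, and the elements with first
    coordinate 0 form a submodule of smaller rank. Lifts of generators of the former and generators
    of the latter suffice. *)
Lemma noetherian_rows (noeth : left_noetherian B) r (N : set 'rV[B]_r) :
  row_submodule N -> exists (t : nat) (G : 'M[B]_(t, r)),
    (forall b, N (row b G)) /\ forall x, N x -> exists y, x = y *m G.
Proof.
elim: r N => [|r IH] N sN; have [N0 NC] := sN.
  by exists 0%N, 0; split=> [[]|x _] //; exists 0; apply/rowP => -[].
pose I := [set b | exists2 x : 'rV[B]_r.+1, N x & b = x 0 0].
have [|t [g [gI gen]]] := noeth I.
  split=> [|a _ _ [x Nx ->] [y Ny ->]]; first by exists 0; rewrite ?mxE.
  by exists (a *: x + y); rewrite ?mxE //; apply: NC.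
have /choice [x xP] (i : 'I_t) : exists x : 'rV[B]_r.+1, N x /\ g i = x 0 0.
  by have [x ? ?] := gI i; exists x.
pose N' : set 'rV[B]_r := [set y | N (row_mx (0 : 'rV_1) y)].
have [|t' [G [NG Ggen]]] := IH N'.
  split=> [|b y z Ny Nz]; first by rewrite /N' /= row_mx0.
  rewrite /N' /= -[X in row_mx X](addr0 (0 : 'rV_1)) -[X in row_mx (X + _)](scaler0 _ b).
  by rewrite -add_row_mx -scale_row_mx; apply: NC.
exists (t + t')%N, (col_mx (\matrix_(i < t) x i) (row_mx (0 : 'cV_t') G)); split.
  move=> b; rewrite -[b]splitK; case: (split b) => i /=.
    by rewrite rowKu rowK; have [] := xP i.
  rewrite rowKd; have := NG i; congr N.
  by rewrite [RHS](row_row_mx i (0 : 'M_(t', 1))) row0.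
move=> y Ny; have [|c yc] := gen (y 0 0); first by exists y.
pose z := y - (\row_i c i) *m (\matrix_(i < t) x i).
have Nz : N z.
  rewrite /z addrC -scaleN1r; apply: NC => //.
  by apply: row_submodule_mul => // i; rewrite rowK; have [] := xP i.
have z0 : z 0 0 = 0.
  rewrite !mxE yc; apply/eqP; rewrite subr_eq0; apply/eqP/eq_bigr => i _.
  by rewrite !mxE; have [_ ->] := xP i.
have Ez : z = row_mx (0 : 'rV_1) (rsubmx (z : 'rV_(1 + r))).
  have <- : lsubmx (z : 'rV_(1 + r)) = 0.
    apply/rowP => i; rewrite mxE [RHS]mxE ord1 -[RHS]z0.
    by congr (fun_of_matrix z _ _); apply/val_inj.
  by rewrite hsubmxK.
have [|u zu] := Ggen (rsubmx (z : 'rV_(1 + r))); first by rewrite /N' /= -Ez.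
exists (row_mx (\row_i c i) u); rewrite mul_row_col.
have -> : u *m (row_mx (0 : 'cV_t') G : 'M_(t', r.+1)) = z.
  rewrite [RHS]Ez zu -(mulmx0 _ u); exact: (mul_mx_row u (0 : 'cV_t') G).
by rewrite addrC subrK.
Qed.

End Noetherian.

Section MinimalResolution.
Variables (B : nzRingType) (gr : nat -> set B).
Hypothesis gr_ds : direct_sum_decomposition gr.
Hypothesis gr_mul : forall i j a b, gr i a -> gr j b -> gr (i + j)%N (a * b).
Hypothesis gr_div : forall a, gr 0%N a -> a != 0 -> exists2 b, gr 0%N b & b * a = 1.
Hypothesis noeth : left_noetherian B.

Notation zc := (hcomp (int_grading_ds gr_ds)).
Notation zgr := (int_grading gr).

Definition hom_submodule r (a : 'I_r -> int) (N : set 'rV[B]_r) : Prop :=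
  row_submodule N /\ forall z x, N x -> N (row_comp gr_ds a z x).

Definition hom_generators r (a : 'I_r -> int) (N : set 'rV[B]_r) (t : nat) :=
  exists (a' : 'I_t -> int) (G : 'M[B]_(t, r)), [/\ hom_mx gr a' a G,
    forall b, N (row b G) & forall x, N x -> exists y, x = y *m G].

(** The homogeneous components of finitely many generators stay in [N] and generate it. They are
    indexed by a generator and a position in a common list [u] of degrees. *)
Lemma hom_generators_exist r (a : 'I_r -> int) N :
  hom_submodule a N -> exists t, hom_generators a N t.
Proof.
move=> [subN homN]; have [t [G [NG genG]]] := noetherian_rows noeth subN.
have /choice [s sP] (i : 'I_t) := row_comp_finite gr_ds a (row i G).
pose u := undup (flatten [seq s i | i <- enum 'I_t]).
have sum_u i : row i G = \sum_(z <- u) row_comp gr_ds a z (row i G).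
  have [us s0 {1}->] := sP i; apply/esym/big_supp; rewrite ?undup_uniq // => z zs.
  by rewrite mem_undup; apply/flattenP; exists (s i); rewrite // map_f ?mem_enum.
pose T : finType := ('I_t * 'I_(size u))%type.
pose dg (p : T) : int := nth 0 u p.2.
exists #|T|, (fun p => dg (enum_val p)),
  (\matrix_p row_comp gr_ds a (dg (enum_val p)) (row (enum_val p).1 G)); split.
- move=> p c; rewrite mxE; exact: row_comp_in.
- by move=> p; rewrite rowK; apply: homN.
move=> x /genG[y ->]; exists (\row_p y 0 (enum_val p).1).
rewrite mulmx_sum_row [RHS]mulmx_sum_row.
under [RHS]eq_bigr do rewrite rowK mxE.
rewrite -(reindex (enum_val (A := T)) (P := xpredT) (F := fun p : T =>
  y 0 p.1 *: row_comp gr_ds a (dg p) (row p.1 G))) /=; last first.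
  by exists enum_rank => p _; [apply: enum_valK|apply: enum_rankK].
rewrite -(pair_bigA _ (fun i j => y 0 i *: row_comp gr_ds a (dg (i, j)) (row i G))) /=.
apply: eq_bigr => i _; rewrite -scaler_sumr {1}sum_u (big_nth 0) big_mkord.
by [].
Qed.

Lemma mulmx_drop_row s r (b : 'I_s) (z : 'rV[B]_s) (G : 'M[B]_(s, r)) :
  z 0 b = 0 -> z *m G = col' b z *m row' b G.
Proof.
move=> zb; apply/rowP => c; rewrite !mxE (bigD1_ord b) //= zb mul0r add0r.
by apply: eq_bigr => i _; rewrite !mxE.
Qed.

(* A generating family of least size is minimal: if a relation had a nonzero  *)
(* coefficient in degree 0, which is a unit, its homogeneous component in the *)
(* degree of that generator would express this generator by the others.       *)
Lemma minimal_generators r (a : 'I_r -> int) N : hom_submodule a N ->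
  exists (t : nat) (a' : 'I_t -> int) (G : 'M[B]_(t, r)),
  [/\ hom_mx gr a' a G, forall x, N x <-> exists y, x = y *m G
    & forall y : 'rV_t, y *m G = 0 -> aug0 gr_ds y].
Proof.
move=> hN; have ex : exists t, `[< hom_generators a N t >].
  by have [t Ht] := hom_generators_exist hN; exists t; apply/asboolP.
case: (ex_minnP ex) => t /asboolP[a' [G [hG NG genG]]] tmin.
exists t, a', G; split=> // [x|y yG i b]; first split; first exact: genG.
  by move=> [y ->]; case: hN => sN _; apply: row_submodule_mul.
rewrite ord1 {i}; apply/eqP; apply/negPn/negP => yb.
have [u _ uy] : exists2 u, gr 0%N u & u * zc 0 (y 0 b) = 1.
  by apply: gr_div => //; apply: (hcomp_in (int_grading_ds gr_ds) 0).
have {u uy} [v vG vb] : exists2 v : 'rV_t, v *m G = 0 & v 0 b = 1.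
  exists (u *: row_comp gr_ds a' (a' b) y); last by rewrite !mxE subrr.
  by rewrite -scalemxAl -(row_comp_mulmx gr_ds gr_mul (a' b) y hG) yG raddf0 scaler0.
case: t a' b G hG NG genG tmin y yG yb v vG vb => [|t] a' b; first by case: b.
move=> G hG NG genG tmin y yG yb v vG vb.
have := tmin t; rewrite ltnn => H; apply/notF/H/asboolP.
exists (fun i => a' (lift b i)), (row' b G); split.
- by move=> i c; rewrite mxE; apply: hG.
- by move=> i; rewrite row_rowsub; apply: NG.
move=> x /genG[w ->]; exists (col' b (w - w 0 b *: v)).
transitivity ((w - w 0 b *: v) *m G).
  by rewrite mulmxBl -scalemxAl vG scaler0 subr0.
by apply: mulmx_drop_row; rewrite !mxE vb mulr1 subrr.
Qed.

Lemma ker_hom_submodule s r (a' : 'I_s -> int) (a : 'I_r -> int) (G : 'M[B]_(s, r)) :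
  hom_mx gr a' a G -> hom_submodule a' [set y | y *m G = 0].
Proof.
move=> hG; split=> [|z x] /=.
  split=> [|b x y] /=; first exact: mul0mx.
  by move=> xG yG; rewrite mulmxDl -scalemxAl xG yG scaler0 addr0.
by move=> xG; rewrite -(row_comp_mulmx gr_ds gr_mul z x hG) xG raddf0.
Qed.

Lemma aug_hom_submodule : hom_submodule (fun _ : 'I_1 => 0) [set x | aug0 gr_ds x].
Proof.
split=> [|z x x0 i j] /=.
  split=> [i j|b x y x0 y0 i j] /=; first by rewrite mxE raddf0.
  by rewrite !mxE raddfD /= (hcomp0M gr_ds gr_mul) x0 y0 mulr0 addr0.
rewrite mxE subr0 (hcomp_hom _ 0 (hcomp_in _ z _)); case: eqP => // <-.
exact: x0.
Qed.

(** A stage of the construction: the current free module and the submodule that the next matrix has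
    to cover. The field [rs_aug] is what makes that matrix minimal. *)
Record resolution_state := ResolutionState {
  rs_rank : nat;
  rs_deg : 'I_rs_rank -> int;
  rs_sub : set 'rV[B]_rs_rank;
  rs_hom : hom_submodule rs_deg rs_sub;
  rs_aug : forall x, rs_sub x -> aug0 gr_ds x
}.

Definition initial_state : resolution_state :=
  ResolutionState aug_hom_submodule (fun x x0 => x0).

(** [minimal_generators] supplies the matrix, and its kernel is the next submodule; minimality of
    the generators says precisely that this kernel satisfies [rs_aug]. *)
Lemma next_exists (st : resolution_state) :
  exists p : {st' : resolution_state & 'M[B]_(rs_rank st', rs_rank st)},
  let: existT st' G := p in
  [/\ hom_mx gr (@rs_deg st') (@rs_deg st) G,
      forall x, rs_sub x <-> exists y, x = y *m G
    & forall y, @rs_sub st' y <-> y *m G = 0].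
Proof.
case: st => r a N hN N0 /=.
have [t [a' [G [hG genG augG]]]] := minimal_generators hN.
pose st' := ResolutionState (ker_hom_submodule hG) augG.
by exists (existT _ st' G); split.
Qed.

Definition next_state st := projT1 (sval (cid (next_exists st))).

Fixpoint nth_state (i : nat) : resolution_state :=
  if i is j.+1 then next_state (nth_state j) else initial_state.

(* Hard-wires the rank 1 of the initial free module, so that the matrices of a *)
(* resolution have definitionally matching sizes.                             *)
Definition min_rank (r : nat -> nat) (i : nat) : nat :=
  if i is j.+1 then r j else 1%N.

Record minimal_resolution (r : nat -> nat)
    (a : forall i, 'I_(min_rank r i) -> int)
    (M : forall i, 'M[B]_(min_rank r i.+1, min_rank r i)) : Prop := {
  mr_deg0 : forall b, a 0%N b = 0;
  mr_hom : forall i, hom_mx gr (@a i.+1) (@a i) (M i);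
  mr_aug : forall i, aug0 gr_ds (M i);
  mr_ex0 : forall x : 'rV[B]_(min_rank r 0), aug0 gr_ds x -> exists y, x = y *m M 0%N;
  mr_comp : forall i, M i.+1 *m M i = 0;
  mr_ex : forall i (x : 'rV[B]_(min_rank r i.+1)), x *m M i = 0 ->
    exists y, x = y *m M i.+1 }.

Theorem minimal_resolution_exists : exists r a M, @minimal_resolution r a M.
Proof.
pose st := nth_state.
pose r i := rs_rank (st i.+1).
pose nG i : 'M[B]_(rs_rank (st i.+1), rs_rank (st i)) :=
  projT2 (sval (cid (next_exists (st i)))).
pose a i : 'I_(min_rank r i) -> int :=
  if i is j.+1 return 'I_(min_rank r i) -> int then @rs_deg (st j.+1)
  else @rs_deg (st 0%N).
pose M i : 'M[B]_(min_rank r i.+1, min_rank r i) :=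
  if i is j.+1 return 'M[B]_(min_rank r i.+1, min_rank r i) then nG j.+1
  else nG 0%N.
have nP i : [/\ hom_mx gr (@rs_deg (st i.+1)) (@rs_deg (st i)) (nG i),
      forall x, rs_sub x <-> exists y, x = y *m nG i
    & forall y, @rs_sub (st i.+1) y <-> y *m nG i = 0].
  by rewrite /nG /st /= /next_state; case: (cid _) => -[].
exists r, a, M; split=> [b|i|i|x x0|i|i x].
- by [].
- by case: i => [|i]; [case: (nP 0%N) | case: (nP i.+1)].
- have H j : aug0 gr_ds (nG j).
    have [_ H _] := nP j => b c.
    have /rs_aug/(_ 0 c) : rs_sub (row b (nG j)).
      by apply/H; exists (delta_mx 0 b); rewrite rowE.
    by rewrite mxE.
  by case: i => [|i]; exact: H.
- by have [_ /(_ x)[H _] _] := nP 0%N; apply: H.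
- have H j : nG j.+1 *m nG j = 0.
    have [_ H _] := nP j.+1; have [_ _ H'] := nP j; apply/row_matrixP => b.
    rewrite row_mul row0; apply/H'/H; exists (delta_mx 0 b).
    by rewrite rowE.
  by case: i => [|i]; exact: H.
- have H j (y : 'rV_(rs_rank (st j.+1))) : y *m nG j = 0 -> exists z, y = z *m nG j.+1.
    by have [_ /(_ y)[H _] _] := nP j.+1; have [_ _ /(_ y)[_ H']] := nP j => /H'/H.
  by case: i x => [|i] x; [exact: (H 0%N) | exact: (H i.+1)].
Qed.

End MinimalResolution.

(** * Comparison of resolutions *)

Section DependentChoice.
Variables (T : nat -> Type) (Inv : forall i, T i -> Prop).
Variable Rel : forall i, T i -> T i.+1 -> Prop.

Lemma dependent_choice (x0 : T 0%N) : Inv x0 ->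
  (forall i (x : T i), Inv x -> exists2 y : T i.+1, Inv y & Rel x y) ->
  exists u : forall i, T i, [/\ u 0%N = x0, forall i, Inv (u i)
    & forall i, Rel (u i) (u i.+1)].
Proof.
move=> inv0 step.
pose next i (x : {x : T i | Inv x}) : {y : T i.+1 | Inv y} :=
  let: exist2 y yI _ := cid2 (step i _ (svalP x)) in exist _ y yI.
pose fix u i : {x : T i | Inv x} :=
  if i is j.+1 return {x : T i | Inv x} then next j (u j) else exist _ x0 inv0.
exists (fun i => sval (u i)); split=> // [i|i]; first exact: svalP.
by rewrite /= /next; case: (cid2 _).
Qed.

End DependentChoice.

Section RowLinear.
Variables (B : nzRingType) (P : lmodType B) (r : nat) (p : 'I_r -> P).

Definition row_linear (x : 'rV[B]_r) : P := \sum_b x 0 b *: p b.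

Lemma row_linear_is_linear : linear row_linear.
Proof.
move=> c x y; rewrite /row_linear scaler_sumr -big_split /=.
by apply: eq_bigr => b _; rewrite !mxE scalerDl scalerA.
Qed.

HB.instance Definition _ :=
  GRing.isLinear.Build B 'rV[B]_r P _ row_linear row_linear_is_linear.

End RowLinear.

Lemma linear_row (B : nzRingType) (P : lmodType B) (r : nat)
    (f : {linear 'rV[B]_r -> P}) (x : 'rV[B]_r) :
  f x = \sum_b x 0 b *: f (delta_mx 0 b).
Proof.
rewrite {1}(row_sum_delta x) raddf_sum /=; apply: eq_bigr => b _.
by rewrite linearZ.
Qed.

Section ImageModule.
Variables (B : nzRingType) (X Y : lmodType B) (f : {linear X -> Y}).

Definition image_pred : {pred Y} := fun y => `[< exists x, f x = y >].

Lemma image_submod_closed : submod_closed image_pred.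
Proof.
split=> [|c _ _ /asboolP[x <-] /asboolP[y <-]]; apply/asboolP.
  by exists 0; rewrite raddf0.
by exists (c *: x + y); rewrite linearP.
Qed.

HB.instance Definition _ :=
  GRing.isSubmodClosed.Build B Y image_pred image_submod_closed.

Record image_module := ImageModule { im_val : Y; _ : im_val \in image_pred }.

HB.instance Definition _ := [isSub for im_val].
HB.instance Definition _ := [Choice of image_module by <:].
HB.instance Definition _ := [SubChoice_isSubLmodule of image_module by <:].

Section Corestriction.
Variables (P : lmodType B) (h : {linear P -> Y}).
Hypothesis h_im : forall p, exists x, f x = h p.

Definition corestrict (p : P) : image_module := ImageModule (asboolT (h_im p)).

Lemma corestrict_is_linear : linear corestrict.
Proof. by move=> c x y; apply: val_inj; rewrite linearP /= linearP. Qed.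

HB.instance Definition _ :=
  GRing.isLinear.Build B P image_module _ corestrict corestrict_is_linear.

End Corestriction.

Definition image_proj : {linear X -> image_module} :=
  @corestrict X f (fun x => ex_intro _ x erefl).

Lemma image_proj_surj y : exists x, image_proj x = y.
Proof.
have /asboolP[x fx] := valP y.
by exists x; apply: val_inj.
Qed.

(** Projectivity speaks of surjections, so both maps are first corestricted to the image of [f]. *)
Lemma projective_lift (P : lmodType B) (h : {linear P -> Y}) :
  projective_module P -> (forall p, exists x, f x = h p) ->
  exists g : {linear P -> X}, forall p, f (g p) = h p.
Proof.
move=> projP him.
have [g gP] := projP X image_module image_proj (@corestrict P h him) image_proj_surj.
by exists g => p; have /(congr1 val) := gP p.
Qed.

End ImageModule.

(* M is a complex of free modules of row vectors, acting by right            *)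
(* multiplication, over a projective resolution P of the same module. The     *)
(* lifts f and g go back and forth, and s is a homotopy from the identity to  *)
(* g f.                                                                       *)
Section Comparison.
Variables (B : nzRingType) (r : nat -> nat).
Notation rk := (min_rank r).
Variable M : forall i, 'M[B]_(rk i.+1, rk i).
Hypothesis M_comp : forall i, M i.+1 *m M i = 0.
Hypothesis M_ex : forall i (x : 'rV[B]_(rk i.+1)), x *m M i = 0 ->
  exists y, x = y *m M i.+1.
Variables (K : lmodType B) (eps : {linear 'rV[B]_(rk 0) -> K}).
Hypothesis eps_comp : forall y, eps (y *m M 0%N) = 0.
Hypothesis eps_ex : forall x, eps x = 0 -> exists y, x = y *m M 0%N.
Variables (P : nat -> lmodType B) (d : forall i, {linear P i.+1 -> P i}).
Variable e : {linear P 0%N -> K}.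
Hypothesis resP : is_resolution d e.

Lemma lift_from_free : exists f : forall i, {linear 'rV[B]_(rk i) -> P i},
  (forall x, e (f 0%N x) = eps x) /\
  forall i x, d i (f i.+1 x) = f i (x *m M i).
Proof.
have [e_surj e_ex d_ex] := resP.
have /choice[p0 p0P] (b : 'I_(rk 0)) := e_surj (eps (delta_mx 0 b)).
have Ep0 x : e (row_linear p0 x) = eps x.
  rewrite (linear_row eps) raddf_sum /=; apply: eq_bigr => b _.
  by rewrite linearZ /= p0P.
pose Inv i (f : {linear 'rV[B]_(rk i) -> P i}) :=
  forall y, exists p, d i p = f (y *m M i).
pose Rel i (f : {linear 'rV[B]_(rk i) -> P i}) (f' : {linear 'rV[B]_(rk i.+1) -> P i.+1}) :=
  forall x, d i (f' x) = f (x *m M i).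
have [| |f [f0 _ fR]] := @dependent_choice _ Inv Rel (row_linear p0).
- by move=> y; apply/e_ex; rewrite Ep0 eps_comp.
- move=> i f fI; have /choice[p pP] (b : 'I_(rk i.+1)) := fI (delta_mx 0 b).
  have R x : d i (row_linear p x) = f (x *m M i).
    rewrite {2}(row_sum_delta x) mulmx_suml !raddf_sum /=; apply: eq_bigr => b _.
    by rewrite linearZ /= pP -scalemxAl linearZ.
  exists (row_linear p) => // y; apply/d_ex.
  by rewrite R -mulmxA M_comp mulmx0 raddf0.
exists f; split=> [x|]; [by rewrite f0 Ep0 | exact: fR].
Qed.

(* [ok] is instantiated with graded maps for graded projective resolutions    *)
(* and with all linear maps otherwise.                                        *)
Lemma lift_to_free (ok : forall i, {linear P i -> 'rV[B]_(rk i)} -> Prop) :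
  (exists2 g0, @ok 0%N g0 & forall p, eps (g0 p) = e p) ->
  (forall i (g : {linear P i -> 'rV[B]_(rk i)}), ok i g ->
    (forall p, exists y, y *m M i = g (d i p)) ->
    exists2 g', ok i.+1 g' & forall p, g' p *m M i = g (d i p)) ->
  exists g : forall i, {linear P i -> 'rV[B]_(rk i)},
  [/\ forall i, ok i (g i), forall p, eps (g 0%N p) = e p
    & forall i p, g i.+1 p *m M i = g i (d i p)].
Proof.
have [e_surj e_ex d_ex] := resP.
move=> [g0 ok0 Eg0] step.
pose Inv i (g : {linear P i -> 'rV[B]_(rk i)}) :=
  ok i g /\ forall p, exists y, y *m M i = g (d i p).
pose Rel i (g : {linear P i -> 'rV[B]_(rk i)}) (g' : {linear P i.+1 -> 'rV[B]_(rk i.+1)}) :=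
  forall p, g' p *m M i = g (d i p).
have [| |g [g0E gI gR]] := @dependent_choice _ Inv Rel g0.
- split=> // p; have [|y yP] := @eps_ex (g0 (d 0%N p)); last by exists y.
  by rewrite Eg0; apply/e_ex; exists p.
- move=> i g [okg gI]; have [g' okg' g'P] := step i g okg gI.
  exists g' => //; split=> // p; have [|y yP] := @M_ex i (g' (d i.+1 p)); last by exists y.
  rewrite g'P; suff -> : d i (d i.+1 p) = 0 by rewrite raddf0.
  by apply/d_ex; exists p.
exists g; split=> // [i|p]; first by have [] := gI i.
by rewrite g0E.
Qed.

Variable f : forall i, {linear 'rV[B]_(rk i) -> P i}.
Hypothesis f0 : forall x, e (f 0%N x) = eps x.
Hypothesis fS : forall i x, d i (f i.+1 x) = f i (x *m M i).
Variable g : forall i, {linear P i -> 'rV[B]_(rk i)}.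
Hypothesis g0 : forall p, eps (g 0%N p) = e p.
Hypothesis gS : forall i p, g i.+1 p *m M i = g i (d i p).

Lemma factor_mx s t t' (G : 'M[B]_(t, t')) (h : {linear 'rV[B]_s -> 'rV[B]_t'}) :
  (forall x, exists y, h x = y *m G) ->
  exists A : 'M[B]_(s, t), forall x, h x = x *m A *m G.
Proof.
move=> hG; have /choice[y yP] b := hG (delta_mx 0 b).
exists (\matrix_b y b) => x; rewrite (linear_row h) {2}(row_sum_delta x) !mulmx_suml.
by apply: eq_bigr => b _; rewrite yP -!scalemxAl -rowE rowK.
Qed.

Lemma homotopy : exists s : forall i, 'M[B]_(rk i, rk i.+1),
  (forall x, x - g 0%N (f 0%N x) = x *m s 0%N *m M 0%N) /\
  forall i x, x - g i.+1 (f i.+1 x) = x *m s i.+1 *m M i.+1 + x *m M i *m s i.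
Proof.
have [s0 s0P] : exists s0 : 'M[B]_(rk 0, rk 1), forall x : 'rV[B]_(rk 0),
    x - g 0%N (f 0%N x) = x *m s0 *m M 0%N.
  apply: (factor_mx (h := idfun \- (g 0%N \o f 0%N))) => x /=.
  by apply: eps_ex; rewrite raddfB /= g0 f0 subrr.
(* The homotopy identity evaluated on boundaries, where the term from the previous stage drops out
   because consecutive matrices compose to 0. It makes the remainder at the next stage a cycle. *)
pose Inv i (s : 'M[B]_(rk i, rk i.+1)) := forall x : 'rV[B]_(rk i.+1),
  x *m M i - g i (f i (x *m M i)) = x *m M i *m s *m M i.
pose Rel i (s : 'M[B]_(rk i, rk i.+1)) (s' : 'M[B]_(rk i.+1, rk i.+2)) :=
  forall x, x - g i.+1 (f i.+1 x) = x *m s' *m M i.+1 + x *m M i *m s.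
have [| |s [s0E _ sR]] := @dependent_choice _ Inv Rel s0.
- by move=> x; apply: s0P.
- move=> i s sI.
  have [s' s'P] : exists s' : 'M[B]_(rk i.+1, rk i.+2), forall x : 'rV[B]_(rk i.+1),
      x - g i.+1 (f i.+1 x) - x *m M i *m s = x *m s' *m M i.+1.
    apply: (factor_mx (h := idfun \- (g i.+1 \o f i.+1) \- (mulmxr s \o mulmxr (M i)))) => x /=.
    by apply: M_ex; rewrite !mulmxBl gS fS sI subrr.
  have R : Rel i s s' by move=> x; rewrite -s'P subrK.
  exists s' => // x; rewrite R -[X in _ + X *m s]mulmxA M_comp mulmx0 mul0mx addr0.
  by [].
by exists s; split=> // x; rewrite s0E.
Qed.

(** This and [coboundaryS] say that the map induced by [g] on cohomology is injective, which is
    enough to transport vanishing and dependence of classes to the complex of the [M i]. *)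
Lemma coboundary0 (y : 'cV[B]_(rk 0)) : M 0%N *m y = 0 ->
  (forall p, g 0%N p *m y = 0) -> y = 0.
Proof.
move=> My gy; have [s [s0 _]] := homotopy.
apply/row_matrixP => b; rewrite row0 rowE -[delta_mx _ _](subrK (g 0%N (f 0%N (delta_mx 0 b)))).
by rewrite s0 mulmxDl -mulmxA My mulmx0 gy addr0.
Qed.

(** For a cocycle [y] the homotopy gives [y = (g f) y + M i (s y)]. Here [g y = psi d], and
    [d f = f M], so the first term is [M i] applied to the values of [psi f] on the basis. *)
Lemma coboundaryS i (y : 'cV[B]_(rk i.+1)) (psi : {linear P i -> B^o}) :
  M i.+1 *m y = 0 -> (forall p, (g i.+1 p *m y) 0 0 = psi (d i p)) ->
  exists y' : 'cV[B]_(rk i), y = M i *m y'.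
Proof.
move=> My gy; have [s [_ sS]] := homotopy.
pose c : 'cV[B]_(rk i) := \col_b psi (f i (delta_mx 0 b)).
exists (c + s i *m y); apply/colP => b.
have E (A : 'cV[B]_(rk i.+1)) : A b 0 = (delta_mx 0 b *m A : 'M_1) 0 0.
  by rewrite -rowE mxE.
rewrite E [RHS]E -[delta_mx _ _ in LHS](subrK (g i.+1 (f i.+1 (delta_mx 0 b)))).
rewrite sS !mulmxDl -[X in (X + _) + _]mulmxA My mulmx0 add0r.
rewrite mulmxDr mulmxDr !mulmxA addrC; rewrite mxE gy fS [RHS]mxE; congr (_ + _).
rewrite [LHS](linear_row (psi \o f i)) [RHS]mxE; apply: eq_bigr => j _.
by rewrite [c _ _]mxE.
Qed.

(** Where [P] vanishes so does [g f], and the homotopy contracts the identity. *)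
Lemma homotopy_top i : (forall p : P i.+1, p = 0) ->
  exists (A : 'M[B]_(rk i.+1, rk i.+2)) (A' : 'M[B]_(rk i, rk i.+1)),
    1%:M = A *m M i.+1 + M i *m A'.
Proof.
move=> P0; have [s [_ sS]] := homotopy.
exists (s i.+1), (s i); apply/row_matrixP => b; rewrite linearD /= !row_mul.
rewrite [in LHS]rowE mulmx1 !rowE -sS [f _ _]P0 raddf0 subr0.
by [].
Qed.

End Comparison.

(** * Linearity of the minimal resolution *)

Section GradedLift.
Variables (k : fieldType) (S : algType k) (gr : nat -> set S).

(** Components of a preimage map to components of its image. With this grading, graded projectivity
    applies to maps that are not surjective. *)
Lemma image_graded_module (X Y : lmodType S^c) (grX : int -> set X)
    (grY : int -> set Y) (f : {linear X -> Y}) :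
  graded_module gr grX -> graded_module gr grY -> graded_hom grX grY f ->
  graded_module gr (fun z => [set y : image_module f | grY z (val y)]).
Proof.
move=> [dsX _] [dsY actY] fgr; split=> [|i j m a gm ga]; last exact: actY.
split=> [z|z x y|y|s F us gF s0 z zs] /=.
- exact: (grade0 dsY).
- exact: (gradeB dsY).
- have [x <-] := image_proj_surj y; case: dsX => _ _ /(_ x)[s [F [gF ->]]] _.
  exists s, (fun z => image_proj f (F z)); split=> [z|]; last by rewrite raddf_sum.
  exact: fgr.
- apply: val_inj; case: dsY => _ _ _ /(_ s (fun z => val (F z))); apply=> //.
  by rewrite -(raddf_sum val) s0.
Qed.

Lemma graded_projective_lift (X Y P : lmodType S^c) (grX : int -> set X)
    (grY : int -> set Y) (grP : int -> set P) (f : {linear X -> Y})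
    (h : {linear P -> Y}) :
  graded_module gr grX -> graded_module gr grY -> graded_hom grX grY f ->
  graded_projective gr grP -> graded_hom grP grY h ->
  (forall p, exists x, f x = h p) ->
  exists2 g : {linear P -> X}, graded_hom grP grX g & forall p, f (g p) = h p.
Proof.
move=> gX gY gf [_ projP] gh him.
have [||g [gg gP]] := projP X (image_module f) grX _ (image_proj f)
  (corestrict him) gX (image_graded_module gX gY gf) _ _ (@image_proj_surj _ _ _ f).
- exact: gf.
- exact: gh.
by exists g => // p; have /(congr1 val) := gP p.
Qed.

End GradedLift.

Section LinearResolution.
Variables (k : fieldType) (S : algType k) (gr : nat -> set S).
Hypothesis gr_connected : connected_graded gr.
Notation B := (S^c : nzRingType).
Notation zgr := (@int_grading B gr).

Lemma connected_ds : direct_sum_decomposition (gr : nat -> set B).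
Proof. by case: gr_connected. Qed.

Lemma connected_mul i j (a b : B) : gr i a -> gr j b -> gr (i + j)%N (a * b).
Proof.
move=> ga gb; rewrite addnC; case: gr_connected => _ _ + _.
by apply.
Qed.

Lemma connected_scalar (c : k) : gr 0%N c%:A.
Proof. by case: gr_connected => _ _ _ ->; exists c. Qed.

Lemma connected_scalarP (a : S) : gr 0%N a -> exists c : k, a = c%:A.
Proof. by case: gr_connected => _ _ _ ->. Qed.

Lemma connected_one : gr 0%N (1 : B).
Proof. by have := connected_scalar 1; rewrite scale1r. Qed.

Lemma connected_div (a : B) : gr 0%N a -> a != 0 ->
  exists2 b : B, gr 0%N b & b * a = 1.
Proof.
move=> /connected_scalarP[c ->] c0; exists (c^-1%:A : S); first exact: connected_scalar.
have c_neq0 : c != 0 by apply: contra c0 => /eqP->; rewrite scale0r.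
suff : (c%:A : S) * c^-1%:A = 1 by [].
by rewrite -scalerAl mul1r scalerA mulfV // scale1r.
Qed.

Notation ds := connected_ds.
Notation zc := (hcomp (int_grading_ds ds)).

Lemma regular_gradingE z (x : S) : regular_grading gr z x = zgr z x.
Proof. by case: z. Qed.

Lemma row_graded_module r (a : 'I_r -> int) : graded_module gr (row_grading gr a).
Proof.
split; first exact: (row_grading_ds ds).
move=> i j m c gm gc b; rewrite mxE addrAC addrC.
by apply: (int_gradingM ds connected_mul) (gm b).
Qed.

Lemma aug0_1 r (b : 'I_r) : ~ aug0 ds (delta_mx b 0 : 'cV[B]_r).
Proof.
move=> /(_ b 0); rewrite mxE !eqxx (hcomp_id _ (i := 0) connected_one).
by apply/eqP; rewrite oner_eq0.
Qed.

Section TrivialModule.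
Variables (K : lmodType S^c) (grK : int -> set K) (u : K).
Hypotheses (K_graded : graded_module gr grK) (K0 : grK 0 = setT).
Hypotheses (u0 : u != 0) (Ku : forall x, exists c : k, x = kscale c u).

(** An element of positive degree moves [u] out of degree 0, where all of [K] lives. *)
Lemma trivial_act (b : B) : b *: u = zc 0 b *: u.
Proof.
have [s [us s0 bs]] := hcomp_finite (int_grading_ds ds) b.
rewrite {1}bs scaler_suml.
have E z : zc z b *: u = if 0 == z then zc 0 b *: u else 0.
  case: eqP => [<-//|/eqP z0]; case: z z0 => [[|m]|m] // _; last first.
    by have -> : zc (Negz m) b = 0 := hcomp_in (int_grading_ds ds) (Negz m) b; rewrite scale0r.
  have [dsK actK] := K_graded.
  apply: (hom_eq0 dsK (i := m.+1%:Z) (j := 0)) => //; last by rewrite K0.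
  have := actK 0 m.+1 u (zc m.+1%:Z b); rewrite add0r; apply; first by rewrite K0.
  exact: (hcomp_in (int_grading_ds ds) m.+1%:Z b).
under eq_bigr do rewrite E.
rewrite (big_seq_pick 0 (fun=> _)) //; case: ifP => // /negbT/s0->.
by rewrite scale0r.
Qed.

Lemma trivial_act_eq0 (b : B) : b *: u = 0 <-> zc 0 b = 0.
Proof.
rewrite trivial_act; split=> [bu|->]; last exact: scale0r.
apply/eqP/negPn/negP => b0.
have [||c _ cb] := @connected_div (zc 0 b) => //.
  exact: (hcomp_in (int_grading_ds ds) 0).
by case/eqP: u0; rewrite -[u]scale1r -cb -scalerA bu scaler0.
Qed.

Definition aug_map (r : nat -> nat) : {linear 'rV[B]_(min_rank r 0) -> K} :=
  @row_linear B K 1 (fun=> u).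

Lemma aug_mapE r (x : 'rV[B]_(min_rank r 0)) : aug_map r x = x 0 0 *: u.
Proof. exact: big_ord1. Qed.

Lemma aug_map_eq0 r (x : 'rV[B]_(min_rank r 0)) : aug_map r x = 0 <-> aug0 ds x.
Proof.
rewrite aug_mapE trivial_act_eq0; split=> [x0 i j|]; last exact.
by rewrite !ord1.
Qed.

End TrivialModule.

Variable n : nat.
Hypothesis S_gldim : gldim_eq S^c n.
Hypothesis S_gor : gorenstein_condition gr n.
Variables (r : nat -> nat) (a : forall i, 'I_(min_rank r i) -> int).
Variable M : forall i, 'M[B]_(min_rank r i.+1, min_rank r i).
Hypothesis resM : minimal_resolution ds a M.
Notation rk := (min_rank r).

(** Comparison with a projective resolution of length [n] contracts the identity of the free module
    at stage [n.+1]. By minimality both summands of the contraction have entries in the augmentation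
    ideal, whereas a diagonal entry 1 does not lie there. *)
Lemma resolution_top : rk n.+1 = 0%N.
Proof.
have [K [grK [_ [_ [_ [_ [[Kgr K0 [u u0 Ku]] _ _ _]]]]]]] := S_gor.
have [M0 Mhom Maug Mex0 Mcomp Mex] := resM.
have [P [d [e [projP resP P0]]]] := S_gldim.1 K.
have ec y : aug_map u r (y *m M 0%N) = 0.
  by apply/(aug_map_eq0 Kgr K0 u0); apply: (aug0_mull connected_mul).
have ex x : aug_map u r x = 0 -> exists y, x = y *m M 0%N.
  by move=> /(aug_map_eq0 Kgr K0 u0); apply: Mex0.
have [f [f0 fS]] := lift_from_free Mcomp ec resP.
have [||g [_ g0 gS]] := lift_to_free Mex ex resP (ok := fun _ _ => True).
- have [|g gP] := projective_lift (f := aug_map u r) (h := e) (projP 0%N).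
    move=> p; have [c ->] := Ku (e p); exists (const_mx (c%:A : S)).
    by rewrite aug_mapE mxE.
  by exists g.
- move=> i g _ gd.
  have [|h hP] := projective_lift (f := mulmxr (M i)) (h := g \o d i) (projP i.+1).
    exact: gd.
  by exists h.
have [p|A [A' E]] := homotopy_top Mcomp Mex ex f0 fS g0 gS (i := n).
  exact: P0.
apply/eqP; rewrite -leqn0 leqNgt; apply/negP => rn.
have /(_ (Ordinal rn) (Ordinal rn)) : aug0 ds (1%:M : 'M[B]_(rk n.+1)).
  rewrite E; apply: aug0D.
    exact: (aug0_mull connected_mul).
  exact: (aug0_mulr connected_mul).
rewrite mxE eqxx (hcomp_id _ (i := 0) connected_one).
by apply/eqP; rewrite oner_eq0.
Qed.

Definition col_grading i (j : int) (y : 'cV[B]_(rk i)) :=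
  forall b, zgr (j + a b) (y b 0).

Definition is_boundary i : 'cV[B]_(rk i) -> Prop :=
  if i is j.+1 return 'cV[B]_(rk i) -> Prop
  then fun y => exists y', y = M j *m y' else fun y => y = 0.

(* The homogeneous columns form the complex Hom(M, S), so that this transports *)
(* the value of Ext(k, S) to the minimal resolution.                          *)
Lemma gorenstein_columns :
  (forall i j y, col_grading j y -> M i *m y = 0 -> i != n \/ j != - n%:Z ->
     is_boundary y) /\
  (forall y1 y2 : 'cV[B]_(rk n), col_grading (- n%:Z) y1 -> col_grading (- n%:Z) y2 ->
     is_boundary y1 \/ exists c : k, is_boundary (y2 + (c%:A : B) *: y1)).
Proof.
have [K [grK [P [grP [d [e [[Kgr K0 [u u0 Ku]] [resP projP egr dgr] En Ei]]]]]]] := S_gor.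
have [M0 Mhom Maug Mex0 Mcomp Mex] := resM.
have ec y : aug_map u r (y *m M 0%N) = 0.
  by apply/(aug_map_eq0 Kgr K0 u0); apply: (aug0_mull connected_mul).
have ex x : aug_map u r x = 0 -> exists y, x = y *m M 0%N.
  by move=> /(aug_map_eq0 Kgr K0 u0); apply: Mex0.
have [f [f0 fS]] := lift_from_free Mcomp ec resP.
have gM i : graded_hom (row_grading gr (@a i.+1)) (row_grading gr (@a i)) (mulmxr (M i)).
  by move=> z x; apply: (row_grading_mulmx ds connected_mul).
(* [g] has to preserve degrees, as the cocycles defining Ext are graded maps. No degree condition is
   imposed on [f], so the boundaries found below are not homogeneous a priori; [boundary_linear]
   repairs this. *)
have [||g [gok g0 gS]] := lift_to_free Mex ex resP
  (ok := fun i g => graded_hom (grP i) (row_grading gr (@a i)) g).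
- have gaug : graded_hom (row_grading gr (@a 0%N)) grK (aug_map u r).
    move=> z x gx; rewrite aug_mapE; move/(_ 0): gx; rewrite M0 subr0.
    have [dsK actK] := Kgr.
    case: z => m /=; last by move=> ->; rewrite scale0r; apply: (grade0 dsK).
    by move=> gx; have := actK 0 m u (x 0 0); rewrite K0 add0r; apply.
  have [|h hgr hP] := graded_projective_lift (row_graded_module (@a 0%N)) Kgr gaug (projP 0%N) egr.
    move=> p; have [c ->] := Ku (e p); exists (const_mx (c%:A : S)).
    by rewrite aug_mapE mxE.
  by exists h.
- move=> i g ggr gd.
  have [| |h hgr hP] := graded_projective_lift (f := mulmxr (M i)) (h := g \o d i)
    (row_graded_module (@a i.+1)) (row_graded_module (@a i)) (@gM i) (projP i.+1).
  + by move=> z p /dgr/ggr.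
  + exact: gd.
  by exists h.
pose phi i (y : 'cV[B]_(rk i)) : {linear P i -> (S^c)^o} :=
  @row_linear B (S^c)^o (rk i) (fun b => y b 0) \o g i.
have phiE i y p : @phi i y p = (g i p *m y) 0 0 by rewrite [RHS]mxE.
have cocy i j y : col_grading j y -> M i *m y = 0 ->
    cocycle grP d (shift j (regular_grading gr)) (@phi i y).
  move=> gy My; split=> [z p gp|p]; last by rewrite phiE -gS -mulmxA My mulmx0 mxE.
  rewrite /shift regular_gradingE phiE mxE; apply: (grade_sum (int_grading_ds ds)) => b _.
  have := int_gradingM ds connected_mul (gok i z p gp b) (gy b).
  by rewrite addrCA subrK.
have bound i j y : M i *m y = 0 ->
    coboundary grP d (shift j (regular_grading gr)) (@phi i y) -> is_boundary y.
  case: i y => [|i] y My /= => [cy|[psi [_ psiP]]].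
    apply: (coboundary0 Mcomp Mex ex f0 fS g0 gS My) => p.
    apply/matrixP => b b'; rewrite !ord1 [RHS]mxE.
    exact: etrans (esym (phiE 0%N y p)) (cy p).
  apply: (coboundaryS Mcomp Mex ex f0 fS g0 gS My (psi := psi)) => p.
  exact: etrans (esym (phiE i.+1 y p)) (psiP p).
split=> [i j y gy My ij|y1 y2 gy1 gy2].
  apply: (bound i j) => //; have cy := cocy i j y gy My.
  case: (eqVneq i n) => [ni|ni]; last exact: (Ei i ni j).
  case: ij => [/eqP/(_ ni) //|jn].
  subst i.
  have [F [FE _ _ F0]] := En j; apply/(F0 _ cy).
  apply: (hom_eq0 (Kgr.1) (FE _ cy) (j := 0)); first by rewrite K0.
  by apply: contra jn => nj; rewrite -(opprK j) eqr_opp eq_sym -addr_eq0.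
(* The next free module is 0, so every column at stage [n] is a cocycle. *)
have top (y : 'cV[B]_(rk n)) : M n *m y = 0.
  by apply/matrixP => b; have := ltn_ord b; rewrite [X in (_ < X)%N]resolution_top.
have c1 := cocy n _ y1 gy1 (top y1); have c2 := cocy n _ y2 gy2 (top y2).
have [F [FE Flin _ F0]] := En (- n%:Z).
have [x1 E1] := Ku (F (phi n y1)); have [x2 E2] := Ku (F (phi n y2)).
have [x10|x10] := eqVneq x1 0.
  left; apply: (bound n (- n%:Z)) => //; apply/(F0 _ c1).
  by rewrite E1 x10 /kscale /right_act scale0r scale0r.
(* The two classes are the multiples [x1] and [x2] of the generator [u] of [K]; this coefficient
   cancels them. *)
right; exists (- x2 / x1); set c := - x2 / x1.
have gy : col_grading (- n%:Z) (y2 + (c%:A : B) *: y1).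
  move=> b; rewrite !mxE; apply: (gradeD (int_grading_ds ds)) => //.
  have := int_gradingM ds connected_mul (connected_scalar c : zgr 0 _) (gy1 b).
  by rewrite add0r.
apply: (bound n (- n%:Z)) => //; have c3 := cocy n _ _ gy (top _).
apply/(F0 _ c3); rewrite (Flin c (phi n y1) (phi n y2)) //.
  rewrite E1 E2 /kscale /right_act scalerA -scalerDl.
  suff -> : (c%:A : S^c) * (x1%:A : S^c) + (x2%:A : S^c) = 0 by rewrite scale0r.
  suff : (x1%:A : S) * c%:A + x2%:A = 0 by [].
  by rewrite -scalerAl mul1r scalerA -scalerDl mulrC divfK // addNr scale0r.
move=> p; rewrite !phiE /kscale /right_act mulmxDr mxE addrC; congr (_ + _).
transitivity (\sum_b g n p 0 b * ((c%:A : B) * y1 b 0)).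
  by rewrite [LHS]mxE; apply: eq_bigr => b _; rewrite [X in _ * X]mxE.
have -> : (g n p *m y1) 0 0 = \sum_b g n p 0 b * y1 b 0 by rewrite mxE.
rewrite -[RHS]/((c%:A : B) * _) mulr_sumr; apply: eq_bigr => b _.
suff H (x y : S) : y * c%:A * x = y * x * c%:A by exact: H.
by rewrite -!scalerAr !mulr1 scalerAl.
Qed.

End LinearResolution.

(** What the potential needs from the resolution, in terms of elements of degrees 0 and 1. [lr_rows]
    is independence of the rows over [k], [lr_cols] exactness of the dual complex before its end,
    and [lr_last] says that linear forms are boundaries at the end, where the surviving class is
    constant. *)
Record linear_resolution (k : fieldType) (S : algType k) (gr : nat -> set S) (n : nat)
    (r : nat -> nat) (M : forall i, 'M[S^c]_(min_rank r i.+1, min_rank r i)) : Prop := {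
  lr_top : min_rank r n = 1%N;
  lr_linear : forall i, (i < n)%N -> forall b c, gr 1%N (M i b c);
  lr_comp : forall i, M i.+1 *m M i = 0;
  lr_rows : forall i (x : 'rV[S^c]_(min_rank r i.+1)), (i < n)%N ->
    (forall b, gr 0%N (x 0 b)) -> x *m M i = 0 -> x = 0;
  lr_cols : forall i (y : 'cV[S^c]_(min_rank r i.+1)), (i.+1 < n)%N ->
    (forall b, gr 1%N (y b 0)) -> M i.+1 *m y = 0 ->
    exists2 y' : 'cV[S^c]_(min_rank r i), (forall b, gr 0%N (y' b 0)) & y = M i *m y';
  lr_last : forall i (y : 'cV[S^c]_(min_rank r i.+1)), i.+1 = n ->
    (forall b, gr 1%N (y b 0)) ->
    exists2 y' : 'cV[S^c]_(min_rank r i), (forall b, gr 0%N (y' b 0)) & y = M i *m y' }.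

Lemma qpa_connected (k : fieldType) (S : algType k) (gr : nat -> set S) n :
  quantum_polynomial_algebra gr n -> connected_graded gr.
Proof. by case. Qed.

Section LinearResolution.
Variables (k : fieldType) (S : algType k) (gr : nat -> set S) (n : nat).
Hypothesis S_qpa : quantum_polynomial_algebra gr n.
Notation B := (S^c : nzRingType).
Notation zgr := (@int_grading B gr).

Notation gr_connected := (qpa_connected S_qpa).
Let S_gldim : gldim_eq S^c n. Proof. by case: S_qpa. Qed.
Let S_gor : gorenstein_condition gr n. Proof. by case: S_qpa. Qed.

Notation ds := (connected_ds gr_connected).
Let gmul := connected_mul gr_connected.
Notation zc := (hcomp (int_grading_ds ds)).

Variables (r : nat -> nat) (a : forall i, 'I_(min_rank r i) -> int).
Variable M : forall i, 'M[B]_(min_rank r i.+1, min_rank r i).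
Hypothesis resM : minimal_resolution ds a M.
Notation rk := (min_rank r).

Lemma boundary_aug0 i (y : 'cV[B]_(rk i)) : is_boundary M y -> aug0 ds y.
Proof.
case: i y => [|i] y /= => [-> b c|[y' ->]]; first by rewrite mxE raddf0.
by apply: (aug0_mulr gmul); apply: (mr_aug resM).
Qed.

Lemma delta_grading i (b : 'I_(rk i)) :
  col_grading gr a (- a b) (delta_mx b 0 : 'cV[B]_(rk i)).
Proof.
move=> c; rewrite mxE eqxx andbT; case: eqP => [->|_].
  by rewrite addNr; apply: (connected_one gr_connected).
exact: (grade0 (int_grading_ds ds)).
Qed.

Let columns := gorenstein_columns S_gldim S_gor resM.

(** At the end a basis column is a cocycle, and its entry 1 keeps it from being a boundary; so its
    degree must be the one in which cohomology survives. *)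
Lemma top_degree (b : 'I_(rk n)) : a b = n.
Proof.
apply/eqP/negPn/negP => bn; apply: (@aug0_1 _ _ _ gr_connected _ b).
apply/boundary_aug0/(columns.1 _ _ _ (delta_grading b)).
  apply/matrixP => c; have := ltn_ord c.
  by rewrite [X in (_ < X)%N](resolution_top S_gldim S_gor resM).
by right; apply: contra bn => /eqP/oppr_inj->.
Qed.

(** Minimality excludes entries of degree 0, and the grading of [S] excludes negative degrees. *)
Lemma entry_degree i b c : M i b c != 0 -> a c < a b.
Proof.
move=> Mbc; have := mr_hom resM b c; have := mr_aug resM b c; rewrite -[a c < a b]subr_gt0.
case: (a b - a c) => [[|m]|m] //=.
  by move=> M0 gM; rewrite -(hcomp_id (int_grading_ds ds) (i := 0) gM) M0 eqxx in Mbc.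
by move=> _ /= M0; rewrite M0 eqxx in Mbc.
Qed.

(** A zero column would make a basis column a cocycle, hence a boundary before the end, against
    minimality. [row_nonzero] is the same argument on the resolution itself. *)
Lemma column_nonzero i (c : 'I_(rk i)) : (i < n)%N -> exists b, M i b c != 0.
Proof.
move=> i_n; apply: contrapT => /forallNP Mc; apply: (@aug0_1 _ _ _ gr_connected _ c).
apply/boundary_aug0/(columns.1 _ _ _ (delta_grading c)).
  by rewrite -colE; apply/colP => b; rewrite !mxE; have /negP/negPn/eqP := Mc b.
by left; rewrite ltn_eqF.
Qed.

Lemma row_nonzero i (b : 'I_(rk i.+1)) : exists c, M i b c != 0.
Proof.
apply: contrapT => /forallNP Mb.
have [|y yE] := mr_ex resM (i := i) (x := delta_mx 0 b).
  by rewrite -rowE; apply/rowP => c; rewrite !mxE; have /negP/negPn/eqP := Mb c.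
have : aug0 ds (delta_mx 0 b : 'rV[B]_(rk i.+1)).
  by rewrite yE; apply: (aug0_mull gmul); apply: (mr_aug resM).
move=> /(_ 0 b); rewrite mxE !eqxx (hcomp_id _ (i := 0) (connected_one gr_connected)).
by apply/eqP; rewrite oner_eq0.
Qed.

(* The degrees of the generators increase strictly along the resolution by    *)
(* minimality, and those of the dual complex do too, starting from -n.        *)
Lemma degree_le i (b : 'I_(rk i)) : (i <= n)%N -> a b <= i.
Proof.
move=> /subnK; move: (n - i)%N => m; elim: m i b => [|m IH] i b mi.
  by move: b; rewrite add0n in mi; rewrite mi => b; rewrite top_degree.
have [|c Mcb] := @column_nonzero i b; first by rewrite -mi; lia.
have := entry_degree Mcb; have := IH i.+1 c; rewrite -mi addSnnS => /(_ erefl).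
by lia.
Qed.

Lemma degree_ge i (b : 'I_(rk i)) : i%:Z <= a b.
Proof.
elim: i b => [|i IH] b; first by rewrite (mr_deg0 resM).
have [c Mbc] := row_nonzero b; have := entry_degree Mbc; have := IH c; lia.
Qed.

Lemma degreeE i (b : 'I_(rk i)) : (i <= n)%N -> a b = i.
Proof. by move=> i_n; apply/eqP; rewrite eq_le degree_le // degree_ge. Qed.

Lemma rank_gt0 i : (i <= n)%N -> (0 < rk i)%N.
Proof.
elim: i => // i IH i_n; have [b _] := column_nonzero (Ordinal (IH (ltnW i_n))) i_n.
exact: leq_ltn_trans (ltn_ord b).
Qed.

(** Two basis columns would be dependent modulo boundaries, whose entries lie in the augmentation
    ideal. *)
Lemma rank_top : rk n = 1%N.
Proof.
apply/eqP; rewrite eqn_leq rank_gt0 // andbT leqNgt; apply/negP => n1.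
pose b1 := Ordinal (ltnW n1); pose b2 := Ordinal n1.
have g b : col_grading gr a (- n%:Z) (delta_mx b 0 : 'cV[B]_(rk n)).
  by have := delta_grading b; rewrite top_degree.
have [/boundary_aug0|[c /boundary_aug0]] := columns.2 _ _ (g b1) (g b2).
  exact: aug0_1.
move=> /(_ b2 0); rewrite !mxE !eqxx /= mulr0 addr0.
rewrite (hcomp_id _ (i := 0) (connected_one gr_connected)).
by apply/eqP; rewrite oner_eq0.
Qed.

(** The entries of [M i] all have degree 1, so the degree-0 components of [y'] already produce
    [y]. *)
Lemma boundary_linear i (y : 'cV[B]_(rk i.+1)) : (i < n)%N ->
  (forall b, gr 1%N (y b 0)) -> is_boundary M y ->
  exists2 y' : 'cV[S^c]_(rk i), (forall b, gr 0%N (y' b 0)) & y = M i *m y'.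
Proof.
move=> i_n gy [y' yE]; exists (\col_b zc 0 (y' b 0)) => [b|].
  by rewrite mxE; apply: (hcomp_in (int_grading_ds ds) 0).
apply/colP => b; rewrite [RHS]mxE -(hcomp_id (int_grading_ds ds) (i := 1) (gy b)).
rewrite yE mxE raddf_sum /=; apply: eq_bigr => c _; rewrite mxE.
have hM := mr_hom resM b c.
rewrite (hcomp_mull ds gmul _ _ hM) !degreeE ?(ltnW i_n) //.
by rewrite intS addrK subrr.
Qed.

Lemma resolution_is_linear : linear_resolution gr n M.
Proof.
have gM i : (i < n)%N -> forall b c, gr 1%N (M i b c).
  move=> i_n b c; have := mr_hom resM b c.
  by rewrite !degreeE ?(ltnW i_n) // intS addrK.
split=> // [||i x i_n gx /(mr_ex resM)[y yE]|i y i_n gy My|i y ni gy].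
- exact: rank_top.
- exact: (mr_comp resM).
- apply/rowP => b; rewrite -[LHS](hcomp_id (int_grading_ds ds) (i := 0) (gx b)) [RHS]mxE.
  have : aug0 ds x by rewrite yE; apply: (aug0_mull gmul); apply: (mr_aug resM).
  exact.
- have gy' : col_grading gr a (- i%:Z) y.
    by move=> b; rewrite degreeE ?(ltnW i_n) // intS addrCA addNr addr0; apply: gy.
  apply: (boundary_linear (ltnW i_n) gy); apply: (columns.1 _ _ _ gy' My).
  by left; rewrite ltn_eqF.
- have i_n : (i < n)%N by rewrite -ni.
  have gy' : col_grading gr a (- i%:Z) y.
    by move=> b; rewrite degreeE // intS addrCA addNr addr0; apply: gy.
  apply: (boundary_linear i_n gy); apply: (columns.1 _ _ _ gy').
    apply/matrixP => c; have := ltn_ord c.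
    have E : rk i.+2 = 0%N by rewrite ni; apply: (resolution_top S_gldim S_gor resM).
    by rewrite [X in (_ < X)%N]E.
  by right; rewrite eqr_opp -ni eqz_nat ltn_eqF.
Qed.

End LinearResolution.

Theorem linear_resolution_exists (k : fieldType) (S : algType k) (gr : nat -> set S) n :
  quantum_polynomial_algebra gr n ->
  exists r M, @linear_resolution k S gr n r M.
Proof.
move=> S_qpa; have [_ [_ noeth] _ _ _] := S_qpa.
pose gc := qpa_connected S_qpa.
have [r [a [M resM]]] := minimal_resolution_exists (connected_ds gc)
  (connected_mul gc) (connected_div gc) noeth.
by exists r, M; apply: resolution_is_linear resM.
Qed.

(** * Tensors as functions on words *)

Section Words.
Variables (k : fieldType) (I : choiceType).
Local Notation FA := (free_algebra k I).
Implicit Types (x y : FA) (s t w : seq I).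

Definition wcoef w (x : {malg k[{fmonom I}]}) : k := x@_(FMonom w).
Definition word w : FA := << FMonom w >>.

Lemma wcoef_is_linear w : linear_for *%R (wcoef w : FA -> k).
Proof. by move=> c x y; rewrite /wcoef mcoeffD mcoeffZ. Qed.

HB.instance Definition _ w :=
  GRing.isLinear.Build k FA k _ (wcoef w : FA -> k) (wcoef_is_linear w).

Lemma wcoefZ w c x : wcoef w (c *: x) = c * wcoef w x.
Proof. exact: mcoeffZ. Qed.

Lemma wcoef_ext x y : (forall w, wcoef w x = wcoef w y) -> x = y.
Proof. by move=> xy; apply/malgP => u; have := xy (fmonom_val u); rewrite /wcoef fmK. Qed.

Lemma wcoef_word s w : wcoef w (word s) = (s == w)%:R.
Proof. by rewrite /wcoef /word mcoeffU1; congr (_%:R); rewrite fmP. Qed.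

Lemma wcoef_sum_word (A : Type) (r : seq A) (P : pred A) (c : A -> k) (f : A -> seq I) w :
  wcoef w (\sum_(i <- r | P i) c i *: word (f i)) =
  \sum_(i <- r | P i) c i * (f i == w)%:R.
Proof. by rewrite raddf_sum; apply: eq_bigr => i _; rewrite /= wcoefZ wcoef_word. Qed.

Lemma word_expansion x : x = \sum_(u <- msupp x) wcoef (fmonom_val u) x *: word (fmonom_val u).
Proof.
rewrite {1}(monalgE x); apply: eq_bigr => u _.
rewrite /wcoef /word fmK; apply/malgP => v.
by rewrite [RHS]mcoeffZ [in RHS]mcoeffU1 mulr_natr mcoeffU.
Qed.

Lemma wordM s t : word s * word t = word (s ++ t).
Proof.
rewrite /word; apply/malgP => v; rewrite mcoeffMl !msuppU1 !big_seq_fset1.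
by rewrite !mcoeffU1 !eqxx mulr1; congr (_ *+ (_ == v)); apply/eqP; rewrite fmP fmM.
Qed.

Lemma word_nil : word [::] = 1.
Proof. by rewrite /word -fmoneE. Qed.

Lemma wcoefM w x y :
  wcoef w (x * y) = \sum_(j < (size w).+1) wcoef (take j w) x * wcoef (drop j w) y.
Proof.
rewrite /wcoef mcoeffMl.
under [RHS]eq_bigr => j _.
  rewrite [X in X@_ _ * _](word_expansion x) [X in _ * X@_ _](word_expansion y).
  rewrite -!/(wcoef _ _) !wcoef_sum_word mulr_suml; over.
rewrite [RHS]exchange_big; apply: eq_bigr => u _ /=.
under [RHS]eq_bigr do rewrite mulr_sumr.
rewrite [RHS]exchange_big; apply: eq_bigr => v _ /=.
have -> : (monalg.mmul u v == FMonom w) = (fmonom_val u ++ fmonom_val v == w) by rewrite fmP fmM.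
rewrite /wcoef !fmK.
under [RHS]eq_bigr do rewrite mulrACA.
rewrite -mulr_sumr -mulr_natr; congr (_ * _).
case: eqP => [<-|uv].
  have su : (size u < (size (u ++ v)).+1)%N by rewrite size_cat ltnS leq_addr.
  rewrite (bigD1 (Ordinal su)) //= take_size_cat // drop_size_cat // !eqxx mulr1.
  rewrite big1 ?addr0 // => j /eqP ju; case: eqP => [E|]; last by rewrite mul0r.
  case: ju; apply/val_inj; rewrite /= {2}E size_takel //.
  by rewrite -ltnS.
rewrite big1 // => j _; case: eqP => [E|]; last by rewrite mul0r.
by case: eqP => [E'|]; rewrite ?mulr0 //; case: uv; rewrite {1}E {1}E' cat_take_drop.
Qed.

Lemma free_scalerAr (c : k) x y : x * (c *: y) = c *: (x * y).
Proof.
apply: wcoef_ext => w; rewrite [RHS]wcoefZ [in LHS]wcoefM [in RHS]wcoefM [RHS]mulr_sumr.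
by apply: eq_bigr => j _; rewrite [in LHS]wcoefZ mulrCA.
Qed.

Lemma free_gradingP (wt : I -> nat) m x : free_grading wt m x <->
  forall w, wcoef w x != 0 -> (\sum_(i <- w) wt i)%N = m.
Proof.
split=> H w; first by rewrite /wcoef mcoeff_neq0 => /H.
by move=> wx; apply: H; rewrite /wcoef fmK mcoeff_neq0.
Qed.

Lemma homogP m x : free_grading (fun=> 1%N) m x <->
  forall w, size w != m -> wcoef w x = 0.
Proof.
rewrite free_gradingP; split=> H w.
  by move=> wm; apply: contraNeq wm => /H <-; rewrite sum1_size.
by rewrite sum1_size => wx; apply: contraNeq wx => /H ->.
Qed.

Lemma homogM m m' x y : free_grading (fun=> 1%N) m x ->
  free_grading (fun=> 1%N) m' y -> free_grading (fun=> 1%N) (m + m') (x * y).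
Proof.
move=> /homogP hx /homogP hy; apply/homogP => w wm; rewrite wcoefM big1 // => j _.
have [jm|jm] := eqVneq (nat_of_ord j) m; last first.
  by rewrite hx ?mul0r // size_takel // -ltnS.
rewrite hy ?mulr0 // size_drop; have := ltn_ord j; move: wm; rewrite jm; lia.
Qed.

Lemma homog_word w : free_grading (fun=> 1%N) (size w) (word w).
Proof.
by apply/homogP => v; rewrite wcoef_word; case: (w =P v) => [->|//]; rewrite eqxx.
Qed.

Lemma homog_subspace m : subspace (free_grading (fun=> 1%N) m : set FA).
Proof.
split=> [|c x y /homogP hx /homogP hy]; apply/homogP => w wm; first exact: mcoeff0.
by rewrite linearP /= hx // hy // mulr0 addr0.
Qed.

Lemma homog_sum m (A : Type) (r : seq A) (P : pred A) (F : A -> FA) :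
  (forall i, P i -> free_grading (fun=> 1%N) m (F i)) ->
  free_grading (fun=> 1%N) m (\sum_(i <- r | P i) F i).
Proof.
move=> hF; apply/homogP => w wm; rewrite raddf_sum /= big1 // => i Pi.
by have /homogP -> := hF i Pi.
Qed.

Lemma homogZ m c x : free_grading (fun=> 1%N) m x -> free_grading (fun=> 1%N) m (c *: x).
Proof.
by move=> /homogP hx; apply/homogP => w wm; rewrite wcoefZ hx ?mulr0.
Qed.

End Words.

Section FiniteWords.
Variables (k : fieldType) (I : finType).
Local Notation FA := (free_algebra k I).
Implicit Types (x y : FA).

Lemma homog_expansion m x : free_grading (fun=> 1%N) m x ->
  x = \sum_(u : m.-tuple I) wcoef u x *: word k u.
Proof.
move=> /homogP hx; apply: wcoef_ext => w.
rewrite (wcoef_sum_word _ _ (fun u : m.-tuple I => wcoef u x) (fun u => tval u)).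
have [wm|wm] := eqVneq (size w) m; last first.
  rewrite hx // big1 // => u _; case: eqP => [uw|]; last by rewrite mulr0.
  by rewrite -uw size_tuple eqxx in wm.
rewrite (bigD1 (Tuple (introT eqP wm))) //= eqxx mulr1 big1 ?addr0 // => u uw.
by case: eqP => [E|]; rewrite ?mulr0 //; case/eqP: uw; apply: val_inj.
Qed.

Lemma homog2_expansion x : free_grading (fun=> 1%N) 2 x ->
  x = \sum_i \sum_j wcoef [:: i; j] x *: word k [:: i; j].
Proof.
move=> /homogP hx; apply: wcoef_ext => w; rewrite raddf_sum /=.
under eq_bigr do rewrite wcoef_sum_word.
have [|w1] := eqVneq (size w) 2; last first.
  rewrite hx // big1 // => i _; rewrite big1 // => j _.
  by case: eqP => [E|_]; [rewrite -E eqxx in w1 | rewrite mulr0].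
case: w => [|i [|j []]] // _; rewrite (bigD1 i) //= (bigD1 j) //= eqxx mulr1.
rewrite !big1 ?addr0 // => [i' ii'|j' jj'].
  by rewrite big1 // => j' _; rewrite eqseq_cons (negbTE ii') mulr0.
by rewrite !eqseq_cons (negbTE jj') andbF mulr0.
Qed.

End FiniteWords.

Section LinearSpan.
Variables (k : fieldType) (M : lmodType k).
Implicit Types (X W : set M).

Lemma linear_span_subspace X : subspace (linear_span X).
Proof.
split; first by exists 0%N, (fun=> 0), (fun=> 0); split=> [[]|] //; rewrite big_ord0.
move=> c _ _ [r [a [y [Xy ->]]]] [r' [a' [y' [Xy' ->]]]].
exists (r + r')%N, (fun i => match split i with inl i => c * a i | inr i => a' i end),
  (fun i => match split i with inl i => y i | inr i => y' i end); split.
  by move=> i; case: split.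
rewrite big_split_ord /= scaler_sumr; congr (_ + _); apply: eq_bigr => i _.
  by rewrite (unsplitK (inl i)) scalerA.
by rewrite (unsplitK (inr i)).
Qed.

Lemma linear_span_mem X x : X x -> linear_span X x.
Proof. by move=> Xx; exists 1%N, (fun=> 1), (fun=> x); rewrite big_ord1 scale1r. Qed.

Lemma subspace_sum W (I : Type) (s : seq I) (P : pred I) (c : I -> k) (y : I -> M) :
  subspace W -> (forall i, P i -> W (y i)) -> W (\sum_(i <- s | P i) c i *: y i).
Proof.
move=> [W0 WC] Wy; elim/big_rec: _ => // i x Pi Wx.
by apply: WC => //; apply: Wy.
Qed.

Lemma linear_span_min X W : subspace W -> X `<=` W -> linear_span X `<=` W.
Proof.
by move=> sW XW _ [r [c [y [Xy ->]]]]; apply: subspace_sum => // i _; apply: XW.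
Qed.

Lemma subspaceZ W c x : subspace W -> W x -> W (c *: x).
Proof. by move=> [W0 WC] Wx; rewrite -[_ *: _]addr0; apply: WC. Qed.

Lemma linear_span_id W : subspace W -> linear_span W = W.
Proof.
move=> sW; apply/seteqP; split; first exact: linear_span_min.
by move=> x; apply: linear_span_mem.
Qed.

End LinearSpan.

Section Ideal.
Variables (k : fieldType) (I : choiceType).
Local Notation FA := (free_algebra k I).
Local Notation homog := (free_grading (fun=> 1%N)).

Lemma wcoefM_head m (x y : FA) s t : homog m x -> size s = m ->
  wcoef (s ++ t) (x * y) = wcoef s x * wcoef t y.
Proof.
move=> + sm; subst m => /homogP hx; rewrite wcoefM.
have ms : (size s < (size (s ++ t)).+1)%N by rewrite size_cat ltnS leq_addr.
rewrite (bigD1 (Ordinal ms)) //= take_size_cat // drop_size_cat //.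
rewrite big1 ?addr0 // => j jm; rewrite hx ?mul0r // size_takel; last by rewrite -ltnS.
by apply: contra jm => /eqP jm; apply/eqP/val_inj; rewrite /= jm.
Qed.

Lemma wcoefM_mid m (a y b : FA) w : homog m y -> size w = m ->
  wcoef w (a * y * b) = wcoef [::] a * wcoef [::] b * wcoef w y.
Proof.
move=> /homogP hy wm; rewrite wcoefM.
rewrite (bigD1 ord_max) //= take_size drop_size [X in _ + X]big1 ?addr0 => [|j jm].
  rewrite wcoefM (bigD1 ord0) //= take0 drop0 big1 ?addr0; first by rewrite mulrAC.
  move=> j j0; rewrite hy ?mulr0 // size_drop.
  have := ltn_ord j; have : nat_of_ord j != 0%N by apply: contra j0 => /eqP j0; apply/eqP/val_inj.
  by lia.
rewrite wcoefM big1 ?mul0r // => l _; rewrite hy ?mulr0 // size_drop.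
have sj : size (take j w) = j by rewrite size_takel // -ltnS.
have := ltn_ord j; have : nat_of_ord j != size w by apply: contra jm => /eqP jm; apply/eqP/val_inj.
by lia.
Qed.

(** In degree [m] a product [a * y * b] with [y] of degree [m] contributes only through the constant
    terms of [a] and [b]. *)
Lemma ideal_homog m (X : set FA) x : X `<=` homog m ->
  two_sided_ideal X x -> homog m x -> linear_span X x.
Proof.
move=> Xm [r [a [b [y [Xy xE]]]]] /homogP hx.
exists r, (fun i => wcoef [::] (a i) * wcoef [::] (b i)), y; split=> //.
apply: wcoef_ext => w; have [wm|wm] := eqVneq (size w) m; last first.
  rewrite hx // raddf_sum big1 // => i _ /=; rewrite wcoefZ.
  by have /homogP -> := Xm _ (Xy i); rewrite ?mulr0.
rewrite xE !raddf_sum; apply: eq_bigr => i _ /=.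
by rewrite wcoefZ (wcoefM_mid _ _ (Xm _ (Xy i)) wm).
Qed.

Lemma ideal_low m m' (X : set FA) x : X `<=` homog m -> (m' < m)%N ->
  two_sided_ideal X x -> homog m' x -> x = 0.
Proof.
move=> Xm m'm [r [a [b [y [Xy xE]]]]] /homogP hx.
apply: wcoef_ext => w; rewrite [RHS]raddf0; have [wm|wm] := eqVneq (size w) m'; last exact: hx.
rewrite xE raddf_sum big1 // => i _ /=; rewrite wcoefM big1 // => j _.
have /homogP hy := Xm _ (Xy i).
rewrite wcoefM big1 ?mul0r // => l _; rewrite hy ?mulr0 // size_drop.
have sj : size (take j w) = j by rewrite size_takel // -ltnS.
by have := ltn_ord j; lia.
Qed.

End Ideal.

(** Adjacent swaps carry any letter to the front ([bring]); induction handles the rest of the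
    word. *)
Lemma perm_eq_invariant (I : eqType) (A : Type) (f : seq I -> A) :
  (forall u p q v, f (u ++ p :: q :: v) = f (u ++ q :: p :: v)) ->
  forall s t, perm_eq s t -> f s = f t.
Proof.
have bring (g : seq I -> A) x v : (forall u p q v, g (u ++ p :: q :: v) = g (u ++ q :: p :: v)) ->
    forall u, g (u ++ x :: v) = g (x :: u ++ v).
  move=> gS u; elim/last_ind: u v => // u y IH v.
  by rewrite -cats1 -!catA /= gS IH.
move=> fS s; elim: s f fS => [|x s IH] f fS t st.
  by move/perm_size: (st) => /esym/size0nil ->.
have xt : x \in t by rewrite -(perm_mem st) inE eqxx.
case/splitPr: t / xt st => u v; rewrite perm_sym -cat1s perm_catCA perm_cons perm_sym => st.
rewrite bring //; apply: (IH (fun s => f (x :: s))) => // u' p q v'.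
exact: (fS (x :: u')).
Qed.

Section SymmetricTensors.
Variables (k : fieldType) (V : vectType k).
Local Notation T := (tensor_algebra V).
Local Notation I := 'I_(\dim {:V}).

Lemma permute_factorsE m (s : 'S_m) (w : T) :
  permute_factors s w = \sum_(u : m.-tuple I) wcoef u w *: word k [tuple tnth u (s j) | j < m].
Proof. by []. Qed.

Lemma symmetric_of_adjacent m (w : T) : tensor_power m w ->
  (forall u p q v, wcoef (u ++ p :: q :: v) w = wcoef (u ++ q :: p :: v) w) ->
  symmetric_tensors m w.
Proof.
move=> hw adj; split=> // s; rewrite permute_factorsE [RHS](homog_expansion hw).
pose h (u : m.-tuple I) := [tuple tnth u (s j) | j < m].
have hK : bijective h.
  exists (fun u => [tuple tnth u ((s^-1)%g j) | j < m]) => u;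
    by apply: eq_from_tnth => j; rewrite !tnth_mktuple (permK, permKV).
rewrite [RHS](reindex h) /=; last exact: onW_bij.
apply: eq_bigr => u _; suff -> : wcoef u w = wcoef (h u) w by [].
apply: (perm_eq_invariant (f := fun v => wcoef v w)) => //.
by rewrite perm_sym; apply/tuple_permP; exists s.
Qed.

Lemma adjacent_of_symmetric m (w : T) u p q : symmetric_tensors m w ->
  wcoef (u ++ [:: p; q]) w = wcoef (u ++ [:: q; p]) w.
Proof.
move=> [/homogP hw sym]; have [um|um] := eqVneq (size u + 2)%N m; last first.
  by rewrite !hw // size_cat.
have am : (size u < m)%N by lia.
have bm : ((size u).+1 < m)%N by lia.
pose s := tperm (Ordinal am) (Ordinal bm).
pose h (t : m.-tuple I) := [tuple tnth t (s j) | j < m].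
have hh t : h (h t) = t.
  by apply: eq_from_tnth => j; rewrite !tnth_mktuple tpermK.
have sz : size (u ++ [:: p; q]) == m by rewrite size_cat um.
pose t := Tuple sz.
have -> : u ++ [:: q; p] = h t.
  apply: (@eq_from_nth _ p); first by rewrite size_tuple size_cat um.
  move=> i; rewrite size_cat um => im.
  rewrite -[RHS](tnth_nth p (h t) (Ordinal im)) tnth_mktuple (tnth_nth p) /= !nth_cat.
  case: tpermP => [/(congr1 val)/= ->|/(congr1 val)/= ->|/eqP ia /eqP ib] /=.
  - by rewrite ltnn subnn ltnNge leqnSn /= subSnn.
  - by rewrite ltnn subnn ltnNge leqnSn /= subSnn.
  - case: ltnP => // ui; exfalso; have iu : i != size u := ia; have : i != (size u).+1 := ib.
    by move: um im ui iu {ia ib t sz h hh s am bm}; move: (size u) => l; lia.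
rewrite -{1}(sym s) permute_factorsE.
rewrite (wcoef_sum_word _ _ (fun u : m.-tuple I => wcoef u w) (fun u => tval (h u))).
rewrite (bigD1 (h t)) // hh eqxx mulr1 big1 => [|v vt]; first exact: addr0.
case: eqP => [E|_]; last exact: mulr0.
have hv : h v = t by apply: val_inj.
by rewrite -hv hh eqxx in vt.
Qed.

End SymmetricTensors.

(** * The symmetric potential *)

Lemma linear_comb (k : fieldType) (X Y : lmodType k) (h : {linear X -> Y})
    (J : Type) (s : seq J) (c : J -> k) (f : J -> X) :
  h (\sum_(j <- s) c j *: f j) = \sum_(j <- s) c j *: h (f j).
Proof. by rewrite linear_sum; apply: eq_bigr => j _; apply: linearZZ. Qed.

Section Contraction.
Variables (k : fieldType) (V : vectType k).
Local Notation T := (tensor_algebra V).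
Local Notation I := 'I_(\dim {:V}).
Local Notation homog := (free_grading (fun=> 1%N)).
Implicit Types (psi : {linear V -> k^o}) (x y : T).

Lemma wcoef_contract psi x t :
  wcoef t (contract psi x) = \sum_i psi (tnth (vbasis {:V}) i) * wcoef (i :: t) x.
Proof.
rewrite /contract raddf_sum /=.
transitivity (\sum_(u <- msupp x) \sum_i psi (tnth (vbasis {:V}) i) *
    (wcoef (fmonom_val u) x * (fmonom_val u == i :: t)%:R)).
  apply: eq_bigr => u _; case Eu : (fmonom_val u) => [|j s].
    by rewrite raddf0 big1 // => i _; rewrite eq_sym mulr0 mulr0.
  rewrite -/(word k s) wcoefZ wcoef_word (bigD1 j) //= eqseq_cons eqxx /=.
  rewrite big1 ?addr0 => [|i ij]; last by rewrite eqseq_cons eq_sym (negbTE ij) !mulr0.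
  by rewrite -Eu /wcoef fmK mulrA; congr (_ * _); rewrite mulrC.
rewrite exchange_big; apply: eq_bigr => i _; rewrite -mulr_sumr; congr (_ * _).
by rewrite [in RHS](word_expansion x) wcoef_sum_word.
Qed.

Lemma contractD psi c x y : contract psi (c *: x + y) = c *: contract psi x + contract psi y.
Proof.
apply: wcoef_ext => t; rewrite [LHS]wcoef_contract.
transitivity (c * wcoef t (contract psi x) + wcoef t (contract psi y)); last exact/esym/linearP.
apply: etrans (esym (congr2 (fun a b => c * a + b) (wcoef_contract psi x t) (wcoef_contract psi y t))).
rewrite mulr_sumr -big_split /=.
by apply: eq_bigr => i _; rewrite [wcoef _ _]linearP /= mulrDr mulrCA.
Qed.

Definition lin_eval psi x : k := \sum_i wcoef [:: i] x * psi (tnth (vbasis {:V}) i).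

Lemma contractM psi x y : homog 1 x -> contract psi (x * y) = lin_eval psi x *: y.
Proof.
move=> hx; apply: wcoef_ext => t; rewrite wcoef_contract wcoefZ mulr_suml.
apply: eq_bigr => i _; rewrite -[i :: t]/([:: i] ++ t).
by rewrite (wcoefM_head _ _ hx) // mulrA; congr (_ * _); rewrite mulrC.
Qed.

HB.instance Definition _ psi :=
  GRing.isLinear.Build k T T _ (contract psi : T -> T) (contractD psi).

Lemma contract_sum psi (J : Type) (s : seq J) (c : J -> k) (f : J -> T) :
  contract psi (\sum_(j <- s) c j *: f j) = \sum_(j <- s) c j *: contract psi (f j).
Proof. exact: (linear_comb (contract psi : {linear T -> T})). Qed.

Definition coord_form (l : I) : {linear V -> k^o} :=
  coord (vbasis {:V}) l : {linear V -> k^o}.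

Lemma lin_eval_coord l x : lin_eval (coord_form l) x = wcoef [:: l] x.
Proof.
rewrite /lin_eval (bigD1 l) //= (tnth_nth 0) coord_free ?eqxx ?mulr1; last first.
  exact: basis_free (vbasisP _).
rewrite big1 ?addr0 // => i il; rewrite (tnth_nth 0) coord_free.
  by rewrite (_ : _ == _ = false) ?mulr0 //; apply/negbTE.
exact: basis_free (vbasisP _).
Qed.

End Contraction.

Section LinearChain.
Variables (k : fieldType) (V : vectType k) (n : nat).
Local Notation T := (tensor_algebra V).
Local Notation I := 'I_(\dim {:V}).
Local Notation homog := (free_grading (fun=> 1%N)).
Variables (R : set T) (S : algType k) (pi : {lrmorphism T -> S}).
Hypotheses (R_sub : subspace R) (R_quad : R `<=` tensor_power 2).
Hypothesis pi_R : presents pi R.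
Hypothesis R_sym : forall x p q, R x -> wcoef [:: p; q] x = wcoef [:: q; p] x.
Local Notation gr := (tensor_quotient_grading pi).

Lemma kernel2 (x : T) : homog 2 x -> pi x = 0 -> R x.
Proof.
move=> hx /(pi_R.2 x) ix; rewrite -(linear_span_id R_sub).
exact: ideal_homog ix hx.
Qed.

Lemma kernel1 (x : T) : homog 1 x -> pi x = 0 -> x = 0.
Proof. by move=> hx /(pi_R.2 x) ix; exact: (ideal_low R_quad _ ix hx). Qed.

Lemma scalar_grade0 (a : S) : gr 0%N a -> exists c : k, a = c%:A.
Proof.
move=> [x /homogP hx <-]; exists (wcoef [::] x).
have {1}-> : x = (wcoef [::] x)%:A; last exact: rmorph_alg.
apply: wcoef_ext => w; rewrite wcoefZ -word_nil wcoef_word.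
by case: w => [|i w]; rewrite ?mulr1 // hx ?mulr0.
Qed.

Variables (r : nat -> nat).
Local Notation rk := (min_rank r).
Variable M : forall i, 'M[S^c]_(rk i.+1, rk i).
Hypothesis linM : linear_resolution gr n M.

Lemma entry_lift : exists ell : forall i, 'I_(rk i.+1) -> 'I_(rk i) -> T,
  forall i b c, (i < n)%N -> homog 1 (ell i b c) /\ pi (ell i b c) = M i b c.
Proof.
pose Q i (f : 'I_(rk i.+1) -> 'I_(rk i) -> T) := forall b c, (i < n)%N ->
  homog 1 (f b c) /\ pi (f b c) = M i b c.
have ex i : exists f, Q i f.
  have [i_n|i_n] := boolP (i < n)%N; last first.
    by exists (fun _ _ => 0) => b c; rewrite (negbTE i_n).
  have /choice[f fP] (p : 'I_(rk i.+1) * 'I_(rk i)) :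
      exists x : T, homog 1 x /\ pi x = M i p.1 p.2.
    by have [x hx xM] := lr_linear linM i_n p.1 p.2; exists x; split; [exact: hx | exact: xM].
  by exists (fun b c => f (b, c)) => b c _; apply: (fP (b, c)).
by exists (fun i => sval (cid (ex i))) => i; apply: (svalP (cid (ex i))).
Qed.

Variable ell : forall i, 'I_(rk i.+1) -> 'I_(rk i) -> T.
Hypothesis ellP : forall i b c, (i < n)%N -> homog 1 (ell b c) /\ pi (ell b c) = M i b c.

(* [chain m i c] is the entry of index [c] of the product of the matrices     *)
(* [ell i], ..., [ell (i + m - 1)] in the tensor algebra, when i + m = n.     *)
Fixpoint chain (m i : nat) : 'I_(rk i) -> T :=
  if m is m'.+1 then fun c => \sum_b ell b c * @chain m' i.+1 b else fun=> 1.

Lemma chain_homog m i c : (m + i <= n)%N -> homog m (@chain m i c).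
Proof.
elim: m i c => [|m IH] i c mi /=; first by rewrite -word_nil; apply: homog_word.
apply: homog_sum => b _; apply: (homogM (m := 1) (m' := m)).
  by have [] := ellP b c (ltac:(lia) : (i < n)%N).
by apply: IH; lia.
Qed.

(** Products in [S^c] are reversed, so with the factors in this order the image in [S] is an entry
    of [M i.+1 *m M i], which is 0. *)
Lemma lift_comp i b c : (i.+1 < n)%N ->
  R (\sum_b' ell b' c * @ell i.+1 b b').
Proof.
move=> i_n; apply: kernel2.
  apply: homog_sum => b' _; apply: (homogM (m := 1) (m' := 1)).
    by have [] := ellP b' c (ltnW i_n).
  by have [] := ellP b b' i_n.
have := congr1 (fun A : 'M[S^c]_(_, _) => A b c) (lr_comp linM i).
rewrite !mxE => M0; rewrite raddf_sum -[RHS]M0; apply: eq_bigr => b' _.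
by rewrite /= rmorphM /= (ellP b' c (ltnW i_n)).2 (ellP b b' i_n).2.
Qed.

(** A swap beyond the first letter is passed to the remaining product. For a swap of the first two
    letters, the first two factors are grouped into elements of [R], which are symmetric. *)
Lemma chain_sym m i c u p q v : (m + i <= n)%N ->
  wcoef (u ++ p :: q :: v) (@chain m i c) = wcoef (u ++ q :: p :: v) (@chain m i c).
Proof.
elim: m i c u => [|m IH] i c u mi.
  have /homogP h1 : homog 0 (1 : T) by rewrite -word_nil; apply: homog_word.
  by rewrite !h1 // size_cat addnS.
have hell b : homog 1 (ell b c) by have [] := ellP b c (ltac:(lia) : (i < n)%N).
case: u => [|l u].
  case: m IH mi => [|m] IH mi.
    by have /homogP h := chain_homog (c := c) mi; rewrite !h.
  have -> : @chain m.+2 i c =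
      \sum_b (\sum_b' ell b' c * @ell i.+1 b b') * @chain m i.+2 b.
    rewrite /=; under [RHS]eq_bigr do rewrite mulr_suml.
    rewrite [RHS]exchange_big; apply: eq_bigr => b' _; rewrite mulr_sumr.
    by apply: eq_bigr => b _; rewrite mulrA.
  rewrite !raddf_sum; apply: eq_bigr => b _ /=.
  have Rb := lift_comp b c (ltac:(lia) : (i.+1 < n)%N).
  have E p' q' y := wcoefM_head y v (R_quad Rb) (erefl : size [:: p'; q'] = 2%N).
  rewrite [LHS](E p q) [RHS](E q p).
  by rewrite (R_sym p q Rb).
rewrite !raddf_sum; apply: eq_bigr => b _ /=.
have E t y := wcoefM_head y t (hell b) (erefl : size [:: l] = 1%N).
rewrite [LHS](E (u ++ p :: q :: v)) [RHS](E (u ++ q :: p :: v)) (IH i.+1 b u) //.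
by rewrite addnS.
Qed.

(** Contraction acts on the first factor alone, which gives one inclusion. Conversely the rows of
    [M i] are independent over [k], so a combination of contractions isolates each entry of the
    shorter product. *)
Lemma partial_chain m i : (m.+1 + i <= n)%N ->
  partial (linear_span (range (@chain m.+1 i))) = linear_span (range (@chain m i.+1)).
Proof.
move=> mi; have i_n : (i < n)%N by lia.
have hell b c : homog 1 (@ell i b c) by have [] := ellP b c i_n.
have Ec psi c : contract psi (@chain m.+1 i c) =
    \sum_b lin_eval psi (@ell i b c) *: @chain m i.+1 b.
  rewrite /=; under eq_bigr do rewrite -[_ * _]scale1r.
  rewrite contract_sum; apply: eq_bigr => b _.
  by rewrite scale1r contractM.
have spanS := linear_span_subspace (range (@chain m i.+1)).
apply/seteqP; split.
  apply: linear_span_min => // _ [psi [x [[s [a [y [yc ->]]]] ->]]].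
  rewrite contract_sum; apply: subspace_sum => // j _.
  have [c _ <-] := yc j; rewrite Ec; apply: subspace_sum => // b _.
  by apply: linear_span_mem; exists b.
apply: linear_span_min; first exact: linear_span_subspace.
move=> _ [b0 _ <-].
pose J : finType := (I * 'I_(rk i))%type.
pose N := \matrix_(p < #|J|, b < rk i.+1) wcoef [:: (enum_val p).1] (ell b (enum_val p).2).
have N_free : row_free N^T.
  apply: inj_row_free => v vN.
  (* A dependency [v] between the columns of [N], read as a row of constants, is killed by [M i], so
     [lr_rows] applies. *)
  pose x : 'rV[S^c]_(rk i.+1) := \row_b ((v 0 b)%:A : S).
  have gx b : gr 0%N (x 0 b).
    rewrite mxE; exists ((v 0 b)%:A : T); last exact: rmorph_alg.
    by apply: homogZ; rewrite -word_nil; apply: homog_word.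
  have xM : x *m M i = 0.
    apply/rowP => c; rewrite !mxE.
    have -> : \sum_b x 0 b * M i b c = pi (\sum_b v 0 b *: ell b c).
      rewrite (linear_comb pi); apply: eq_bigr => b _; rewrite [X in _ *: X](ellP b c i_n).2 mxE.
      suff H (a : k) (y : S) : y * a%:A = a *: y by exact: H.
      by rewrite -scalerAr mulr1.
    suff -> : \sum_b v 0 b *: ell b c = 0 by rewrite raddf0.
    apply: wcoef_ext => w; rewrite raddf0 (linear_comb (wcoef w : {linear T -> k^o})).
    have [|w1] := eqVneq (size w) 1%N; last first.
      by rewrite big1 // => b _; have /homogP h := hell b c; rewrite /= h ?scaler0.
    case: w => [|l []] // _.
    have := congr1 (fun A : 'rV_#|J| => A 0 (enum_rank (l, c))) vN.
    rewrite mxE [RHS]mxE => Ev; rewrite -[RHS]Ev; apply: eq_bigr => b _.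
    by rewrite !mxE enum_rankK.
  have x0 := lr_rows linM i_n gx xM; apply/rowP => b; rewrite mxE.
  have := congr1 (fun A : 'rV[S^c]_(rk i.+1) => A 0 b : S) x0; rewrite !mxE => /eqP.
  by rewrite scaler_eq0 oner_eq0 orbF => /eqP.
have N_full : row_full N by rewrite /row_full -mxrank_tr; exact: N_free.
(* The left inverse [D] of [N] holds the coefficients that isolate an entry. *)
have ND := mulVpmx N_full; set D := pinvmx N in ND.
have -> : @chain m i.+1 b0 = \sum_p D b0 p *: contract (coord_form (enum_val p).1)
    (@chain m.+1 i (enum_val p).2).
  under eq_bigr => p _ do rewrite Ec scaler_sumr.
  rewrite exchange_big /= -[LHS]scale1r.
  transitivity (\sum_b (1%:M : 'M[k]_(rk i.+1)) b0 b *: @chain m i.+1 b).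
    rewrite (bigD1 b0) //= mxE eqxx big1 ?addr0 // => b bb.
    by rewrite mxE eq_sym (negbTE bb) scale0r.
  apply: eq_bigr => b _; rewrite -ND mxE scaler_suml; apply: eq_bigr => p _.
  by rewrite scalerA lin_eval_coord [N _ _]mxE.
apply: subspace_sum; first exact: linear_span_subspace.
move=> p _; apply: linear_span_mem.
exists (coord_form (enum_val p).1), (@chain m.+1 i (enum_val p).2); split=> //.
by apply: linear_span_mem; exists (enum_val p).2.
Qed.

Definition potential : T := @chain n 0 ord0.

Lemma derivation_chain j : (j <= n)%N ->
  derivation_relations potential j = linear_span (range (@chain (n - j) j)).
Proof.
elim: j => [|j IH] j_n.
  rewrite /derivation_relations /= subn0; apply/seteqP; split.
    move=> _ [c ->]; apply: subspaceZ; first exact: linear_span_subspace.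
    by apply: linear_span_mem; exists ord0.
  apply: linear_span_min.
    split=> [|c _ _ [a ->] [b ->]]; first by exists 0; rewrite scale0r.
    by exists (c * a + b); rewrite scalerDl scalerA.
  by move=> _ [b _ <-]; exists 1; rewrite scale1r /potential [b]ord1.
rewrite /derivation_relations iterS -/(derivation_relations _ _) IH ?(ltnW j_n) //.
by rewrite -subSS subSn // partial_chain //; lia.
Qed.

(** By [lr_last] each letter is a combination of the entries of the last matrix, so [x] is a sum of
    products of linear forms [z b] with these entries. As [pi x = 0], the column of the [z b] is a
    cocycle of the dual complex, hence a constant combination of the columns of [M i] by
    [lr_cols]. *)
Lemma chain2_span i : i.+2 = n -> linear_span (range (@chain 2 i)) = R.
Proof.
move=> i_n; have rk1 : rk i.+2 = 1%N by rewrite i_n (lr_top linM).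
have E c : @chain 2 i c = \sum_b ell b c * @ell i.+1 (cast_ord (esym rk1) ord0) b.
  rewrite /=; apply: eq_bigr => b _; congr (_ * _).
  have all b' : b' = cast_ord (esym rk1) ord0 :> 'I_(rk i.+2).
    by apply: val_inj => /=; have := ltn_ord b'; rewrite [X in (_ < X)%N]rk1; case: (val b').
  rewrite (big_pred1 (cast_ord (esym rk1) ord0)) ?mulr1 // => b'.
  by rewrite /= [b']all !eqxx.
set b1 := cast_ord _ _ in E.
have i1n : (i.+1 < n)%N by rewrite -i_n.
have h0 b c : homog 1 (@ell i b c) by have [] := ellP b c (ltnW i1n).
have h1 b c : homog 1 (@ell i.+1 b c) by have [] := ellP b c i1n.
apply/seteqP; split.
  by apply: linear_span_min => // _ [c _ <-]; rewrite E; apply: lift_comp.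
move=> x Rx; have hx := R_quad Rx.
have /choice[y yP] (l : I) : exists y : 'I_(rk i.+1) -> k,
    word k [:: l] = \sum_b y b *: @ell i.+1 b1 b :> T.
  have gl : gr 1%N (pi (word k [:: l])) by exists (word k [:: l]); [exact: (@homog_word k _ [:: l]) | by []].
  have [|y gy yE] := lr_last linM (i := i.+1) (y := const_mx (pi (word k [:: l]))) i_n.
    by move=> b; rewrite mxE.
  have /choice[c cP] b := scalar_grade0 (gy b).
  exists c; apply/eqP; rewrite -subr_eq0; apply/eqP/kernel1.
    apply/homogP => w w1; rewrite raddfB raddf_sum /=.
    have /homogP -> // := @homog_word k _ [:: l].
    rewrite big1 ?subr0 // => b _; have /homogP h := h1 b1 b.
    by rewrite wcoefZ h ?mulr0.
  have := congr1 (fun A : 'cV[S^c]_(rk i.+2) => A b1 0 : S) yE; rewrite !mxE => Ey.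
  rewrite raddfB /= Ey [X in _ - X](linear_comb pi) -sumrB big1 // => b _.
  rewrite [X in _ - _ *: X](ellP b1 b i1n).2 cP.
  suff H (a : k) (z : S) : a%:A * z - a *: z = 0 by exact: H.
  by rewrite -scalerAl mul1r subrr.
pose z b : T := \sum_l \sum_l' (wcoef [:: l; l'] x * y l' b) *: word k [:: l].
have hz b : homog 1 (z b).
  by do 2!apply: homog_sum => ? _; apply: homogZ; apply: (@homog_word k _ [:: _]).
have xz : x = \sum_b z b * @ell i.+1 b1 b.
  rewrite {1}(homog2_expansion hx).
  under [RHS]eq_bigr => b _ do rewrite mulr_suml.
  rewrite [RHS]exchange_big; apply: eq_bigr => l _.
  under [RHS]eq_bigr => b _ do rewrite mulr_suml.
  rewrite [RHS]exchange_big; apply: eq_bigr => l' _.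
  rewrite -[[:: l; l']]/([:: l] ++ [:: l']) -wordM (yP l') mulr_sumr scaler_sumr.
  by apply: eq_bigr => b _; rewrite free_scalerAr scalerA scalerAl.
pose u : 'cV[S^c]_(rk i.+1) := \col_b pi (z b).
have gu b : gr 1%N (u b 0) by rewrite mxE; exists (z b).
have Mu : M i.+1 *m u = 0.
  apply/colP => b; rewrite !mxE.
  have -> : b = b1 by apply: val_inj => /=; have := ltn_ord b; rewrite [X in (_ < X)%N]rk1; case: (val b).
  have : pi x = 0 by apply/pi_R.2; exists 1%N, (fun=> 1), (fun=> 1), (fun=> x); rewrite big_ord1 mul1r mulr1.
  rewrite xz raddf_sum => pix; rewrite -[RHS]pix; apply: eq_bigr => b' _.
  by rewrite /= rmorphM /= (ellP b1 b' i1n).2 mxE.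
have [y' gy' uE] := lr_cols linM i1n gu Mu.
have /choice[c cP] b := scalar_grade0 (gy' b).
have zE b : z b = \sum_a c a *: @ell i b a.
  apply/eqP; rewrite -subr_eq0; apply/eqP/kernel1.
    apply/homogP => w w1; rewrite raddfB [X in _ - X](linear_comb (wcoef w : {linear T -> k^o})).
    have /homogP hzb := hz b; rewrite [X in X - _]hzb //.
    rewrite big1 ?subr0 // => a _; have /homogP h := h0 b a.
    by rewrite /= h ?scaler0.
  have := congr1 (fun A : 'cV[S^c]_(rk i.+1) => A b 0 : S) uE; rewrite !mxE => Ey.
  rewrite raddfB /= Ey [X in _ - X](linear_comb pi) -sumrB big1 // => a _.
  rewrite [X in _ - _ *: X](ellP b a (ltnW i1n)).2 cP.
  suff H (e : k) (t : S) : e%:A * t - e *: t = 0 by exact: H.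
  by rewrite -scalerAl mul1r subrr.
have -> : x = \sum_a c a *: @chain 2 i a.
  rewrite xz; under eq_bigr => b _ do rewrite zE mulr_suml.
  rewrite exchange_big; apply: eq_bigr => a _; rewrite E scaler_sumr.
  by apply: eq_bigr => b _; rewrite scalerAl.
apply: subspace_sum; first exact: linear_span_subspace.
by move=> a _; apply: linear_span_mem; apply: imageP.
Qed.

End LinearChain.

Theorem symmetric_potential (k : fieldType) (V : vectType k) (n : nat)
    (R : set (tensor_algebra V)) (S : algType k) (pi : {lrmorphism tensor_algebra V -> S}) :
  (2 <= n)%N -> subspace R -> R `<=` tensor_power 2 -> presents pi R ->
  quantum_polynomial_algebra (tensor_quotient_grading pi) n ->
  (forall x p q, R x -> wcoef [:: p; q] x = wcoef [:: q; p] x) ->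
  exists w : tensor_algebra V,
    symmetric_tensors n w /\ presents pi (derivation_relations w (n - 2)%N).
Proof.
move=> n2 R_sub R_quad pi_R qpa R_sym.
have [r [M linM]] := linear_resolution_exists qpa.
have [ell ellP] := entry_lift linM.
exists (potential n ell); split.
  apply: symmetric_of_adjacent; first by apply: (chain_homog ellP); rewrite addn0.
  by move=> u p q v; apply: (chain_sym R_sub R_quad pi_R R_sym linM ellP); rewrite addn0.
rewrite (derivation_chain linM ellP) ?leq_subr // subKn //.
by rewrite (chain2_span R_sub R_quad pi_R linM ellP) //; lia.
Qed.

(** * Symmetry of the relations *)

Section SymmetricRelations.
Variables (k : fieldType) (V : vectType k).
Local Notation T := (tensor_algebra V).
Local Notation I := 'I_(\dim {:V}).
Local Notation homog := (free_grading (fun=> 1%N)).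
Variables (S : algType k) (pi : {lrmorphism T -> S}).

(** Symmetry in the last two positions only: contraction removes the first letter, so this property
    survives derivation down to degree 2. *)
Definition tail_symmetric (m : nat) : set T :=
  [set x | homog m x /\ forall u p q, wcoef (u ++ [:: p; q]) x = wcoef (u ++ [:: q; p]) x].

Lemma tail_symmetric_subspace m : subspace (tail_symmetric m).
Proof.
split=> [|c x y [hx sx] [hy sy]].
  by split=> [|u p q]; [exact: (homog_subspace _ _ m).1 | rewrite !raddf0].
split=> [|u p q]; first exact: (homog_subspace _ _ m).2.
by rewrite !linearP /= sx sy.
Qed.

Lemma derivation_tail_symmetric m (w : T) j : symmetric_tensors m w -> (j <= m)%N ->
  derivation_relations w j `<=` tail_symmetric (m - j).
Proof.
move=> sw; elim: j => [|j IH] jm.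
  rewrite subn0 => _ [c ->]; apply: subspaceZ; first exact: tail_symmetric_subspace.
  by split=> [|u p q]; [case: sw | apply: adjacent_of_symmetric sw].
rewrite /derivation_relations iterS; apply: linear_span_min.
  exact: tail_symmetric_subspace.
move=> _ [psi [x [/(IH (ltnW jm))[/homogP hx sx] ->]]]; split.
  apply/homogP => t tm; rewrite wcoef_contract big1 // => i _.
  rewrite hx ?mulr0 //=; move: tm {hx sx}; move: (size t) => l; lia.
move=> u p q; rewrite [LHS]wcoef_contract [RHS]wcoef_contract.
by apply: eq_bigr => i _; rewrite -!cat_cons sx.
Qed.

Lemma relations_symmetric n (w x : T) p q : (2 <= n)%N -> symmetric_tensors n w ->
  presents pi (derivation_relations w (n - 2)) -> homog 2 x -> pi x = 0 ->
  wcoef [:: p; q] x = wcoef [:: q; p] x.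
Proof.
move=> n2 sw [_ kerP] hx /(kerP x) ix.
have sub := derivation_tail_symmetric sw (leq_subr 2 n).
rewrite subKn // in sub.
have sub2 : derivation_relations w (n - 2) `<=` homog 2 by move=> y /sub[].
have [_ sx] := linear_span_min (tail_symmetric_subspace 2) sub (ideal_homog sub2 ix hx).
exact: (sx [::]).
Qed.

End SymmetricRelations.

(** * Symmetry forced by the relations of a graded Clifford algebra *)

Section CliffordRelations.
Variables (k : fieldType) (n : nat).
Local Notation CF := (cliff_free k n).
Local Notation J := ('I_n + 'I_n)%type.

Lemma gen_word (I : choiceType) (i : I) : gen k i = word k [:: i].
Proof. by rewrite /gen /word fmuE. Qed.

(** The Clifford relations mix words of lengths 1 and 2, so homogeneity in length cannot be used;
    vanishing on the shorter words that matter replaces it. *)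
Lemma wcoefM_pair (I : choiceType) (a b y : free_algebra k I) (p q : I) :
  wcoef [::] y = 0 -> wcoef [:: p] y = 0 -> wcoef [:: q] y = 0 ->
  wcoef [:: p; q] (a * y * b) = wcoef [::] a * wcoef [::] b * wcoef [:: p; q] y.
Proof.
move=> y0 yp yq; rewrite wcoefM /= !big_ord_recl big_ord0 /=.
rewrite !wcoefM /= !big_ord_recl !big_ord0 /= y0 yp yq.
by rewrite !mulr0 !addr0 !mul0r !add0r mulrAC.
Qed.

Lemma cliff_xx (i j : 'I_n) : cliff_x k i * cliff_x k j = word k [:: inl i; inl j].
Proof. by rewrite /cliff_x !gen_word wordM. Qed.

Lemma cliff_xy (i j : 'I_n) : cliff_x k i * cliff_y k j = word k [:: inl i; inr j].
Proof. by rewrite /cliff_x /cliff_y !gen_word wordM. Qed.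

Lemma cliff_yx (i j : 'I_n) : cliff_y k i * cliff_x k j = word k [:: inr i; inl j].
Proof. by rewrite /cliff_x /cliff_y !gen_word wordM. Qed.

Lemma cliff_yy (i j : 'I_n) : cliff_y k i * cliff_y k j = word k [:: inr i; inr j].
Proof. by rewrite /cliff_y !gen_word wordM. Qed.

Lemma wcoef_anticommutator (F : n.-tuple 'M[k]_n) (i j : 'I_n) (w : seq J) :
  wcoef w (cliff_x k i * cliff_x k j + cliff_x k j * cliff_x k i
           - \sum_(m < n) (tnth F m) i j *: cliff_y k m : CF) =
  ([:: inl i; inl j] == w)%:R + ([:: inl j; inl i] == w)%:R
    - \sum_(m < n) (tnth F m) i j * ([:: inr m] == w)%:R.
Proof.
apply: etrans (raddfB (wcoef w : {linear CF -> k^o}) _ _) _; congr (_ - _).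
  apply: etrans (raddfD (wcoef w : {linear CF -> k^o}) _ _) _.
  by rewrite cliff_xx cliff_xx; congr (_ + _); apply: wcoef_word.
rewrite -(wcoef_sum_word _ _ (fun m => tnth F m i j) (fun m => [:: inr m : J])).
apply: (congr1 (wcoef w)); apply: eq_bigr => m _.
exact: (congr1 (fun z => _ *: z) (gen_word (inr m : J))).
Qed.

Lemma wcoef_commutator (s t w : seq J) :
  wcoef w (word k s - word k t : CF) = (s == w)%:R - (t == w)%:R.
Proof.
apply: etrans (raddfB (wcoef w : {linear CF -> k^o}) _ _) _.
by congr (_ - _); apply: wcoef_word.
Qed.

Lemma clifford_relation_coef (F : n.-tuple 'M[k]_n) (y : CF) (a b : 'I_n) :
  clifford_relations F y ->
  [/\ wcoef [::] y = 0, wcoef [:: inl a] y = 0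
    & wcoef [:: inl a; inl b] y = wcoef [:: inl b; inl a] y].
Proof.
move=> [i [j]] [] ->.
- rewrite !wcoef_anticommutator /= !big1 => [|m _]; last by rewrite mulr0.
  rewrite !subr0; split; rewrite ?addr0 // !eqseq_cons /= ?andbF ?addr0 //.
  by rewrite !andbT addrC; congr (_%:R + _%:R); rewrite andbC.
- by rewrite cliff_xy cliff_yx !wcoef_commutator !eqseq_cons /= !andbF !subrr.
- by rewrite cliff_yy cliff_yy !wcoef_commutator /= !subrr.
Qed.

Lemma clifford_ideal_coef (F : n.-tuple 'M[k]_n) (z : CF) (a b : 'I_n) :
  two_sided_ideal (clifford_relations F) z ->
  wcoef [:: inl a; inl b] z = wcoef [:: inl b; inl a] z.
Proof.
move=> [r [c [d [y [Fy ->]]]]].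
apply: etrans (raddf_sum _ _ _ _) _; apply: etrans _ (esym (raddf_sum _ _ _ _)).
apply: eq_bigr => i _.
have [y0 ya yab] := clifford_relation_coef a b (Fy i).
have [_ yb _] := clifford_relation_coef b a (Fy i).
rewrite [LHS](wcoefM_pair _ _ y0 ya yb) [RHS](wcoefM_pair _ _ y0 yb ya).
by rewrite yab.
Qed.

End CliffordRelations.

Section CliffordSymmetric.
Variables (k : fieldType) (V : vectType k) (n : nat).
Local Notation T := (tensor_algebra V).
Local Notation I := 'I_(\dim {:V}).
Local Notation CF := (cliff_free k n).
Local Notation homog := (free_grading (fun=> 1%N)).

Lemma cliff_degree1_coef (z : CF) w : free_grading (@cliff_deg n) 1 z ->
  wcoef w z != 0 -> exists a, w = [:: inl a].
Proof.
move=> /free_gradingP gz /gz; case: w => [|[a|a] [|x w]]; rewrite ?big_nil //.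
- by exists a.
- by rewrite 2!big_cons; case: x => x /=; move: (bigop _ _ _) => s; lia.
- by rewrite big_seq1 /=.
- by rewrite 2!big_cons /=; move: (bigop _ _ _) => s; lia.
Qed.

(** The images of the letters lift to combinations [z l] of the [x_a], with coefficient matrix [P].
    Substituted into a relation with matrix [X], they give an element of the Clifford ideal, so
    [P^T X P] is symmetric. As [pi] is injective on linear forms, [P] has a right inverse and [X] is
    symmetric. *)
Lemma clifford_relations_symmetric (R : set T) (S : algType k) (pi : {lrmorphism T -> S})
    (F : n.-tuple 'M[k]_n) (C : algType k) (rho : {lrmorphism CF -> C}) :
  R `<=` tensor_power 2 -> presents pi R ->
  presents rho (clifford_relations F) ->
  graded_algebra_iso (tensor_quotient_grading pi) (quotient_grading rho (@cliff_deg n)) ->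
  forall x p q, R x -> wcoef [:: p; q] x = wcoef [:: q; p] x.
Proof.
move=> R_quad pi_R rhoP [f [f_bij f_gr]].
have /choice[z zP] (l : I) : exists z : CF,
    free_grading (@cliff_deg n) 1 z /\ rho z = f (pi (word k [:: l])).
  have /f_gr[z gz zE] : tensor_quotient_grading pi 1%N (pi (word k [:: l])).
    by exists (word k [:: l]); [exact: (@homog_word k _ [:: l]) | by []].
  by exists z.
pose P : 'M[k]_(\dim {:V}, n) := \matrix_(l, a) wcoef [:: inl a] (z l).
have P_free : row_free P.
  apply: inj_row_free => v vP.
  have z0 : \sum_l v 0 l *: z l = 0.
    apply: wcoef_ext => w; rewrite raddf0 (linear_comb (wcoef w : {linear CF -> k^o})) /=.
    have [[a ->]|nw] := pselect (exists a, w = [:: inl a]).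
      have := congr1 (fun A : 'rV_n => A 0 a) vP; rewrite mxE [RHS]mxE => Ev.
      by rewrite -[RHS]Ev; apply: eq_bigr => l _; rewrite mxE.
    rewrite big1 // => l _; have [gz _] := zP l.
    have [->|/(cliff_degree1_coef gz)//] := eqVneq (wcoef w (z l)) 0.
    by rewrite scaler0.
  have pi0 : pi (\sum_l v 0 l *: word k [:: l]) = 0.
    apply: (bij_inj f_bij); rewrite raddf0.
    transitivity (\sum_l v 0 l *: rho (z l)); last first.
      by rewrite -[LHS](linear_comb rho) -(raddf0 rho); congr (rho _).
    rewrite [X in f X](linear_comb pi) [LHS](linear_comb f); apply: eq_bigr => l _.
    by have [_ ->] := zP l.
  have w0 : \sum_l v 0 l *: word k [:: l] = 0.
    apply: (kernel1 R_quad pi_R _ pi0).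
    by apply: homog_sum => l _; apply: homogZ; apply: (@homog_word k _ [:: l]).
  apply/rowP => l; rewrite [RHS]mxE.
  have := congr1 (wcoef [:: l]) w0; rewrite wcoef_sum_word raddf0 => <-.
  rewrite (bigD1 l) //= eqxx mulr1 big1 ?addr0 // => j jl.
  by rewrite eqseq_cons (negbTE jl) mulr0.
move=> x p q Rx; have hx := R_quad _ Rx.
pose Z : CF := \sum_i \sum_j wcoef [:: i; j] x *: (z i * z j).
have rhoZ : rho Z = 0.
  have pix : pi x = 0.
    by apply/pi_R.2; exists 1%N, (fun=> 1), (fun=> 1), (fun=> x); rewrite big_ord1 mul1r mulr1.
  rewrite -(raddf0 f) -pix [in RHS](homog2_expansion hx) !raddf_sum /=.
  apply: eq_bigr => i _; rewrite (linear_comb rho) (linear_comb pi) (linear_comb f).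
  apply: eq_bigr => j _ /=; rewrite -[[:: i; j]]/([:: i] ++ [:: j]) -wordM !rmorphM /=.
  by have [_ ->] := zP i; have [_ ->] := zP j.
have Zcoef a b : wcoef [:: inl a; inl b] Z =
    (P^T *m (\matrix_(i, j) wcoef [:: i; j] x) *m P) a b.
  rewrite mxE; under [RHS]eq_bigr => j _ do rewrite mxE mulr_suml.
  rewrite [RHS]exchange_big raddf_sum; apply: eq_bigr => i _ /=.
  rewrite (linear_comb (wcoef _ : {linear CF -> k^o})); apply: eq_bigr => j _ /=.
  rewrite !mxE wcoefM /= !big_ord_recl big_ord0 /=.
  have z0 l : wcoef [::] (z l) = 0.
    by have [gz _] := zP l; apply/eqP/negPn/negP => /(cliff_degree1_coef gz)[].
  rewrite !z0 !mul0r mulr0 !addr0 add0r -[LHS]/(_ * (_ * _)).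
  by rewrite mulrA [X in X * _]mulrC.
have sym : P^T *m (\matrix_(i, j) wcoef [:: i; j] x) *m P =
    (P^T *m (\matrix_(i, j) wcoef [:: i; j] x) *m P)^T.
  apply/matrixP => a b; rewrite [RHS]mxE -!Zcoef.
  by apply: (clifford_ideal_coef (F := F)); apply/rhoP.2.
have [Q PQ] : exists Q, P *m Q = 1%:M by exists (pinvmx P); apply: mulmxVp.
set X := \matrix_(i, j) _ in sym.
have XE : X = X^T.
  have E : Q^T *m (P^T *m X *m P) *m Q = X.
    by rewrite !mulmxA -(trmx_mul P Q) PQ trmx1 mul1mx -mulmxA PQ mulmx1.
  move: sym E; move: (P^T *m X *m P) => A sym E.
  by rewrite -E (trmx_mul (Q^T *m A) Q) (trmx_mul Q^T A) trmxK -sym mulmxA.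
by have := congr1 (fun A : 'M[k]_(\dim {:V}) => A p q) XE; rewrite !mxE.
Qed.

End CliffordSymmetric.

(** * Dimension counts and the Clifford presentation *)

Section Coordinates.
Variables (k : fieldType) (I : finType) (m : nat).
Local Notation FA := (free_algebra k I).
Local Notation N := #|{: m.-tuple I}|.
Local Notation homog := (free_grading (fun=> 1%N)).

Definition of_row (t : 'rV[k]_N) : FA := \sum_p t 0 p *: word k (enum_val p : m.-tuple I).

Lemma wcoef_of_row t (u : m.-tuple I) : wcoef u (of_row t) = t 0 (enum_rank u).
Proof.
rewrite /of_row (linear_comb (wcoef u : {linear FA -> k^o})).
rewrite (bigD1 (enum_rank u)) //= enum_rankK wcoef_word eqxx big1 => [|p pu].
  by rewrite addr0 -[LHS]/(_ * _) mulr1.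
rewrite wcoef_word (_ : (_ == _) = false) ?scaler0 //.
by apply: contraNF pu => /eqP/val_inj <-; rewrite enum_valK.
Qed.

Lemma of_row_homog t : homog m (of_row t).
Proof.
apply: homog_sum => p _; apply: homogZ.
have /homogP h := @homog_word k I (enum_val p : m.-tuple I); apply/homogP => w wm.
by apply: h; rewrite size_tuple.
Qed.

Lemma of_row_surj (x : FA) : homog m x -> exists t, x = of_row t.
Proof.
move=> hx; exists (\row_(p < N) wcoef (enum_val p : m.-tuple I) x); rewrite {1}(homog_expansion hx) /of_row.
rewrite (reindex (enum_val (A := {: m.-tuple I}))) /=; last first.
  by exists enum_rank => p _; [apply: enum_valK | apply: enum_rankK].
by apply: eq_bigr => p _; rewrite mxE.
Qed.

Definition functional_mx (J : finType) (psi : J -> {linear FA -> k^o}) : 'M[k]_(N, #|J|) :=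
  \matrix_(p, q) psi (enum_val q) (word k (enum_val p : m.-tuple I)).

Lemma functional_mxE (J : finType) (psi : J -> {linear FA -> k^o}) t q :
  (t *m functional_mx psi) 0 q = psi (enum_val q) (of_row t).
Proof.
rewrite mxE /of_row (linear_comb (psi _)); apply: eq_bigr => p _.
by rewrite [functional_mx _ _ _]mxE.
Qed.

Lemma functional_mx_full (J : finType) (psi : J -> {linear FA -> k^o}) (b : J -> FA) :
  (forall j, homog m (b j)) -> (forall i j, psi i (b j) = (i == j)%:R) ->
  row_full (functional_mx psi).
Proof.
move=> hb bP; apply/row_fullP.
have /choice[t tP] (q : 'I_#|J|) := of_row_surj (hb (enum_val q)).
exists (\matrix_q t q); apply/row_matrixP => q; rewrite row_mul rowK row1.
apply/rowP => q'; rewrite functional_mxE -tP bP !mxE eqxx /=.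
by rewrite (inj_eq enum_val_inj).
Qed.

(** [A] is the matrix of the surjection [pi] in degree [m], from words to a basis [e]; its rank is
    the value of the Hilbert function. *)
Lemma graded_coordinates (S : algType k) (pi : {lrmorphism FA -> S}) (h : nat) :
  has_dim (quotient_grading pi (fun=> 1%N) m) h ->
  exists (A : 'M[k]_(N, h)) (e : 'I_h -> S), [/\ row_full A,
    forall t, pi (of_row t) = \sum_j (t *m A) 0 j *: e j
    & forall c : 'I_h -> k, \sum_j c j *: e j = 0 -> forall j, c j = 0].
Proof.
move=> [e [grE e_free]].
have gr_word (x : FA) : homog m x -> exists c : 'I_h -> k, pi x = \sum_j c j *: e j.
  move=> hx; have : quotient_grading pi (fun=> 1%N) m (pi x) by exists x.
  by rewrite grE.
have /choice[c cP] (p : 'I_N) : exists c : 'I_h -> k,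
    pi (word k (enum_val p : m.-tuple I)) = \sum_j c j *: e j.
  apply: gr_word; have /homogP hw := @homog_word k I (enum_val p : m.-tuple I); apply/homogP => w wm.
  by apply: hw; rewrite size_tuple.
pose A := \matrix_(p, j) c p j.
have piE t : pi (of_row t) = \sum_j (t *m A) 0 j *: e j.
  rewrite /of_row [LHS](linear_comb pi).
  transitivity (\sum_p \sum_j (t 0 p * A p j) *: e j).
    apply: eq_bigr => p _; rewrite [X in _ *: X](cP p) scaler_sumr; apply: eq_bigr => j _.
    by rewrite scalerA mxE.
  by rewrite exchange_big; apply: eq_bigr => j _; rewrite mxE scaler_suml.
exists A, e; split=> //; apply/row_fullP.
have /choice[t tP] (j : 'I_h) : exists t, e j = pi (of_row t).
  have : quotient_grading pi (fun=> 1%N) m (e j).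
    rewrite grE; exists (fun i => (i == j)%:R); rewrite (bigD1 j) //= eqxx scale1r.
    by rewrite big1 ?addr0 // => i /negbTE ->; rewrite scale0r.
  by move=> [x /of_row_surj[t ->] <-]; exists t.
exists (\matrix_j t j); apply/row_matrixP => j; rewrite row_mul rowK row1.
apply/rowP => i; apply/eqP; rewrite -subr_eq0; apply/eqP; move: i.
apply: e_free; under eq_bigr do rewrite scalerBl.
rewrite sumrB -piE -tP (bigD1 j) //= mxE !eqxx scale1r big1 ?addr0 ?subrr //.
by move=> i ij; rewrite mxE (negbTE ij) scale0r.
Qed.

Lemma kernel_coordinates (S : algType k) (pi : {lrmorphism FA -> S}) h
    (A : 'M[k]_(N, h)) (e : 'I_h -> S) t :
  (forall t, pi (of_row t) = \sum_j (t *m A) 0 j *: e j) ->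
  (forall c : 'I_h -> k, \sum_j c j *: e j = 0 -> forall j, c j = 0) ->
  pi (of_row t) = 0 <-> t *m A = 0.
Proof.
move=> piE e_free; rewrite piE; split=> [/e_free tA|->].
  by apply/rowP => j; rewrite [RHS]mxE; apply: tA.
by rewrite big1 // => j _; rewrite mxE scale0r.
Qed.

End Coordinates.

Section FreeAlgebraMorphism.
Variables (k : fieldType) (J : choiceType) (S : lalgType k) (g : J -> S).
Local Notation FA := (free_algebra k J).

Definition eval_word (u : {fmonom J}) : S := \prod_(i <- fmonom_val u) g i.

Lemma eval_word_mmorphism : mmorphism eval_word.
Proof.
split=> [u v|]; last by rewrite /eval_word fm1 big_nil.
by rewrite /eval_word fmM big_cat.
Qed.

HB.instance Definition _ := isMultiplicative.Build {fmonom J} S eval_word eval_word_mmorphism.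

Definition free_eval (x : FA) : S := mmap (in_alg S) eval_word x.

Lemma free_eval_is_linear : linear free_eval.
Proof.
move=> c x y; rewrite /free_eval raddfD /= mmapZ; congr (_ + _).
by rewrite /= -scalerAl mul1r.
Qed.

HB.instance Definition _ :=
  GRing.isLinear.Build k FA S _ free_eval free_eval_is_linear.

Lemma free_eval_word s : free_eval (word k s) = \prod_(i <- s) g i.
Proof. by rewrite /free_eval /word mmapU /= scale1r mul1r. Qed.

(* The free algebra is only a left algebra in the library, hence the explicit *)
(* hypothesis that scalars are central.                                       *)
Lemma free_eval_is_monoid_morphism :
  (forall (c : k) (x y : S), x * (c *: y) = c *: (x * y)) -> monoid_morphism free_eval.
Proof.
move=> scal.
have [mulE oneE] : multiplicative (mmap (in_alg S) eval_word : {malg k[{fmonom J}]} -> S).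
  apply: commr_mmap_is_multiplicative => x u v.
  by rewrite /GRing.comm /= -scalerAl mul1r scal mulr1.
by split; [exact: oneE | exact: mulE].
Qed.

End FreeAlgebraMorphism.

HB.instance Definition _ (k : fieldType) (J : choiceType) (S : algType k) (g : J -> S) :=
  GRing.isMonoidMorphism.Build (free_algebra k J) S (free_eval g)
    (free_eval_is_monoid_morphism g (fun c x y => esym (scalerAr c x y))).

Lemma coef_1subX_exp n j : ((1 - 'X) ^+ n : {poly int})`_j = (-1) ^+ j * 'C(n, j)%:Z.
Proof.
elim: n j => [|n IH] j; first by rewrite expr0 coef1 bin0n; case: j => [|j] /=; rewrite ?mulr1 ?mulr0.
rewrite exprS mulrBl mul1r coefB coefXM !IH.
case: j => [|j] /=; first by rewrite !bin0 subr0.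
by rewrite binS PoszD exprS; ring.
Qed.

(** The degree-3 value is written as the number of functionals used in [tau_central]. *)
Lemma hilbert_values (k : fieldType) (S : algType k) (gr : nat -> set S) n :
  hilbert_series_eq_inv_pow gr n -> exists h : nat -> nat,
  [/\ hilbert_function gr h, h 1%N = n, (h 2%N + 'C(n, 2) = n * n)%N
    & h 3%N = (n * n + 'C(n, 3))%N].
Proof.
move=> [h [hgr hs]]; exists h.
have b2 : ('C(n, 2) * 2 = n * n.-1)%N.
  by have := bin_ffact n 2; rewrite ffactnS ffactn1.
have [s0 s1 s2 s3] : [/\ h 0%N = 1%N, h 1%N = n, (h 2%N + 'C(n, 2) = n * n)%N
    & (h 3%N + n * n * n.-1 = n * n * n + 'C(n, 3))%N].
  have := hs 0%N; have := hs 1%N; have := hs 2%N; have := hs 3%N.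
  rewrite !big_ord_recr !big_ord0 /= !coef_1subX_exp !bin0 !bin1 !add0r !expr0 !expr1.
  rewrite !subnn !subn0 /=.
  rewrite -[(3 - 1)%N]/2%N -[(3 - 2)%N]/1%N -[(2 - 1)%N]/1%N.
  have -> : (-1) ^+ 2 = 1 :> int by [].
  have -> : (-1) ^+ 3 = -1 :> int by [].
  move=> e3 e2 e1 e0; have h0 : h 0%N = 1%N by lia.
  rewrite h0 in e1 e2 e3; have h1 : h 1%N = n by lia.
  rewrite h1 in e2 e3; have h2 : (h 2%N + 'C(n, 2) = n * n)%N by lia.
  split=> //; case: (posnP n) => [n0|n0]; first by move: e3; rewrite n0 bin0n; lia.
  have E : (n * (n * n.-1) + n * n = n * n * n)%N by case: {+}n n0 => // m _ /=; ring.
  have E2 : (n * 'C(n, 2) * 2 = n * (n * n.-1))%N by rewrite -b2; ring.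
  have E3 : (h 3%N + 2 * (n * 'C(n, 2)) = n * (n * n) + 'C(n, 3))%N.
    have : (n * h 2%N + n * 'C(n, 2) = n * (n * n))%N by rewrite -h2; ring.
    by lia.
  by lia.
split=> //.
have : (n * n * n.-1 + n * n = n * n * n)%N by case: {+}n => // m /=; ring.
by lia.
Qed.

(** * Dimension counts in degrees 2 and 3 *)

Section SymmetricToClifford.
Variables (k : fieldType) (V : vectType k).
Local Notation T := (tensor_algebra V).
Local Notation n := (\dim {:V}).
Local Notation I := 'I_n.
Local Notation homog := (free_grading (fun=> 1%N)).
Variables (R : set T) (S : algType k) (pi : {lrmorphism T -> S}).
Hypotheses (R_sub : subspace R) (R_quad : R `<=` tensor_power 2).
Hypothesis pi_R : presents pi R.
Hypothesis R_sym : forall x p q, R x -> wcoef [:: p; q] x = wcoef [:: q; p] x.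
Local Notation gr := (tensor_quotient_grading pi).

Definition symmetric2 (x : T) : Prop :=
  homog 2 x /\ forall p q, wcoef [:: p; q] x = wcoef [:: q; p] x.

Lemma kernel2_symmetric x : homog 2 x -> pi x = 0 -> symmetric2 x.
Proof.
move=> hx px; have Rx := kernel2 R_sub R_quad pi_R hx px.
by split=> // p q; apply: R_sym.
Qed.

(* The strictly increasing words index a basis of the exterior power.         *)
Definition increasing (m : nat) : finType :=
  {u : m.-tuple I | sorted ltn [seq val i | i <- u]}.

Lemma card_increasing m : #|increasing m| = 'C(n, m).
Proof. by rewrite card_sig -card_ltn_sorted_tuples cardsE. Qed.

Definition alt2 (u : seq I) (x : T) : k^o :=
  if u is [:: i; j] then wcoef [:: i; j] x - wcoef [:: j; i] x else 0.

Lemma alt2_is_linear u : linear (alt2 u).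
Proof.
move=> c x y; rewrite /alt2; case: u => [|i [|j []]]; rewrite ?scaler0 ?addr0 //.
by rewrite !linearP /= scalerBr addrACA opprD.
Qed.

HB.instance Definition _ u := GRing.isLinear.Build k T k^o _ (alt2 u) (alt2_is_linear u).

(** The signed sum over the six orderings, a coordinate of the projection to the third exterior
    power. *)
Definition alt3 (u : seq I) (x : T) : k^o :=
  if u is [:: i; j; l] then
    (wcoef [:: i; j; l] x - wcoef [:: j; i; l] x) +
    (wcoef [:: j; l; i] x - wcoef [:: l; j; i] x) +
    (wcoef [:: l; i; j] x - wcoef [:: i; l; j] x)
  else 0.

Lemma alt3_is_linear u : linear (alt3 u).
Proof.
move=> c x y; rewrite /alt3; case: u => [|i [|j [|l []]]]; rewrite ?scaler0 ?addr0 //.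
rewrite !linearP /=.
by rewrite -[_ *: _]/(_ * _); ring.
Qed.

HB.instance Definition _ u := GRing.isLinear.Build k T k^o _ (alt3 u) (alt3_is_linear u).

Lemma alt2_increasing (u v : increasing 2) : alt2 (val u) (word k (val v)) = (u == v)%:R.
Proof.
case: u v => [u su] [v sv]; rewrite -(inj_eq val_inj) /= -(inj_eq val_inj) /=.
case: u su => [[|i [|j []]] su'] //= /andP[ij _].
case: v sv => [[|i' [|j' []]] sv'] //= /andP[ij' _].
rewrite !wcoef_word !eqseq_cons !andbT.
case: (altP (i' =P j)) => [ji|_]; last by rewrite /= subr0 eq_sym [j' == j]eq_sym.
case: (altP (j' =P i)) => [ji'|_] /=; last by rewrite subr0 eq_sym [j' == j]eq_sym.
by move: ij ij'; rewrite ji ji' => /ltnW; rewrite leqNgt => /negbTE ->.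
Qed.

Lemma alt3_increasing (u v : increasing 3) : alt3 (val u) (word k (val v)) = (u == v)%:R.
Proof.
case: u v => [u su] [v sv]; rewrite -(inj_eq val_inj) /= -(inj_eq val_inj) /=.
case: u su => [[|i [|j [|l []]]] su'] //= /and3P[ij jl _].
case: v sv => [[|i' [|j' [|l' []]]] sv'] //= /and3P[ij' jl' _].
rewrite !wcoef_word !eqseq_cons !andbT -!val_eqE /=.
move: ij jl ij' jl'; move: (val i) (val j) (val l) (val i') (val j') (val l') => a b c a' b' c' ab bc ab' bc'.
have -> : [&& a' == b, b' == a & c' == c] = false by lia.
have -> : [&& a' == b, b' == c & c' == a] = false by lia.
have -> : [&& a' == c, b' == b & c' == a] = false by lia.
have -> : [&& a' == c, b' == a & c' == b] = false by lia.
have -> : [&& a' == a, b' == c & c' == b] = false by lia.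
by rewrite !subr0 !addr0 [a' == a]eq_sym [b' == b]eq_sym [c' == c]eq_sym.
Qed.

Lemma symmetric2_of_row (t : 'rV[k]_#|{: 2.-tuple I}|) :
  symmetric2 (of_row t) <->
  t *m functional_mx 2 (fun u : increasing 2 => alt2 (val u) : {linear T -> k^o}) = 0.
Proof.
split=> [[_ sx]|tb].
  apply/rowP => q; rewrite functional_mxE [RHS]mxE /=.
  by rewrite /alt2; case: (tval _) => [|i [|j []]] //; rewrite sx subrr.
split=> [|p q]; first exact: of_row_homog.
wlog pq : p q / (p < q)%N => [H|].
  by case: (ltngtP p q) => [/H //|/H //|/val_inj ->].
have su : sorted ltn [seq val i | i <- [tuple p; q]] by rewrite /= pq.
pose u : increasing 2 := exist (fun u : 2.-tuple I => sorted ltn [seq val i | i <- u]) [tuple p; q] su.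
have := congr1 (fun A : 'rV[k]_#|increasing 2| => A 0 (enum_rank u)) tb.
by rewrite functional_mxE enum_rankK [RHS]mxE /= => /eqP; rewrite subr_eq0 => /eqP.
Qed.

(** The kernel of [pi] in degree 2 has dimension C(n,2) and lies in Sym^2, so the image of Sym^2 has
    dimension n^2 - 2 C(n,2) = n. The [tau m] lift a basis of this image. *)
Lemma symmetric_image_basis h : has_dim (gr 2) h -> (h + 'C(n, 2) = n * n)%N ->
  exists tau : I -> T, [/\ forall m, symmetric2 (tau m),
    forall c : I -> k, \sum_m c m *: pi (tau m) = 0 -> forall m, c m = 0
    & forall x, symmetric2 x -> exists c : I -> k, pi x = \sum_m c m *: pi (tau m)].
Proof.
move=> hdim hn; have [A [e [A_full piE e_free]]] := graded_coordinates hdim.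
set N := #|{: 2.-tuple I}| in A A_full piE.
have NE : N = (n * n)%N by rewrite /N card_tuple card_ord.
set beta := functional_mx 2 (fun u : increasing 2 => alt2 (val u) : {linear T -> k^o}).
have beta_rank : \rank beta = 'C(n, 2).
  rewrite -card_increasing; apply/eqP.
  apply: (functional_mx_full (b := fun u : increasing 2 => word k (val u))) => [u|u v].
    have /homogP hw := @homog_word k _ (tval (val u)); apply/homogP => w wm.
    by apply: hw; rewrite size_tuple.
  exact: alt2_increasing.
have A_rank : \rank A = h by apply/eqP.
have kerAb : (kermx A <= kermx beta)%MS.
  apply/sub_kermxP/row_matrixP => i; rewrite row_mul row0.
  apply/symmetric2_of_row/kernel2_symmetric; first exact: of_row_homog.
  by apply/(kernel_coordinates _ piE e_free); rewrite -row_mul mulmx_ker row0.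
pose X := kermx beta *m A.
have X_rank : \rank X = n.
  have := mxrank_mul_ker (kermx beta) A; rewrite (capmx_idPr kerAb) !mxrank_ker -/X.
  rewrite beta_rank A_rank; move: (\rank X) => x; rewrite -/N NE.
  have : ('C(n, 2) * 2 = n * n.-1)%N by have := bin_ffact n 2; rewrite ffactnS ffactn1.
  have : (n * n.-1 + n = n * n)%N by case: {+}n => // m /=; ring.
  by move: hn; move: (\dim {:V}) => d; lia.
have [Y YX Y_free] : exists2 Y : 'M[k]_(n, h), (Y :=: X)%MS & row_free Y.
  move: (row_base X) (eq_row_base X) (row_base_free X).
  by rewrite X_rank => Y YX Y_free; exists Y.
have /choice[t tP] (m : I) : exists t : 'rV[k]_N, t *m beta = 0 /\ t *m A = row m Y.
  have /submxP[D DE] : (row m Y <= X)%MS by rewrite -YX row_sub.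
  exists (D *m kermx beta); split; first by rewrite -mulmxA mulmx_ker mulmx0.
  by rewrite DE -mulmxA.
have comb (c : I -> k) :
    \sum_m c m *: pi (of_row (t m)) = \sum_j ((\row_m c m) *m Y) 0 j *: e j.
  transitivity (\sum_m \sum_j (c m * Y m j) *: e j).
    apply: eq_bigr => m _; rewrite piE (tP m).2 scaler_sumr; apply: eq_bigr => j _.
    by rewrite mxE scalerA.
  rewrite exchange_big; apply: eq_bigr => j _; rewrite mxE scaler_suml.
  by apply: eq_bigr => m _; rewrite mxE.
exists (fun m => of_row (t m)); split.
- by move=> m; apply/symmetric2_of_row; case: (tP m).
- move=> c; rewrite comb => /e_free cY m.
  have : (\row_m c m) *m Y = 0 by apply/rowP => j; rewrite [RHS]mxE; apply: cY.
  rewrite -[X in _ = X](mul0mx _ Y) => /(row_free_inj Y_free)/rowP/(_ m).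
  by rewrite !mxE.
- move=> x [hx sx]; have [s xE] := of_row_surj hx; rewrite xE in sx hx *.
  have sb : s *m beta = 0 by apply/symmetric2_of_row.
  have /submxP[D DE] : (s *m A <= Y)%MS by rewrite YX submxMr //; apply/sub_kermxP.
  exists (fun m => D 0 m); rewrite comb piE DE; apply: eq_bigr => j _.
  by congr (_ *: _); congr ((_ *m Y) 0 j); apply/rowP => m; rewrite mxE.
Qed.

Lemma wcoef3_mid (a y b : T) p q s : homog 2 y ->
  wcoef [:: p; q; s] (a * y * b) =
  wcoef [::] a * wcoef [:: p; q] y * wcoef [:: s] b
  + wcoef [:: p] a * wcoef [:: q; s] y * wcoef [::] b.
Proof.
move=> /homogP hy; rewrite wcoefM /= !big_ord_recl big_ord0 /=.
rewrite !wcoefM /= !big_ord_recl !big_ord0 /=.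
rewrite (hy [::]) // (hy [:: p]) // (hy [:: q]) // (hy [:: s]) // (hy [:: p; q; s]) //.
by rewrite !mulr0 !addr0 !mul0r !add0r.
Qed.

Lemma alt3_mid (a y b : T) u : symmetric2 y -> alt3 u (a * y * b) = 0.
Proof.
move=> [hy sy]; rewrite /alt3; case: u => [|i [|j [|l []]]] //.
rewrite !wcoef3_mid // (sy j i) (sy l i) (sy l j).
by ring.
Qed.

(* Up to the factor 1/2 this is the component along y_m (x) x_v, G being the  *)
(* matrix of y_m, of x_a x_b x_c |-> ([ab] c + [bc] a - [ac] b) / 2, where    *)
(* [ab] stands for x_a x_b + x_b x_a: the only combination that sends both    *)
(* [ab] c and c [ab] to [ab] (x) c.                                           *)
Definition phi (G : 'M[k]_n) (v : I) (x : T) : k^o :=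
  \sum_i \sum_j G i j *
    (wcoef [:: i; j; v] x + wcoef [:: v; i; j] x - wcoef [:: i; v; j] x).

Lemma phi_is_linear G v : linear (phi G v).
Proof.
move=> c x y; rewrite /phi scaler_sumr -big_split; apply: eq_bigr => i _ /=.
rewrite scaler_sumr -big_split; apply: eq_bigr => j _ /=.
rewrite !linearP /= -[_ *: _]/(_ * _).
by ring.
Qed.

HB.instance Definition _ G v := GRing.isLinear.Build k T k^o _ (phi G v) (phi_is_linear G v).

(** For symmetric [y] and [G = G m] this is twice the coordinate of [pi y] along [pi (tau m)], as
    [pi_symmetric2] shows. *)
Definition contraction2 (G : 'M[k]_n) (y : T) : k := \sum_i \sum_j G i j * wcoef [:: i; j] y.

(** The value is unchanged when [a] and [b] are exchanged, so [phi] vanishes on commutators of a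
    letter with a symmetric tensor. *)
Lemma phi_mid G v (a y b : T) : symmetric2 y -> phi G v (a * y * b) =
  (wcoef [::] a * wcoef [:: v] b + wcoef [:: v] a * wcoef [::] b) * contraction2 G y.
Proof.
move=> [hy sy]; rewrite /phi /contraction2 mulr_sumr; apply: eq_bigr => i _.
rewrite mulr_sumr; apply: eq_bigr => j _.
rewrite !wcoef3_mid // (sy v i) (sy v j).
by ring.
Qed.

End SymmetricToClifford.

Section TwoSidedIdeal.
Variables (A : nzRingType) (X : set A).
Local Notation ideal := (two_sided_ideal X).

Lemma ideal_mem x : X x -> ideal x.
Proof.
by move=> Xx; exists 1%N, (fun=> 1), (fun=> 1), (fun=> x); rewrite big_ord1 mul1r mulr1.
Qed.

Lemma ideal0 : ideal 0.
Proof.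
by exists 0%N, (fun=> 0), (fun=> 0), (fun=> 0); split=> [[]|] //; rewrite big_ord0.
Qed.

Lemma idealD x y : ideal x -> ideal y -> ideal (x + y).
Proof.
move=> [r [a [b [z [Xz ->]]]]] [r' [a' [b' [z' [Xz' ->]]]]].
exists (r + r')%N, (fun i => match split i with inl i => a i | inr i => a' i end),
  (fun i => match split i with inl i => b i | inr i => b' i end),
  (fun i => match split i with inl i => z i | inr i => z' i end); split.
  by move=> i; case: split.
rewrite big_split_ord /=; congr (_ + _); apply: eq_bigr => i _.
  by rewrite (unsplitK (inl i)).
by rewrite (unsplitK (inr i)).
Qed.

Lemma idealM a b x : ideal x -> ideal (a * x * b).
Proof.
move=> [r [c [d [z [Xz ->]]]]]; exists r, (fun i => a * c i), (fun i => d i * b), z.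
split=> //; rewrite mulr_sumr mulr_suml; apply: eq_bigr => i _.
by rewrite !mulrA.
Qed.

Lemma ideal_sum (J : Type) (s : seq J) (P : pred J) (F : J -> A) :
  (forall j, P j -> ideal (F j)) -> ideal (\sum_(j <- s | P j) F j).
Proof. by move=> iF; elim/big_ind: _ => //; [exact: ideal0 | exact: idealD]. Qed.

End TwoSidedIdeal.

Lemma idealZ (k : fieldType) (A : lalgType k) (X : set A) (c : k) (x : A) :
  two_sided_ideal X x -> two_sided_ideal X (c *: x).
Proof.
by move=> /(idealM c%:A 1); rewrite mulr1 -scalerAl mul1r.
Qed.

Lemma sum_pick (k : fieldType) (J : finType) (c : J -> k) (j : J) :
  \sum_i c i * (j == i)%:R = c j.
Proof.
rewrite (bigD1 j) //= eqxx mulr1 big1 ?addr0 // => i ij.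
by rewrite eq_sym (negbTE ij) mulr0.
Qed.

Lemma symmetric_double_sum (k : fieldType) (M : lmodType k) (I : finType)
    (f : seq I -> k) (e : I -> I -> M) :
  (forall i j, f [:: i; j] = f [:: j; i]) ->
  \sum_i \sum_j f [:: i; j] *: e i j + \sum_i \sum_j f [:: i; j] *: e i j =
  \sum_i \sum_j f [:: i; j] *: (e i j + e j i).
Proof.
move=> fS; rewrite [X in _ + X]exchange_big -big_split; apply: eq_bigr => i _.
by rewrite -big_split; apply: eq_bigr => j _; rewrite /= fS -scalerDr.
Qed.

Section SymmetricToClifford.
Variables (k : fieldType) (V : vectType k).
Hypothesis two_neq0 : (2%:R : k) != 0.
Local Notation T := (tensor_algebra V).
Local Notation n := (\dim {:V}).
Local Notation I := 'I_n.
Local Notation homog := (free_grading (fun=> 1%N)).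
Variables (R : set T) (S : algType k) (pi : {lrmorphism T -> S}).
Hypotheses (R_sub : subspace R) (R_quad : R `<=` tensor_power 2).
Hypothesis pi_R : presents pi R.
Hypothesis R_sym : forall x p q, R x -> wcoef [:: p; q] x = wcoef [:: q; p] x.
Local Notation gr := (tensor_quotient_grading pi).
Variable tau : I -> T.
Hypothesis tau_sym : forall m, symmetric2 (tau m).
Hypothesis tau_free : forall c : I -> k,
  \sum_m c m *: pi (tau m) = 0 -> forall m, c m = 0.
Hypothesis tau_span : forall x, symmetric2 x ->
  exists c : I -> k, pi x = \sum_m c m *: pi (tau m).

Lemma anticommutator_symmetric2 (i j : I) :
  symmetric2 (word k [:: i; j] + word k [:: j; i]).
Proof.
split=> [|p q].
  rewrite -[X in X + _]scale1r; apply: (homog_subspace _ _ 2).2.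
    exact: (@homog_word k _ [:: i; j]).
  exact: (@homog_word k _ [:: j; i]).
have E (w : seq I) : wcoef w (word k [:: i; j] + word k [:: j; i] : T) =
    ([:: i; j] == w)%:R + ([:: j; i] == w)%:R.
  apply: etrans (raddfD (wcoef w : {linear T -> k^o}) _ _) _.
  by congr (_ + _); apply: wcoef_word.
rewrite !E !eqseq_cons !andbT addrC.
by congr (_%:R + _%:R); rewrite andbC.
Qed.

(** An anticommutator does not depend on the order of its letters, and coordinates along the
    independent [pi (tau m)] are unique; hence the symmetry. *)
Lemma structure_matrices : exists G : I -> 'M[k]_n,
  (forall m, (G m)^T = G m) /\ forall i j,
  pi (word k [:: i; j] + word k [:: j; i]) = \sum_m G m i j *: pi (tau m).
Proof.
have /choice[c cP] (p : I * I) := tau_span (anticommutator_symmetric2 p.1 p.2).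
exists (fun m => \matrix_(i, j) c (i, j) m); split=> [m|i j]; last first.
  by rewrite (cP (i, j)); apply: eq_bigr => m _; rewrite mxE.
apply/matrixP => i j; rewrite !mxE; apply/eqP; rewrite -subr_eq0; apply/eqP.
move: m; apply: tau_free; under eq_bigr do rewrite scalerBl.
by rewrite sumrB -(cP (j, i)) -(cP (i, j)) /= [X in _ - pi X]addrC subrr.
Qed.

Variable G : I -> 'M[k]_n.
Hypothesis G_rel : forall i j,
  pi (word k [:: i; j] + word k [:: j; i]) = \sum_m G m i j *: pi (tau m).

Lemma symmetric2_double (x : T) : symmetric2 x ->
  2%:R *: x = \sum_i \sum_j wcoef [:: i; j] x *: (word k [:: i; j] + word k [:: j; i]).
Proof.
move=> [hx sx]; rewrite [LHS]scaler_nat mulr2n.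
apply: etrans (symmetric_double_sum (f := fun s => wcoef s x) (fun i j => word k [:: i; j]) sx).
by apply: (f_equal2 +%R); apply: homog2_expansion.
Qed.

Lemma pi_symmetric2 (x : T) : symmetric2 x ->
  2%:R *: pi x = \sum_m contraction2 (G m) x *: pi (tau m).
Proof.
move=> sx; rewrite -linearZ /= (symmetric2_double sx).
transitivity (\sum_i \sum_j \sum_m (wcoef [:: i; j] x * G m i j) *: pi (tau m)).
  rewrite raddf_sum; apply: eq_bigr => i _; rewrite [LHS](linear_comb pi).
  apply: eq_bigr => j _; rewrite [X in _ *: X]G_rel scaler_sumr.
  by apply: eq_bigr => m _; rewrite scalerA.
under [LHS]eq_bigr => i _ do rewrite exchange_big /=.
rewrite [LHS]exchange_big; apply: eq_bigr => m _; rewrite /contraction2 scaler_suml.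
apply: eq_bigr => i _; rewrite scaler_suml; apply: eq_bigr => j _.
by rewrite mulrC.
Qed.

Lemma contraction2_relation (x : T) m : homog 2 x -> pi x = 0 -> contraction2 (G m) x = 0.
Proof.
move=> hx px; have sx := kernel2_symmetric R_sub R_quad pi_R R_sym hx px.
move: m; apply: (tau_free (c := fun m => contraction2 (G m) x)).
by rewrite -(pi_symmetric2 sx) px scaler0.
Qed.

Lemma contraction2_tau m m' : contraction2 (G m') (tau m) = 2%:R * (m' == m)%:R.
Proof.
apply/eqP; rewrite -subr_eq0; apply/eqP.
move: m'; apply: (tau_free (c := fun m' => contraction2 (G m') (tau m) - 2%:R * (m' == m)%:R)).
under eq_bigr do rewrite scalerBl.
rewrite sumrB -pi_symmetric2 // (bigD1 m) //= eqxx mulr1 big1 ?addr0 ?subrr //.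
by move=> i im; rewrite (negbTE im) mulr0 scale0r.
Qed.

Lemma wcoef_one (w : seq I) : wcoef w (1 : T) = (w == [::])%:R.
Proof. by rewrite -word_nil wcoef_word eq_sym. Qed.

Lemma phi_mul_letter (H : 'M[k]_n) (v v' : I) (y : T) : symmetric2 y ->
  phi H v (y * word k [:: v']) = (v == v')%:R * contraction2 H y /\
  phi H v (word k [:: v'] * y) = (v == v')%:R * contraction2 H y.
Proof.
move=> sy; have w1 : wcoef [:: v] (word k [:: v'] : T) = (v == v')%:R.
  by rewrite wcoef_word eqseq_cons andbT eq_sym.
have w0 : wcoef [::] (word k [:: v'] : T) = 0 by rewrite wcoef_word.
have e1 := wcoef_one [::]; have e0 := wcoef_one [:: v].
split.
  transitivity (phi H v (1 * y * word k [:: v'])); first by rewrite mul1r.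
  apply: etrans (phi_mid H v 1 (word k [:: v']) sy) _; congr (_ * _).
  apply: etrans (congr2 +%R (congr2 *%R e1 w1) (congr2 *%R e0 w0)) _.
  by rewrite mul1r mul0r addr0.
transitivity (phi H v (word k [:: v'] * y * 1)); first by rewrite mulr1.
apply: etrans (phi_mid H v (word k [:: v']) 1 sy) _; congr (_ * _).
apply: etrans (congr2 +%R (congr2 *%R w0 e0) (congr2 *%R w1 e1)) _.
by rewrite mulr1 mul0r add0r.
Qed.

(** The functionals [psi] are independent, as many as the dimension of S_3, and vanish on the
    degree-3 kernel of [pi]; hence their common kernel is that kernel. They vanish on the commutator
    by [phi_mul_letter] and [alt3_mid]. *)
Lemma tau_central h3 m (v : I) : has_dim (gr 3) h3 -> h3 = (n * n + 'C(n, 3))%N ->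
  pi (word k [:: v]) * pi (tau m) = pi (tau m) * pi (word k [:: v]).
Proof.
move=> hdim h3E; have [A [e [A_full piE e_free]]] := graded_coordinates hdim.
pose J : finType := ((I * I) + increasing V 3)%type.
pose psi (q : J) : {linear T -> k^o} :=
  match q with inl p => phi (G p.1) p.2 | inr u => alt3 (tval (val u)) end.
have two_inv : 2%:R^-1 * 2%:R = 1 :> k by rewrite mulVf.
have phi_tau (p q : I * I) : phi (G p.1) p.2 (tau q.1 * word k [:: q.2]) = 2%:R * (p == q)%:R.
  have [E _] := phi_mul_letter (G p.1) p.2 q.2 (tau_sym q.1).
  apply: etrans E _; rewrite contraction2_tau -[p == q]/((p.1 == q.1) && (p.2 == q.2)).
  by case: (p.1 == q.1); case: (p.2 == q.2); rewrite /= ?mulr1 ?mul1r ?mulr0 ?mul0r.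
(* The factor 1/2 offsets the 2 of [contraction2_tau]. *)
pose b0 (p : I * I) : T := 2%:R^-1 *: (tau p.1 * word k [:: p.2]).
have phi_b0 (p q : I * I) : phi (G p.1) p.2 (b0 q) = (p == q)%:R.
  by rewrite linearZ /= phi_tau -[LHS]/(_ * _) mulrA two_inv mul1r.
have alt_b0 u p : alt3 u (b0 p) = 0.
  apply: etrans (linearZ _ _) _; rewrite /= -[X in alt3 _ X]/(tau _ * _) -[tau _]mul1r.
  by rewrite alt3_mid // scaler0.
have hb0 p : homog 3 (b0 p).
  apply: homogZ; apply: (homogM (m := 2) (m' := 1)); first by case: (tau_sym p.1).
  exact: (@homog_word k _ [:: _]).
(* Removing its [phi]-components makes an increasing word dual to its [alt3] functional; [alt3] does
   not notice the correction, as it vanishes on every [b0 p]. *)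
pose b (q : J) : T := match q with inl p => b0 p
  | inr u => word k (val u) - \sum_p phi (G p.1) p.2 (word k (val u)) *: b0 p end.
have comb q w (c : I * I -> k) :
    psi q (w - \sum_p c p *: b0 p) = psi q w - \sum_p c p * psi q (b0 p).
  by apply: etrans (raddfB _ _ _) _; congr (_ - _); apply: linear_comb.
have psi_full : row_full (functional_mx 3 psi).
  apply: (functional_mx_full (b := b)) => [[p|u]|q [p|u]] /=.
  - exact: hb0.
  - rewrite addrC -scaleN1r; apply: (homog_subspace _ _ 3).2.
      by apply: homog_sum => p _; apply: homogZ.
    have /homogP hw := @homog_word k _ (tval (val u)); apply/homogP => w wm.
    by apply: hw; rewrite size_tuple.
  - by case: q => [q|u] /=; [exact: phi_b0 | exact: alt_b0].
  - apply: etrans (comb _ _ _) _; case: q => [q|u'].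
      apply/eqP; rewrite subr_eq0; apply/eqP/esym.
      apply: etrans (sum_pick (fun p => phi (G p.1) p.2 (word k (val u))) q).
      by apply: eq_bigr => p _; apply: (f_equal2 *%R erefl (phi_b0 q p)).
    apply: etrans (congr1 (fun z => alt3 (val u') (word k (val u)) - z) (big1 _ _ _ _)) _.
      by move=> p _; apply: etrans (f_equal2 *%R erefl (alt_b0 (val u') p)) (mulr0 _).
    by rewrite subr0 alt3_increasing.
have psi_mid (a y c : T) : homog 2 y -> pi y = 0 -> forall q, psi q (a * y * c) = 0.
  move=> hy py; have sy := kernel2_symmetric R_sub R_quad pi_R R_sym hy py.
  by case=> [p|u] /=; [rewrite phi_mid // contraction2_relation // mulr0 | rewrite alt3_mid].
have kerA : (kermx A <= kermx (functional_mx 3 psi))%MS.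
  apply/sub_kermxP/row_matrixP => i; rewrite row_mul row0.
  have px : pi (of_row (row i (kermx A))) = 0.
    by apply/(kernel_coordinates _ piE e_free); rewrite -row_mul mulmx_ker row0.
  apply/rowP => q; rewrite functional_mxE [RHS]mxE.
  have [r [a [c [y [Ry ->]]]]] := (pi_R.2 _).1 px.
  rewrite raddf_sum big1 // => j _; apply: psi_mid; first exact: (R_quad (Ry j)).
  exact/pi_R.2/ideal_mem.
(* Both matrices have rank [h3], so the inclusion of kernels is an equality. *)
have kerE : (kermx (functional_mx 3 psi) <= kermx A)%MS.
  rewrite -(mxrank_leqif_sup kerA) !mxrank_ker.
  move: A_full psi_full; rewrite /row_full => /eqP -> /eqP ->.
  by rewrite h3E card_sum card_prod card_ord card_increasing.
apply/eqP; rewrite -subr_eq0 -!rmorphM -raddfB; apply/eqP.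
set x := _ - _; have hx : homog 3 x.
  rewrite /x addrC -scaleN1r; apply: (homog_subspace _ _ 3).2.
    apply: (homogM (m := 2) (m' := 1)); first by case: (tau_sym m).
    exact: (@homog_word k _ [:: _]).
  apply: (homogM (m := 1) (m' := 2)); last by case: (tau_sym m).
  exact: (@homog_word k _ [:: _]).
have psix q : psi q x = 0.
  rewrite /x raddfB; apply/eqP; rewrite subr_eq0; apply/eqP.
  case: q => [p|u] /=.
    have [E1 E2] := phi_mul_letter (G p.1) p.2 v (tau_sym m).
    exact: etrans E2 (esym E1).
  transitivity (alt3 (tval (val u)) (word k [:: v] * tau m * 1)); first by rewrite mulr1.
  transitivity (alt3 (tval (val u)) (1 * tau m * word k [:: v])); last by rewrite mul1r.
  by apply: etrans (alt3_mid _ _ _ (tau_sym m)) (esym (alt3_mid _ _ _ (tau_sym m))).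
have [t xE] := of_row_surj hx; rewrite xE.
apply/(kernel_coordinates _ piE e_free)/sub_kermxP/(submx_trans _ kerE)/sub_kermxP.
by apply/rowP => q; rewrite functional_mxE -xE psix mxE.
Qed.

End SymmetricToClifford.

(** * The Clifford presentation of S *)

Section SymmetricToClifford.
Variables (k : fieldType) (V : vectType k).
Hypothesis two_neq0 : (2%:R : k) != 0.
Local Notation T := (tensor_algebra V).
Local Notation n := (\dim {:V}).
Local Notation I := 'I_n.
Local Notation J := (I + I)%type.
Local Notation CF := (cliff_free k n).
Local Notation homog := (free_grading (fun=> 1%N)).
Variables (R : set T) (S : algType k) (pi : {lrmorphism T -> S}).
Hypotheses (R_sub : subspace R) (R_quad : R `<=` tensor_power 2).
Hypothesis pi_R : presents pi R.
Hypothesis R_sym : forall x p q, R x -> wcoef [:: p; q] x = wcoef [:: q; p] x.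
Local Notation gr := (tensor_quotient_grading pi).
Variable tau : I -> T.
Hypothesis tau_sym : forall m, symmetric2 (tau m).
Hypothesis tau_free : forall c : I -> k,
  \sum_m c m *: pi (tau m) = 0 -> forall m, c m = 0.
Variable G : I -> 'M[k]_n.
Hypothesis G_rel : forall i j,
  pi (word k [:: i; j] + word k [:: j; i]) = \sum_m G m i j *: pi (tau m).
Hypothesis tau_central : forall m v,
  pi (word k [:: v]) * pi (tau m) = pi (tau m) * pi (word k [:: v]).

Definition clifford_forms : n.-tuple 'M[k]_n := [tuple G m | m < n].
Local Notation F := clifford_forms.

Definition clifford_gen (z : J) : S :=
  match z with inl i => pi (word k [:: i]) | inr m => pi (tau m) end.

Definition clifford_map : {lrmorphism CF -> S} := free_eval clifford_gen.

Definition clifford_section : {linear T -> CF} := free_eval (fun i : I => cliff_x k i).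
Local Notation rho := clifford_map.
Local Notation sigma := clifford_section.
Local Notation ideal := (two_sided_ideal (clifford_relations F)).

Lemma clifford_map_word s : rho (word k s) = \prod_(z <- s) clifford_gen z.
Proof. exact: free_eval_word. Qed.

Lemma clifford_section1 : sigma 1 = 1.
Proof. exact: (free_eval_is_monoid_morphism _ (@free_scalerAr k J)).1. Qed.

Lemma clifford_sectionM x y : sigma (x * y) = sigma x * sigma y.
Proof. exact: (free_eval_is_monoid_morphism _ (@free_scalerAr k J)).2. Qed.

Lemma clifford_section_word (s : seq I) : sigma (word k s) = word k (map inl s).
Proof.
apply: etrans (free_eval_word _ _) _; elim: s => [|i s IH].
  by rewrite big_nil -word_nil.
by rewrite big_cons IH [cliff_x k i]gen_word wordM.
Qed.

Lemma clifford_mapK x : rho (sigma x) = pi x.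
Proof.
have E s : rho (sigma (word k s)) = pi (word k s).
  rewrite clifford_section_word clifford_map_word; elim: s => [|i s IH].
    by rewrite big_nil word_nil rmorph1.
  by rewrite big_cons IH /= -rmorphM wordM.
rewrite (word_expansion x) [sigma _](linear_comb sigma) [LHS](linear_comb rho).
by rewrite [RHS](linear_comb pi); apply: eq_bigr => u _; congr (_ *: _); apply: E.
Qed.

Lemma contraction2_comb (M : lmodType k) (y : I -> M) x :
  \sum_m contraction2 (G m) x *: y m =
  \sum_i \sum_j wcoef [:: i; j] x *: \sum_(m < n) (tnth F m) i j *: y m.
Proof.
transitivity (\sum_m \sum_i \sum_j (wcoef [:: i; j] x * G m i j) *: y m).
  apply: eq_bigr => m _; rewrite /contraction2 scaler_suml; apply: eq_bigr => i _.
  by rewrite scaler_suml; apply: eq_bigr => j _; rewrite mulrC.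
rewrite exchange_big; apply: eq_bigr => i _; rewrite exchange_big; apply: eq_bigr => j _.
by rewrite scaler_sumr; apply: eq_bigr => m _; rewrite scalerA tnth_mktuple.
Qed.

(** Written through anticommutators by [symmetric2_double], twice [x] differs from its [y_m]-part by
    a combination of the relations for x_i x_j + x_j x_i. *)
Lemma symmetric2_section x : symmetric2 x ->
  ideal (2%:R *: sigma x - \sum_m contraction2 (G m) x *: cliff_y k m).
Proof.
move=> sx.
have -> : 2%:R *: sigma x - \sum_m contraction2 (G m) x *: cliff_y k m =
    \sum_i \sum_j wcoef [:: i; j] x *: (cliff_x k i * cliff_x k j + cliff_x k j * cliff_x k i
       - \sum_(m < n) (tnth F m) i j *: cliff_y k m).
  transitivity (sigma (\sum_i \sum_j wcoef [:: i; j] x *: (word k [:: i; j] + word k [:: j; i]))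
     - \sum_m contraction2 (G m) x *: cliff_y k m).
    by congr (_ - _); rewrite -symmetric2_double //; apply/esym/linearZ.
  transitivity (\sum_i \sum_j wcoef [:: i; j] x *: (cliff_x k i * cliff_x k j + cliff_x k j * cliff_x k i)
     - \sum_i \sum_j wcoef [:: i; j] x *: \sum_(m < n) (tnth F m) i j *: cliff_y k m).
    congr (_ - _).
      apply: etrans (raddf_sum sigma _ _ _) _; apply: eq_bigr => i _.
      apply: etrans (linear_comb sigma _ _ _) _; apply: eq_bigr => j _; congr (_ *: _).
      rewrite !cliff_xx; apply: etrans (raddfD sigma _ _) _.
      by congr (_ + _); apply: clifford_section_word.
    exact: contraction2_comb.
  rewrite -sumrB; apply: eq_bigr => i _; rewrite -sumrB; apply: eq_bigr => j _.
  exact/esym/scalerBr.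
apply: ideal_sum => i _; apply: ideal_sum => j _; apply/idealZ/ideal_mem.
by exists i, j; constructor 1.
Qed.

Lemma ideal_halve (z : CF) : ideal (2%:R *: z) -> ideal z.
Proof.
by move=> /(idealZ 2%:R^-1); rewrite scalerA mulVf // scale1r.
Qed.

Lemma section_relation x : R x -> ideal (sigma x).
Proof.
move=> Rx; have hx := R_quad Rx.
have px : pi x = 0 by apply/pi_R.2/ideal_mem.
have sx := kernel2_symmetric R_sub R_quad pi_R R_sym hx px.
apply: ideal_halve; have := symmetric2_section sx; rewrite [X in _ - X]big1 ?subr0 //.
move=> m _; rewrite (contraction2_relation R_sub R_quad pi_R R_sym tau_free G_rel) //.
exact: scale0r.
Qed.

Lemma section_kernel x : pi x = 0 -> ideal (sigma x).
Proof.
move=> /pi_R.2[r [a [b [y [Ry ->]]]]].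
rewrite raddf_sum; apply: ideal_sum => i _ /=.
rewrite !clifford_sectionM; apply/idealM/section_relation; exact: Ry.
Qed.

Lemma section_tau m : ideal (cliff_y k m - sigma (tau m)).
Proof.
apply: ideal_halve; have /(idealZ (-1)) := symmetric2_section (tau_sym m).
have -> : \sum_m' contraction2 (G m') (tau m) *: cliff_y k m' = 2%:R *: cliff_y k m :> CF.
  have E m' := contraction2_tau tau_sym tau_free G_rel m m'.
  apply: etrans (eq_bigr _ (fun m' _ => congr1 (fun c => c *: cliff_y k m') (E m'))) _.
  rewrite (bigD1 m) //= eqxx mulr1 big1 => [|i im]; first exact: addr0.
  by rewrite (negbTE im) mulr0 scale0r.
by rewrite scaleN1r opprB scalerBr.
Qed.

(** Modulo the ideal each y_m is the quadratic tensor [tau m] in the x_i ([section_tau]), so the x_i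
    alone generate. *)
Lemma section_surj (z : CF) : exists t, ideal (z - sigma t).
Proof.
have letter (i : J) : exists t, ideal (word k [:: i] - sigma t).
  case: i => [i|m].
    by exists (word k [:: i]); rewrite clifford_section_word subrr; apply: ideal0.
  by exists (tau m); have := section_tau m; rewrite [cliff_y k m]gen_word.
have words s : exists t, ideal (word k s - sigma t).
  elim: s => [|i s [t it]].
    by exists 1; rewrite clifford_section1 word_nil subrr; apply: ideal0.
  have [u iu] := letter i; exists (u * t).
  have -> : word k (i :: s) - sigma (u * t) =
      1 * (word k [:: i] - sigma u) * word k s + sigma u * (word k s - sigma t) * 1.
    rewrite clifford_sectionM mul1r mulr1 mulrBl mulrBr wordM addrA subrK.
    by [].
  by apply: idealD; apply: idealM.
have /choice[t tP] s := words s.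
exists (\sum_(u <- msupp z) wcoef (fmonom_val u) z *: t (fmonom_val u)).
have -> : z - sigma (\sum_(u <- msupp z) wcoef (fmonom_val u) z *: t (fmonom_val u)) =
    \sum_(u <- msupp z) wcoef (fmonom_val u) z *: (word k (fmonom_val u) - sigma (t (fmonom_val u))).
  transitivity (\sum_(u <- msupp z) wcoef (fmonom_val u) z *: word k (fmonom_val u)
    - \sum_(u <- msupp z) wcoef (fmonom_val u) z *: sigma (t (fmonom_val u))).
    by apply: (f_equal2 (fun a b => a - b)); [exact: word_expansion | exact: linear_comb].
  by rewrite -sumrB; apply: eq_bigr => u _; exact/esym/scalerBr.
by apply: ideal_sum => u _; apply/idealZ/tP.
Qed.

Lemma pi_tau_central m x : pi x * pi (tau m) = pi (tau m) * pi x.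
Proof.
rewrite (word_expansion x) [pi _](linear_comb pi) mulr_suml mulr_sumr.
apply: eq_bigr => u _; rewrite -scalerAl -scalerAr; congr (_ *: _) => /=.
elim: (fmonom_val u) => [|i s IH]; first by rewrite word_nil rmorph1 mul1r mulr1.
have step (a b t : S) : a * t = t * a -> b * t = t * b -> a * b * t = t * (a * b).
  by move=> ea eb; rewrite -mulrA eb mulrA ea mulrA.
have E : pi (word k (i :: s)) = pi (word k [:: i]) * pi (word k s).
  by rewrite -[i :: s]/([:: i] ++ s) -wordM; apply: rmorphM.
have H := step _ _ _ (tau_central m i) IH.
exact: etrans (congr1 (fun a => a * _) E) (etrans H (congr1 (fun a => _ * a) (esym E))).
Qed.

Lemma clifford_map_relation z : clifford_relations F z -> rho z = 0.
Proof.
have rx i : rho (cliff_x k i) = pi (word k [:: i]).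
  by rewrite [cliff_x k i]gen_word clifford_map_word big_seq1.
have ry m : rho (cliff_y k m) = pi (tau m).
  by rewrite [cliff_y k m]gen_word clifford_map_word big_seq1.
have rM (a b : CF) (a' b' : S) : rho a = a' -> rho b = b' -> rho (a * b) = a' * b'.
  by move=> <- <-; apply: rmorphM.
have rB (a b : CF) (c : S) : rho a = c -> rho b = c -> rho (a - b) = 0.
  move=> ac bc; apply: etrans (raddfB rho _ _) _.
  exact: etrans (f_equal2 (fun x y => x - y) ac bc) (subrr c).
have rxx i j : rho (cliff_x k i * cliff_x k j) = pi (word k [:: i; j]).
  apply: etrans (rM _ _ _ _ (rx i) (rx j)) _.
  by apply: etrans (esym (rmorphM pi _ _)) (congr1 pi (wordM _ _ _)).
move=> [i [j [] ->]].
- apply: (rB _ _ (\sum_m G m i j *: pi (tau m))).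
    rewrite -G_rel; apply: etrans (raddfD rho _ _) _.
    exact: etrans (f_equal2 +%R (rxx i j) (rxx j i)) (esym (raddfD pi _ _)).
  apply: etrans (linear_comb rho _ _ _) _.
  by apply: eq_bigr => m _; rewrite tnth_mktuple; congr (_ *: _); apply: ry.
- apply: (rB _ _ _ (rM _ _ _ _ (rx i) (ry j))).
  by apply: etrans (rM _ _ _ _ (ry j) (rx i)) _; rewrite pi_tau_central.
- apply: (rB _ _ _ (rM _ _ _ _ (ry i) (ry j))).
  by apply: etrans (rM _ _ _ _ (ry j) (ry i)) _; rewrite pi_tau_central.
Qed.

Lemma clifford_map_ideal z : ideal z -> rho z = 0.
Proof.
move=> [r [a [b [y [Fy ->]]]]]; rewrite raddf_sum big1 // => i _ /=.
by rewrite !rmorphM /= (clifford_map_relation (Fy i)) mulr0 mul0r.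
Qed.

(** Modulo the ideal [z] is some [sigma t]. If [rho z = 0] then [pi t = 0], and [section_kernel]
    puts [sigma t] in the ideal. *)
Lemma clifford_presents : presents rho (clifford_relations F).
Proof.
split=> [a|z].
  by have [x <-] := pi_R.1 a; exists (sigma x); apply: clifford_mapK.
split=> [rz|]; last exact: clifford_map_ideal.
have [t it] := section_surj z.
have pt : pi t = 0.
  have E : rho (z - sigma t) = rho z - rho (sigma t) := raddfB rho _ _.
  have := etrans (esym E) (clifford_map_ideal it); rewrite rz sub0r clifford_mapK.
  by move/eqP; rewrite oppr_eq0 => /eqP.
by rewrite -[z](subrK (sigma t)); apply: idealD it (section_kernel pt).
Qed.

(** Contraction against the [tau m] is, up to the factor 2, a dual family to the [G m]. *)
Lemma clifford_forms_free : free F.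
Proof.
apply/freeP => c c0 m; apply/eqP.
have : \sum_m' c m' * contraction2 (G m') (tau m) = 0.
  transitivity (contraction2 (\sum_(m' < n) c m' *: F`_m') (tau m)).
    rewrite /contraction2; under eq_bigr do rewrite mulr_sumr.
    rewrite exchange_big; apply: eq_bigr => i _.
    under eq_bigr do rewrite mulr_sumr.
    rewrite exchange_big; apply: eq_bigr => j _.
    rewrite summxE mulr_suml; apply: eq_bigr => m' _.
    by rewrite mxE -tnth_nth tnth_mktuple mulrA.
  rewrite c0 /contraction2 big1 // => i _; rewrite big1 // => j _.
  by rewrite mxE mul0r.
rewrite (bigD1 m) //= big1 => [|m' mm'].
  rewrite addr0 (contraction2_tau tau_sym tau_free G_rel) eqxx mulr1 => /eqP.
  by rewrite mulf_eq0 (negbTE two_neq0) orbF.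
by rewrite (contraction2_tau tau_sym tau_free G_rel) (negbTE mm') !mulr0.
Qed.

Lemma gr_mul i j (a b : S) : gr i a -> gr j b -> gr (i + j)%N (a * b).
Proof.
move=> [x hx <-] [y hy <-]; rewrite -rmorphM; exists (x * y) => //.
exact: homogM.
Qed.

Lemma clifford_grading i a : gr i a <-> quotient_grading rho (@cliff_deg n) i a.
Proof.
split=> [[x hx <-]|[z /free_gradingP hz <-]].
  exists (sigma x); last exact: clifford_mapK.
  apply/free_gradingP => w; rewrite (homog_expansion hx).
  rewrite [sigma _](linear_comb sigma) [wcoef w _](linear_comb (wcoef w : {linear CF -> k^o})).
  move=> w0; have [u _ uw] : exists2 u : i.-tuple I, true & map inl u == w :> seq J.
    apply: contrapT => nw; case/eqP: w0; apply: big1 => u _.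
    apply: etrans (congr1 (fun b => _ *: (wcoef w b : k^o)) (clifford_section_word u)) _.
    rewrite wcoef_word; case: eqP => [E|_]; last exact: scaler0.
    by case: nw; exists u => //; apply/eqP.
  by rewrite -(eqP uw) big_map sum1_size size_tuple.
have subS : subspace (gr i).
  split=> [|c _ _ [x hx <-] [y hy <-]].
    by exists 0; [exact: (homog_subspace k _ i).1 | exact: raddf0].
  exists (c *: x + y); first exact: (homog_subspace k _ i).2.
  by rewrite linearP.
rewrite (word_expansion z) [rho _](linear_comb rho).
have {hz}hz u : u \in msupp z -> (\sum_(x <- fmonom_val u) cliff_deg x)%N = i.
  by move=> uz; apply: hz; rewrite /wcoef fmK mcoeff_neq0.
have gw (s : seq J) : gr (\sum_(x <- s) cliff_deg x)%N (rho (word k s)).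
  rewrite clifford_map_word; elim: s => [|x s IH].
    rewrite !big_nil; exists 1; last exact: rmorph1.
    by rewrite -word_nil; apply: homog_word.
  rewrite !big_cons; apply: gr_mul => //.
  case: x => [j|m] /=.
    by exists (word k [:: j]); [exact: (@homog_word k _ [:: j]) | by []].
  by exists (tau m); [case: (tau_sym m) | by []].
rewrite big_seq; apply: subspace_sum => // u uz.
by rewrite -[i](hz u uz); apply: gw.
Qed.

End SymmetricToClifford.

Theorem clifford_of_symmetric (k : fieldType) (V : vectType k) (n : nat)
    (R : set (tensor_algebra V)) (S : algType k) (pi : {lrmorphism tensor_algebra V -> S}) :
  (2%:R : k) != 0 -> subspace R -> R `<=` tensor_power 2 -> presents pi R ->
  quantum_polynomial_algebra (tensor_quotient_grading pi) n ->
  (forall x p q, R x -> wcoef [:: p; q] x = wcoef [:: q; p] x) ->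
  clifford_quantum_polynomial_algebra n (tensor_quotient_grading pi).
Proof.
move=> two_neq0 R_sub R_quad pi_R qpa R_sym; split=> //.
have [_ _ _ _ /hilbert_values[h [hdim h1 h2 h3]]] := qpa.
(* In degree 1 [pi] is a bijection onto a space of dimension [n], so the basis of [V] can index the
   generators of the Clifford algebra. *)
have dimV : \dim {:V} = n.
  have [A [e [A_full piE e_free]]] := graded_coordinates (hdim 1%N).
  have A_free : row_free A.
    apply: inj_row_free => t tA.
    have p0 : pi (of_row t) = 0 by apply/(kernel_coordinates _ piE e_free).
    have t0 := kernel1 R_quad pi_R (@of_row_homog _ _ _ t) p0.
    apply/rowP => q; rewrite mxE -[q]enum_valK -wcoef_of_row t0.
    exact: raddf0.
  move: A_free A_full; rewrite /row_free /row_full => /eqP-> /eqP.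
  by rewrite h1 card_tuple card_ord expn1.
rewrite -dimV in h2 h3 *.
have [tau [tau_sym tau_free tau_span]] :=
  symmetric_image_basis R_sub R_quad pi_R R_sym (hdim 2) h2.
have [G [G_sym G_rel]] := structure_matrices tau_free tau_span.
have central m v := tau_central two_neq0 R_sub R_quad pi_R R_sym tau_sym tau_free G_rel
  m v (hdim 3) h3.
exists (clifford_forms G); split.
- exact: (clifford_forms_free two_neq0 tau_sym tau_free G_rel).
- by move=> m; rewrite tnth_mktuple G_sym.
(* [S] itself serves as the Clifford algebra, and the isomorphism is the identity. *)
- exists S, (clifford_map pi tau); split.
    exact: (clifford_presents two_neq0 R_sub R_quad pi_R R_sym tau_sym tau_free G_rel central).
  exists (idfun : {lrmorphism S -> S}); split; first by exists idfun.
  move=> i a; exact: (clifford_grading pi tau_sym).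
Qed.

Theorem proposition3p12 (k : closedFieldType) (char_k : [pchar k] =i pred0)
    (V : vectType k) (n : nat) (n_ge2 : (2 <= n)%N)
    (R : set (tensor_algebra V)) (R_sub : subspace R)
    (R_quadratic : R `<=` tensor_power 2)
    (S : algType k) (pi : {lrmorphism tensor_algebra V -> S})
    (S_def : presents pi R)
    (S_qpa : quantum_polynomial_algebra (tensor_quotient_grading pi) n) :
  clifford_quantum_polynomial_algebra n (tensor_quotient_grading pi) <->
  exists w : tensor_algebra V,
    symmetric_tensors n w /\ presents pi (derivation_relations w (n - 2)%N).
Proof.
split=> [[_ [F [_ _ [C [rho [rhoP iso]]]]]]|[w [w_sym w_pres]]].
  apply: (symmetric_potential n_ge2 R_sub R_quadratic S_def S_qpa) => x p q.
  exact: (clifford_relations_symmetric R_quadratic S_def rhoP iso).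
(* Characteristic 0 makes 2 invertible, as required for halving anticommutators. *)
have two_neq0 : (2%:R : k) != 0 by have /GRing.pcharf0P -> := char_k.
apply: (clifford_of_symmetric two_neq0 R_sub R_quadratic S_def S_qpa) => x p q Rx.
apply: (relations_symmetric (pi := pi) p q n_ge2 w_sym w_pres (R_quadratic _ Rx)).
exact/S_def.2/ideal_mem.
Qed.
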